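(* Let $Z\subset S^1$ be an admissible discrete subset with set of limit points $L(Z)$, and let $\mathcal S$ be a cluster in $\mathcal C_{can}(Z)$. Then the following statements are equivalent: (1) The cluster $\mathcal S$ is a triangulation cluster. (2) For every sequence of objects $E(x_i,y_i)$ in $\mathcal S$ and every $w\in L(Z)$, the points $x_i$ converge to $w$ if and only if the points $y_i$ converge to the same point $w$.
   Context: A subset $Z\subset S^1$ is an admissible discrete subset if: (1) every element of $Z$ has an open neighborhood in $S^1$ containing no other element of $Z$; (2) every point of $S^1$ which is a limit point of $Z$ is a limit of $Z$ from both sides; (3) $Z$ has at least four elements. Then each $z\in Z$ has a successor $z^+\in Z$ and predecessor $z^-\in Z$. $L(Z)\subset S^1$ is the set of limit points of $Z$. $\mathcal C_{can}(Z)$ is the triangulated category associated to the cyclically ordered set $Z$ with its canonical automorphism $z\mapsto z^+$ (the stable category of a Frobenius category of matrix factorizations of $t$ over $k[[t]]$). For the present statement only the following is needed: its indecomposable objects, up to isomorphism, are $E(x,y)\cong E(y,x)$ for $x,y\in Z$ with $y\neq x,x^+,x^-$; to $E(x,y)$ one associates the closed hyperbolic geodesic $\widehat{xy}$ in the closed unit disk $D^2$ (Poincaré model) with endpoints $x,y$; two such objects are compatible if and only if their geodesics do not cross in the interior of $D^2$. A cluster is a maximal set of pairwise compatible, pairwise nonisomorphic indecomposable objects. The simplicial complex $K(\mathcal S)$ has vertex set $Z$; $\{x,y\}$ is a 1-simplex iff either $E(x,y)\in\mathcal S$ (up to isomorphism) or $y\in\{x^+,x^-\}$; $\{x,y,z\}$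 is a 2-simplex iff all three pairs are 1-simplices; there are no higher simplices. The map $\psi_{\mathcal S}:|K(\mathcal S)|\to D^2$ from the geometric realization (weak topology) sends each vertex to itself, each 1-simplex $\{z,z^+\}$ homeomorphically to the arc of $S^1$ from $z$ to $z^+$, every other 1-simplex $\{x,y\}$ homeomorphically to $\widehat{xy}$, and each 2-simplex by a homeomorphism (extending the given boundary map) onto the closed region of $D^2$ enclosed by the image of its boundary. The cluster $\mathcal S$ is a triangulation cluster if $\psi_{\mathcal S}$ is a homeomorphism of $|K(\mathcal S)|$ onto $D^2\setminus L(Z)$. *)

(* Defs.v *)
From HB Require Import structures.
From mathcomp Require Import all_boot all_order all_algebra finmap.
From mathcomp Require Import all_classical all_reals all_analysis.

Set Implicit Arguments.
Unset Strict Implicit.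
Unset Printing Implicit Defensive.

Import Order.TTheory GRing.Theory Num.Theory.
Import numFieldNormedType.Exports.

Local Open Scope classical_set_scope.
Local Open Scope ring_scope.

Notation plane R := (R * R)%type.

Definition homeo_onto (X Y : topologicalType) (A : set X) (B : set Y)
    (f : X -> Y) : Prop :=
  [/\ set_bij A B f,
      {within A, continuous f} &
      exists g : Y -> X,
        {within B, continuous g} /\ (forall x, A x -> g (f x) = x)].

Section Realization.
Context (R : realType) (V : choiceType).

(* Barycentric coordinates: the closed simplex spanned by s. *)
Definition simplex (s : {fset V}) : set (V -> R) :=
  [set f | [/\ forall v, 0 <= f v,
               forall v, v \notin s -> f v = 0 &
               \sum_(v <- s) f v = 1]].

(* K is the set of simplices of a simplicial complex, as finite vertex sets. *)
Definition realization (K : set {fset V}) : Type :=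
  {f : V -> R | exists s, K s /\ simplex s f}.

Context (K : set {fset V}).

HB.instance Definition _ := gen_eqMixin (realization K).
HB.instance Definition _ := gen_choiceMixin (realization K).

Definition face (s : {fset V}) : set (realization K) :=
  [set p | simplex s (sval p)].

Definition face_boundary (s : {fset V}) : set (realization K) :=
  [set p | simplex s (sval p) /\ exists v, v \in s /\ sval p v = 0].

(* U is open iff its trace on each closed simplex is relatively open.  Points
   of a closed simplex vanish off a fixed finite set, so the pointwise topology
   induces on it the Euclidean one. *)
Definition weak_open (U : set (realization K)) : Prop :=
  forall s, K s -> exists W : set {ptws V -> R},
    open W /\ forall p : realization K, face s p -> (U p <-> W (sval p)).

Lemma weak_openT : weak_open setT.
Proof. by move=> s _; exists setT; split=> //; exact: openT. Qed.

Lemma weak_openI : setI_closed weak_open.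
Proof.
move=> U U' oU oU' s Ks.
have [W [oW WE]] := oU s Ks; have [W' [oW' WE']] := oU' s Ks.
exists (W `&` W'); split; first exact: openI.
by move=> p ps; split=> -[/(WE _ ps) ? /(WE' _ ps) ?].
Qed.

Lemma weak_open_bigU (I : Type) (F : I -> set (realization K)) :
  (forall i, weak_open (F i)) -> weak_open (\bigcup_i F i).
Proof.
move=> oF s Ks; have /choice[W WE] := fun i => oF i s Ks.
exists (\bigcup_i W i); split; first by apply: bigcup_open => i _; case: (WE i).
move=> p ps; split=> -[i _ Fip]; exists i => //.
- by apply/(WE i).2.
- by apply/((WE i).2 p ps).
Qed.

HB.instance Definition _ := isOpenTopological.Build (realization K)
  weak_openT weak_openI weak_open_bigU.

End Realization.

Section Disk.
Context {R : realType}.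
Implicit Types (p x y z w c : plane R) (Z J : set (plane R)).

Definition sqnorm p : R := p.1 ^+ 2 + p.2 ^+ 2.

Definition D2 : set (plane R) := [set p | sqnorm p <= 1].
Definition S1 : set (plane R) := [set p | sqnorm p = 1].

Definition circ (t : R) : plane R := (cos t, sin t).

(* The closed arc of S1 running counterclockwise from x to y ([set x] if
   x = y). *)
Definition arc x y : set (plane R) :=
  [set p | exists a b t, [/\ x = circ a, y = circ b, a <= b < a + pi *+ 2,
                             a <= t <= b & p = circ t]].

(* For x != y in S1: the part in D2 of the diameter through x and y if these
   are antipodal, and otherwise of the circle through x and y orthogonal to
   S1.  The circle of centre c and radius r is orthogonal to S1 iff
   |c|^2 = 1 + r^2. *)
Definition geodesic x y : set (plane R) :=
  [set p | D2 p /\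
    ((x + y = 0 /\ exists t : R, p = t *: x) \/
     exists c (r : R), [/\ 0 < r, sqnorm c = 1 + r ^+ 2,
       sqnorm (x - c) = r ^+ 2, sqnorm (y - c) = r ^+ 2 &
       sqnorm (p - c) = r ^+ 2])].

(* Geodesics sharing an endpoint meet only on S1, and a geodesic does not cross
   itself. *)
Definition cross (A B : set (plane R)) : Prop :=
  A <> B /\ exists p, [/\ A p, B p & sqnorm p < 1].

(* J together with the bounded components of its complement. *)
Definition enclosed J : set (plane R) :=
  [set p | J p \/ (~ J p /\ bounded_set (connected_component (~` J) p))].

Definition limit_set Z : set (plane R) := S1 `&` limit_point Z.

Definition admissible Z : Prop :=
  [/\ Z `<=` S1,
      forall z, Z z -> exists U, [/\ open U, U z & U `&` Z = [set z]],
      forall a : R, limit_set Z (circ a) -> forall e : R, 0 < e ->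
        (exists t, a < t < a + e /\ Z (circ t)) /\
        (exists t, a - e < t < a /\ Z (circ t)) &
      (`I_4 #<= Z)%card].

(* succ Z x y means y = x^+, equivalently x = y^-. *)
Definition succ Z x y : Prop :=
  [/\ Z x, Z y, x <> y & arc x y `&` Z = [set x; y]].

(* Isomorphism classes of indecomposables: the only isomorphisms are
   E(x,y) = E(y,x), so the class of E(x,y) is encoded by {x,y}. *)
Definition E x y : {fset plane R} := [fset x; y]%fset.

Definition indecomposable Z : set {fset plane R} :=
  [set e | exists x y, [/\ Z x, Z y, x <> y, ~ succ Z x y & ~ succ Z y x] /\
                       e = E x y].

Definition compatible (e f : {fset plane R}) : Prop :=
  forall x y u v, e = E x y -> f = E u v ->
    ~ cross (geodesic x y) (geodesic u v).

Definition pairwise_compatible Z (S : set {fset plane R}) : Prop :=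
  S `<=` indecomposable Z /\ forall e f, S e -> S f -> compatible e f.

Definition is_cluster Z (S : set {fset plane R}) : Prop :=
  pairwise_compatible Z S /\
  forall T, pairwise_compatible Z T -> S `<=` T -> T = S.

Definition is_edge Z (S : set {fset plane R}) x y : Prop :=
  [\/ S (E x y), succ Z x y | succ Z y x].

Definition cluster_complex Z (S : set {fset plane R}) : set {fset plane R} :=
  [set s | [\/ exists x, Z x /\ s = [fset x]%fset,
               exists x y, is_edge Z S x y /\ s = [fset x; y]%fset |
               exists x y z,
                 [/\ is_edge Z S x y, is_edge Z S y z & is_edge Z S x z] /\
                 s = [fset x; y; z]%fset]].

Definition cluster_map Z (S : set {fset plane R})
    (psi : realization R (cluster_complex Z S) -> plane R) : Prop :=
  [/\ forall z q, Z z -> face [fset z]%fset q -> psi q = z,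
      forall x y, succ Z x y ->
        homeo_onto (face [fset x; y]%fset) (arc x y) psi,
      forall x y, S (E x y) ->
        homeo_onto (face [fset x; y]%fset) (geodesic x y) psi &
      forall x y z, is_edge Z S x y -> is_edge Z S y z -> is_edge Z S x z ->
        homeo_onto (face [fset x; y; z]%fset)
          (enclosed (psi @` face_boundary [fset x; y; z]%fset)) psi].

(* psi is only determined up to the choice of the homeomorphisms on the
   individual simplices. *)
Definition triangulation_cluster Z (S : set {fset plane R}) : Prop :=
  exists psi : realization R (cluster_complex Z S) -> plane R,
    cluster_map psi /\ homeo_onto setT (D2 `\` limit_set Z) psi.

End Disk.

(* Main.v *)
(** In the Klein model hyperbolic geodesics are straight chords, and the plane
    homeomorphism [kinv], the identity outside the disk, carries chords to
    geodesics; so everything is proved for chords and transported.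

    If [psi] is a homeomorphism and [x_i] tends to a limit point [w] while [y_i]
    clusters at some [v <> w], then the midpoints of the chords cluster at an
    interior point of the disk.  Their preimages lie in distinct open edges,
    each closed simplex contains finitely many of them, and so they form a
    closed discrete set in the weak topology: a contradiction.

    Conversely, the convergence condition makes the family of edges locally
    finite away from the limit points.  Hence vertices have finite degree, each
    chord has a triangle on either side, and a point off the limit set lies in
    the triangle next to the last chord met on the way to it.  Distinct triangles
    are separated by a chord, so the cone-wise maps of the triangles glue to a
    bijection, whose inverse is continuous by local finiteness. *)

Require Import Defs.
From HB Require Import structures.
From mathcomp Require Import all_boot all_order all_algebra finmap.
From mathcomp Require Import all_classical all_reals all_analysis.
From mathcomp Require Import ring lra.

Set Implicit Arguments.
Unset Strict Implicit.
Unset Printing Implicit Defensive.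

Import Order.TTheory GRing.Theory Num.Theory.
Import numFieldNormedType.Exports.

Local Open Scope classical_set_scope.
Local Open Scope ring_scope.

(** * Finite sets, limit points and restricted homeomorphisms *)

Section Preliminaries.
Context {R : realType}.

(** A side joining [z] to [z^+] is an arc of [S1] even in the Klein model, so a triangle need not be
    the convex hull of its vertices. It is still convex: the disk cut by one half-plane for each
    side that lies in [S]. This makes the cone from the centroid available.

    The hypothesis on sequences speaks of edges in [S] only. The sides joining neighbours are
    brought in through caps, the parts of the disk cut off by chords between points of [Z] close to
    a limit point; they exist because limit points are two-sided. A cap is cut out by a half-plane,
    so chords and triangles with vertices in it stay in it; for arcs this requires a further point
    of [Z] outside the cap, to prevent the arc from running the other way round.

    Order arguments on the circle are reduced to signs of [det], and these to linear inequalities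
    between angles. *)

Lemma finite_min (T : Type) (A : set T) (f : T -> R) : finite_set A -> A !=set0 ->
  exists2 t, A t & forall t', A t' -> f t <= f t'.
Proof.
elim/Pchoice: T => T in A f * => /finite_seqP[s ->]; elim: s => [[]//|a s IH _].
have [[b bs]|s0] := pselect ([set` s] !=set0); last first.
  exists a => /=; first by rewrite inE eqxx.
  move=> y /=; rewrite inE => /orP[/eqP -> //|ys].
  by case: s0; exists y.
have [|m ms mmin] := IH; first by exists b.
have [am|/ltW ma] := leP (f a) (f m).
  exists a => /=; first by rewrite inE eqxx.
  move=> y /=; rewrite inE => /orP[/eqP -> //|ys].
  exact: le_trans am (mmin y ys).
exists m => /=; first by rewrite inE (ms : m \in s) orbT.
by move=> y /=; rewrite inE => /orP[/eqP -> //|ys]; exact: mmin.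
Qed.

(** The sets containing all but finitely many points of [A] form a proper filter, and any cluster
    point of it is a limit point of [A]. *)
Lemma infinite_limit_point (T : topologicalType) (A K : set T) :
  compact K -> A `<=` K -> infinite_set A -> exists2 w, K w & limit_point A w.
Proof.
move=> cK AK iA; pose F := [set B : set T | finite_set (A `\` B)].
have FF : ProperFilter F.
  split; first by rewrite /F /= setD0.
  split.
  - by rewrite /F /= setDT; exact: finite_set0.
  - by move=> P Q; rewrite /F /= setDIr finite_setU.
  - move=> P Q PQ; apply: sub_finite_set => x [Ax nQ]; split=> //; exact: contra_not (PQ x) nQ.
have [|w [Kw cw]] := cK F FF.
  by rewrite /F /= (_ : A `\` K = set0) ?finite_set0 //; apply/seteqP; split=> // x [/AK].
exists w => // U Uw; have [|y [[Ay yw] Uy]] := cw (A `\ w) U _ Uw.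
  by apply: (@sub_finite_set _ _ [set w]); [move=> x [Ax]; apply: contra_notP => xw|exact: finite_set1].
by exists y; split=> //; apply/eqP.
Qed.

(** Lets a point of the realization pass between any two simplices that carry it. *)
Lemma sum_support_eq (V : choiceType) (s s' : {fset V}) (f : V -> R) :
  (forall v, v \notin s -> f v = 0) -> (forall v, v \notin s' -> f v = 0) ->
  \sum_(v <- s) f v = \sum_(v <- s') f v.
Proof.
move=> h h'; transitivity (\sum_(v <- (s `|` s')%fset) f v).
  by apply: big_fset_incl => [|v _ vs]; [exact: fsubsetUl|exact: h].
by apply/esym; apply: big_fset_incl => [|v _ vs]; [exact: fsubsetUr|exact: h'].
Qed.

Lemma fset3_rot (T : choiceType) (x y z : T) : [fset y; z; x]%fset = [fset x; y; z]%fset.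
Proof. by rewrite fsetUC fsetUA. Qed.

Lemma cvg_min_fun (T : topologicalType) (f g : T -> R) t : {for t, continuous f} ->
  {for t, continuous g} -> {for t, continuous (fun t => Num.min (f t) (g t))}.
Proof. exact: (@continuous_min R T f g t). Qed.

Lemma cvg_triple (T : Type) (F : set_system T) (FF : Filter F) (a b c : T -> R) (la lb lc : R) :
  a @ F --> la -> b @ F --> lb -> c @ F --> lc ->
  (fun t => (a t, b t, c t)) @ F --> (la, lb, lc).
Proof.
move=> ha hb hc; apply: (@cvg_pair _ _ _ _ (nbhs (la, lb)) (nbhs lc)) => //.
exact: (@cvg_pair _ _ _ _ (nbhs la) (nbhs lb)).
Qed.

(** One global left inverse, continuous on [D], serves all restrictions at once; so the
    homeomorphisms on single simplices required by [cluster_map] reduce to computing images. *)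
Lemma homeo_onto_image (X Y : topologicalType) (f : X -> Y) (g : Y -> X) (D B : set Y) (A : set X) :
  continuous f -> cancel f g -> {within D, continuous g} -> B `<=` D -> f @` A = B ->
  homeo_onto A B f.
Proof.
move=> cf gK cg BD AB; split.
- split.
  + by move=> q Aq; rewrite -AB; exists q.
  + by move=> q q' _ _; exact: can_inj gK _ _.
  + by rewrite -AB.
- exact: continuous_subspaceT.
- by exists g; split=> //; exact: continuous_subspaceW cg.
Qed.

End Preliminaries.

(** * Chords of the unit disk *)

Section Chords.
Context {R : realType}.
Implicit Types (p q r x y z u v : plane R).

(** Twice the signed area of the triangle [x y p]: positive iff [p] is to the left of the directed
    line from [x] to [y], hence, for points of [S1], iff [x], [y], [p] are in counterclockwise
    order. *)
Definition det x y p : R :=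
  (y.1 - x.1) * (p.2 - x.2) - (y.2 - x.2) * (p.1 - x.1).

Definition mix (k : R) p q : plane R := (1 - k) *: p + k *: q.

Lemma mixE k p q :
  mix k p q = ((1 - k) * p.1 + k * q.1, (1 - k) * p.2 + k * q.2).
Proof. by []. Qed.

Lemma mix0 p q : mix 0 p q = p.
Proof. by rewrite mixE [RHS]surjective_pairing; congr pair; ring. Qed.

Lemma mix1 p q : mix 1 p q = q.
Proof. by rewrite mixE [RHS]surjective_pairing; congr pair; ring. Qed.

Lemma det_mix x y k p q : det x y (mix k p q) = (1 - k) * det x y p + k * det x y q.
Proof. by rewrite mixE /det /=; ring. Qed.

Lemma det_cyc x y p : det x y p = det y p x.
Proof. by rewrite /det; ring. Qed.

Lemma det_swap x y p : det y x p = - det x y p.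
Proof. by rewrite /det; ring. Qed.

Lemma det_xx x p : det x x p = 0. Proof. by rewrite /det; ring. Qed.
Lemma det_xyx x y : det x y x = 0. Proof. by rewrite /det; ring. Qed.
Lemma det_xyy x y : det x y y = 0. Proof. by rewrite /det; ring. Qed.

Lemma plane_eqP p q : p.1 = q.1 -> p.2 = q.2 -> p = q.
Proof. by case: p q => [a b] [c d] /= -> ->. Qed.

Lemma dot_lt1 x y : S1 x -> S1 y -> x <> y -> x.1 * y.1 + x.2 * y.2 < 1.
Proof.
rewrite /S1 /sqnorm /= => hx hy nxy.
have : 0 < (x.1 - y.1) ^+ 2 + (x.2 - y.2) ^+ 2.
  rewrite lt_neqAle addr_ge0 ?sqr_ge0 // andbT eq_sym paddr_eq0 ?sqr_ge0 //.
  rewrite !sqrf_eq0 !subr_eq0; apply/negP => /andP[/eqP h1 /eqP h2].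
  by apply: nxy; apply: plane_eqP.
nra.
Qed.

Lemma line_param x y p : x <> y -> det x y p = 0 -> exists k, p = mix k x y.
Proof.
rewrite /det => nxy d0.
have [e1|n1] := eqVneq (y.1 - x.1) 0.
  have n2 : y.2 - x.2 != 0.
    rewrite subr_eq0; apply/eqP => e2; apply: nxy; apply: plane_eqP => //.
    by move/eqP: e1; rewrite subr_eq0 => /eqP.
  exists ((p.2 - x.2) / (y.2 - x.2)); rewrite mixE; apply: plane_eqP => /=; last by field.
  have : (y.2 - x.2) * (p.1 - x.1) = 0 by move: d0; rewrite e1; lra.
  move/eqP; rewrite mulf_eq0 (negbTE n2) /= subr_eq0 => /eqP ->.
  by move/eqP: e1; rewrite subr_eq0 => /eqP ->; ring.
exists ((p.1 - x.1) / (y.1 - x.1)); rewrite mixE; apply: plane_eqP => /=; first by field.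
have -> : p.2 = x.2 + (y.2 - x.2) * (p.1 - x.1) / (y.1 - x.1).
  apply: (@mulIf _ (y.1 - x.1)) => //; rewrite mulrDl divfK //.
  by move: d0; lra.
by field.
Qed.

Lemma sqnorm_mix k p q : sqnorm (mix k p q) =
  (1 - k) * sqnorm p + k * sqnorm q
  - k * (1 - k) * ((p.1 - q.1) ^+ 2 + (p.2 - q.2) ^+ 2).
Proof. by rewrite mixE /sqnorm /=; ring. Qed.

Lemma sqnorm_chord k x y : S1 x -> S1 y ->
  sqnorm (mix k x y) = 1 - 2 * k * (1 - k) * (1 - (x.1 * y.1 + x.2 * y.2)).
Proof.
rewrite /S1 /= => hx hy; rewrite sqnorm_mix hx hy.
have -> : (x.1 - y.1) ^+ 2 + (x.2 - y.2) ^+ 2 = 2 * (1 - (x.1 * y.1 + x.2 * y.2)).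
  by move: hx hy; rewrite /sqnorm; lra.
ring.
Qed.

Lemma chordP x y p : S1 x -> S1 y -> x <> y -> D2 p -> det x y p = 0 ->
  exists2 k, 0 <= k <= 1 & p = mix k x y.
Proof.
move=> hx hy nxy dp /(line_param nxy)[k pE]; exists k => //.
move: dp; rewrite /D2 /= pE sqnorm_chord //.
have := dot_lt1 hx hy nxy; set d := _ + _ => d1 h.
have h0 : 0 <= k * (1 - k) by nra.
by nra.
Qed.

Lemma open_chordP x y p : S1 x -> S1 y -> x <> y -> sqnorm p < 1 -> det x y p = 0 ->
  exists2 k, 0 < k < 1 & p = mix k x y.
Proof.
move=> hx hy nxy dp d0.
have [|k /andP[k0 k1] pE] := chordP hx hy nxy _ d0; first exact: ltW.
exists k => //; rewrite !lt_neqAle k0 k1 !andbT eq_sym.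
apply/andP; split; apply/eqP => kE; move: dp; rewrite pE kE ?mix0 ?mix1.
  by rewrite (hx : sqnorm x = 1) ltxx.
by rewrite (hy : sqnorm y = 1) ltxx.
Qed.

Lemma open_chord_lt1 x y k : S1 x -> S1 y -> x <> y -> 0 < k < 1 -> sqnorm (mix k x y) < 1.
Proof.
move=> hx hy nxy hk; rewrite sqnorm_chord //.
have := dot_lt1 hx hy nxy; set d := _ + _ => d1.
have : 0 < k * (1 - k) * (1 - d) by rewrite !mulr_gt0 //; lra.
by lra.
Qed.

Lemma D2_mix k p q : 0 <= k <= 1 -> D2 p -> D2 q -> D2 (mix k p q).
Proof.
rewrite /D2 /= => /andP[k0 k1] hp hq; rewrite sqnorm_mix.
have h1 : 0 <= (p.1 - q.1) ^+ 2 + (p.2 - q.2) ^+ 2 by rewrite addr_ge0 ?sqr_ge0.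
have : 0 <= k * (1 - k) * ((p.1 - q.1) ^+ 2 + (p.2 - q.2) ^+ 2).
  by rewrite !mulr_ge0 //; lra.
by nra.
Qed.

Lemma sqnorm_mix_lt1 k p q : 0 <= k < 1 -> sqnorm p < 1 -> D2 q ->
  sqnorm (mix k p q) < 1.
Proof.
rewrite /D2 /= => /andP[k0 k1] hp hq; rewrite sqnorm_mix.
have h1 : 0 <= (p.1 - q.1) ^+ 2 + (p.2 - q.2) ^+ 2 by rewrite addr_ge0 ?sqr_ge0.
have : 0 <= k * (1 - k) * ((p.1 - q.1) ^+ 2 + (p.2 - q.2) ^+ 2).
  by rewrite !mulr_ge0 //; lra.
by nra.
Qed.

Lemma D2_S1 x : S1 x -> D2 x.
Proof. by rewrite /S1 /D2 /= => ->. Qed.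

Lemma det_eq0_S1 x y p : S1 x -> S1 y -> x <> y -> S1 p -> det x y p = 0 -> p = x \/ p = y.
Proof.
move=> hx hy nxy hp /(line_param nxy)[k pE].
have := hp; rewrite /S1 /= pE sqnorm_chord //.
have := dot_lt1 hx hy nxy; set d := _ + _ => d1 h.
have : k * (1 - k) == 0.
  have : k * (1 - k) * (1 - d) == 0 by apply/eqP; lra.
  by rewrite mulf_eq0 => /orP[//|/eqP]; lra.
rewrite mulf_eq0 => /orP[/eqP ->|/eqP k1]; first by left; rewrite mix0.
by right; have -> : k = 1 by [lra]; rewrite mix1.
Qed.

Lemma circ_S1 t : S1 (circ t : plane R).
Proof. by rewrite /S1 /sqnorm /= cos2Dsin2. Qed.

Lemma circD2pi t : circ (t + pi *+ 2) = circ t :> plane R.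
Proof. by rewrite /circ cosD2pi sinD2pi. Qed.

Lemma circ_ex0 p : S1 p -> exists2 t, 0 <= t < pi *+ 2 & p = circ t.
Proof.
rewrite /S1 /sqnorm /= => hp.
have hp1 : -1 <= p.1 <= 1 by nra.
have a0 := acos_ge0 hp1; have api := acos_lepi hp1.
have cE : cos (acos p.1) = p.1 by rewrite acosK // in_itv.
have pi0 := pi_gt0 R.
have sq : Num.sqrt (1 - p.1 ^+ 2) = `|p.2|.
  by rewrite -sqrtr_sqr; congr Num.sqrt; lra.
have [p2|p2] := leP 0 p.2.
  exists (acos p.1); first by rewrite mulr2n; lra.
  by apply: plane_eqP; rewrite /= ?cE // sin_acos // sq ger0_norm.
exists (pi *+ 2 - acos p.1).
  have : acos p.1 != 0.
    apply/eqP => e; have := cE; rewrite e cos0 => e1; move: hp p2; rewrite -e1; nra.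
  rewrite mulr2n => n0; apply/andP; split; first lra.
  have : 0 < acos p.1 by rewrite lt_neqAle eq_sym n0.
  lra.
apply: plane_eqP; rewrite /=.
  by rewrite cosB cos2pi sin2pi cE; ring.
by rewrite sinB cos2pi sin2pi sin_acos // sq ltr0_norm //; ring.
Qed.

Lemma circ_ex (a : R) p : S1 p -> exists2 t, a <= t < a + pi *+ 2 & p = circ t.
Proof.
rewrite /S1 /sqnorm /= => hp.
(* [p] rotated by [- a], which reduces the claim to the period starting at 0. *)
pose p' : plane R := (p.1 * cos a + p.2 * sin a, p.2 * cos a - p.1 * sin a).
have cs := cos2Dsin2 a.
have cs2 : cos a ^+ 2 = 1 - sin a ^+ 2 by lra.
have hp2 : p.1 ^+ 2 = 1 - p.2 ^+ 2 by lra.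
have hp' : S1 p' by rewrite /S1 /sqnorm /=; ring: hp2 cs2.
have [t ht pE] := circ_ex0 hp'; exists (a + t); first lra.
have [e1 e2] : cos t = p'.1 /\ sin t = p'.2 by rewrite pE.
apply: plane_eqP => /=; rewrite ?cosD ?sinD e1 e2 /=; ring: cs2.
Qed.

(** The area formula for an inscribed triangle: chord lengths are twice the sines of half the angle
    differences, and twice the area is half the product of the three lengths. *)
Lemma det_circ (a b c : R) : det (circ a) (circ b) (circ c) =
  4 * sin ((b - a) / 2) * sin ((c - b) / 2) * sin ((c - a) / 2).
Proof.
have -> : circ b = (cos (a + (b - a) / 2 + (b - a) / 2), sin (a + (b - a) / 2 + (b - a) / 2)).
  by rewrite /circ -addrA; congr (cos _, sin _); field.
have -> : circ c = (cos (a + (c - a) / 2 + (c - a) / 2), sin (a + (c - a) / 2 + (c - a) / 2)).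
  by rewrite /circ -addrA; congr (cos _, sin _); field.
have -> : (c - b) / 2 = (c - a) / 2 - (b - a) / 2 by field.
move: ((b - a) / 2) ((c - a) / 2) => s t.
have dcos (u : R) : cos (a + u + u) - cos a = - (2 * sin u * sin (a + u)).
  transitivity (cos (a + u + u) - cos a * (cos u ^+ 2 + sin u ^+ 2)).
    by rewrite cos2Dsin2 mulr1.
  by rewrite !(cosD, sinD); ring.
have dsin (u : R) : sin (a + u + u) - sin a = 2 * sin u * cos (a + u).
  transitivity (sin (a + u + u) - sin a * (cos u ^+ 2 + sin u ^+ 2)).
    by rewrite cos2Dsin2 mulr1.
  by rewrite !(cosD, sinD); ring.
rewrite /det /= !dcos !dsin sinB.
transitivity (4 * sin s * (sin t * cos s - cos t * sin s) * sin t *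
  (cos a ^+ 2 + sin a ^+ 2)); first by rewrite !(sinD, cosD); ring.
by rewrite cos2Dsin2 mulr1.
Qed.

Lemma sin_half_gt0 (t : R) : 0 < t < pi *+ 2 -> 0 < sin (t / 2).
Proof. by rewrite mulr2n => h; apply: sin_gt0_pi; lra. Qed.

Lemma sgr_sin_half (t : R) : - (pi *+ 2) < t < pi *+ 2 ->
  Num.sg (sin (t / 2)) = Num.sg t.
Proof.
move=> h; have [t0|t0|->] := ltgtP t 0.
- have : 0 < sin (- t / 2) by apply: sin_half_gt0; lra.
  rewrite mulNr sinN => s0; rewrite !ltr0_sg //; lra.
- have : 0 < sin (t / 2) by apply: sin_half_gt0; lra.
  by move=> s0; rewrite !gtr0_sg.
- by rewrite mul0r sin0.
Qed.

Lemma sgr_det_circ (o a b c : R) : o <= a < o + pi *+ 2 -> o <= b < o + pi *+ 2 ->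
  o <= c < o + pi *+ 2 ->
  Num.sg (det (circ a) (circ b) (circ c)) = Num.sg ((b - a) * (c - b) * (c - a)).
Proof.
move=> ha hb hc; rewrite det_circ !sgrM gtr0_sg // mul1r.
by rewrite !sgr_sin_half //; lra.
Qed.

Lemma circ_inj (o a b : R) : o <= a < o + pi *+ 2 -> o <= b < o + pi *+ 2 ->
  circ a = circ b -> a = b.
Proof.
move=> ha hb e.
have [ca sa] : cos a = cos b /\ sin a = sin b by case: e.
have c1 : cos (b - a) = 1 by rewrite cosB ca sa -!expr2 cos2Dsin2.
have : sin ((b - a) / 2) == 0.
  have : cos (((b - a) / 2) *+ 2) = 1 by rewrite -mulr_natr divfK.
  rewrite cos_mulr2n cos2sin2 mulr2n => h; rewrite -sqrf_eq0; apply/eqP; lra.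
move/eqP => s0; have := @sgr_sin_half (b - a); rewrite s0 sgr0 => h.
have /esym/eqP : 0 = Num.sg (b - a) by apply: h; lra.
by rewrite sgr_eq0 subr_eq0 => /eqP.
Qed.

(** Within one period the half-angle sines have the signs of the angle differences. Cyclic order
    thus becomes a Boolean combination of linear inequalities, which [lra] decides. *)
Lemma det_circ_gt0 (o a b c : R) : o <= a < o + pi *+ 2 -> o <= b < o + pi *+ 2 ->
  o <= c < o + pi *+ 2 ->
  (0 < det (circ a) (circ b) (circ c)) = [|| a < b < c, b < c < a | c < a < b].
Proof.
have subE (s t : R) : Num.sg (t - s) = if s < t then 1 else if t < s then -1 else 0.
  have [st|st|->] := ltgtP s t; last by rewrite subrr sgr0.
    by rewrite gtr0_sg ?subr_gt0.
  by rewrite ltr0_sg ?subr_lt0.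
move=> ha hb hc; rewrite -sgr_cp0 (sgr_det_circ ha hb hc) !sgrM !subE.
have [ab|ab|ab] := ltgtP a b; have [bc|bc|bc] := ltgtP b c;
  have [ac|ac|ac] := ltgtP a c; rewrite /= ?(mulr0, mul0r, mulr1, mulrN1, opprK) ?eqxx //;
  try (exfalso; lra); apply/negbTE; apply/eqP; lra.
Qed.

Lemma circ_continuous : continuous (circ : R -> plane R).
Proof.
move=> t; apply: (@cvg_pair _ _ _ _ (nbhs (cos t)) (nbhs (sin t))).
  exact: continuous_cos.
exact: continuous_sin.
Qed.

End Chords.

(** * The Klein model *)

Section Klein.
Context {R : realType}.
Implicit Types (p q r x y z u v : plane R) (Z : set (plane R)).

(** The passage from the Poincare to the Klein model, [2 p / (1 + |p|^2)] on the disk; the minimum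
    freezes the factor at 1 outside. *)
Definition kap p : plane R := (2 / (1 + Num.min 1 (sqnorm p))) *: p.
(** Outside the disk the square root of a negative number is 0, so this map is the identity there
    too. *)
Definition kinv p : plane R := (1 + Num.sqrt (1 - sqnorm p))^-1 *: p.

Lemma sqnorm_ge0 p : 0 <= sqnorm p.
Proof. by rewrite addr_ge0 ?sqr_ge0. Qed.

Lemma sqnormZ k p : sqnorm (k *: p) = k ^+ 2 * sqnorm p.
Proof. by rewrite /sqnorm /=; rewrite /GRing.scale /=; ring. Qed.

Lemma kap_out p : 1 <= sqnorm p -> kap p = p.
Proof. by move=> h; rewrite /kap min_l // divff ?scale1r // gt_eqF. Qed.

Lemma kinv_out p : 1 <= sqnorm p -> kinv p = p.
Proof. by move=> h; rewrite /kinv ler0_sqrtr ?subr_le0 // addr0 invr1 scale1r. Qed.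

Lemma kap_in p : sqnorm p <= 1 -> kap p = (2 / (1 + sqnorm p)) *: p.
Proof. by move=> h; rewrite /kap min_r. Qed.

Lemma kapK : cancel kap kinv.
Proof.
move=> p; have [h|/ltW h] := leP 1 (sqnorm p); first by rewrite kap_out // kinv_out.
have n0 := sqnorm_ge0 p.
rewrite kap_in // /kinv sqnormZ scalerA.
have -> : 1 - (2 / (1 + sqnorm p)) ^+ 2 * sqnorm p
    = ((1 - sqnorm p) / (1 + sqnorm p)) ^+ 2 by field; lra.
have q0 : 0 <= (1 - sqnorm p) / (1 + sqnorm p) by apply: divr_ge0; lra.
rewrite sqrtr_sqr ger0_norm //.
have -> : (1 + (1 - sqnorm p) / (1 + sqnorm p))^-1 * (2 / (1 + sqnorm p)) = 1.
  by field; lra.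
by rewrite scale1r.
Qed.

Lemma sqnorm_kinv p : sqnorm p <= 1 ->
  sqnorm (kinv p) = (1 - Num.sqrt (1 - sqnorm p)) / (1 + Num.sqrt (1 - sqnorm p)).
Proof.
move=> h; rewrite /kinv sqnormZ.
have s0 : 0 <= Num.sqrt (1 - sqnorm p) by exact: sqrtr_ge0.
have sE : Num.sqrt (1 - sqnorm p) ^+ 2 = 1 - sqnorm p by rewrite sqr_sqrtr //; lra.
have -> : sqnorm p = 1 - Num.sqrt (1 - sqnorm p) ^+ 2 by lra.
move: (Num.sqrt _) s0 => s s0 in sE *.
have -> : Num.sqrt (1 - (1 - s ^+ 2)) = s.
  by have -> : 1 - (1 - s ^+ 2) = s ^+ 2 by [ring]; rewrite sqrtr_sqr ger0_norm.
by field; lra.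
Qed.

Lemma kinvK : cancel kinv kap.
Proof.
move=> p; have [h|/ltW h] := leP 1 (sqnorm p); first by rewrite kinv_out // kap_out.
have s0 : 0 <= Num.sqrt (1 - sqnorm p) by exact: sqrtr_ge0.
have e := sqnorm_kinv h.
have h1 : sqnorm (kinv p) <= 1 by rewrite e ler_pdivrMr; lra.
rewrite kap_in // e /kinv scalerA.
have -> : 2 / (1 + (1 - Num.sqrt (1 - sqnorm p)) / (1 + Num.sqrt (1 - sqnorm p)))
   / (1 + Num.sqrt (1 - sqnorm p)) = 1 by field; lra.
by rewrite scale1r.
Qed.

Lemma kap_lt1 p : sqnorm p < 1 -> sqnorm (kap p) < 1.
Proof.
move=> h; have n0 := sqnorm_ge0 p; rewrite kap_in ?ltW // sqnormZ.
have -> : (2 / (1 + sqnorm p)) ^+ 2 * sqnorm p = 4 * sqnorm p / (1 + sqnorm p) ^+ 2.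
  by field; lra.
have q0 : 0 < (1 + sqnorm p) ^+ 2 by apply: exprn_gt0; lra.
have q1 : 0 < (1 - sqnorm p) ^+ 2 by apply: exprn_gt0; lra.
by rewrite ltr_pdivrMr //; lra.
Qed.

Lemma kap_D2 p : D2 p -> D2 (kap p).
Proof.
rewrite /D2 /= le_eqVlt => /orP[/eqP e|/kap_lt1/ltW //].
by rewrite kap_out ?e.
Qed.

Lemma kinv_D2 p : D2 p -> D2 (kinv p).
Proof.
move=> h; rewrite /D2 /= leNgt; apply/negP => h1.
by have := kinvK p; rewrite (kap_out (ltW h1)) => e; move: h1; rewrite e ltNge h.
Qed.

Lemma kinv_lt1 p : sqnorm p < 1 -> sqnorm (kinv p) < 1.
Proof.
move=> h; rewrite ltNge; apply/negP => h1.
by have := kinvK p; rewrite kap_out // => e; move: h1; rewrite e leNgt h.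
Qed.

Lemma kinv_S1 p : S1 p -> kinv p = p.
Proof. by rewrite /S1 /= => h; rewrite kinv_out ?h. Qed.

Lemma kap_S1 p : S1 p -> kap p = p.
Proof. by rewrite /S1 /= => h; rewrite kap_out ?h. Qed.

Lemma sqnorm_continuous : continuous (sqnorm : plane R -> R).
Proof.
move=> p; rewrite (_ : sqnorm = fun p => p.1 * p.1 + p.2 * p.2); last first.
  by apply/funext => q; rewrite /sqnorm !expr2.
by apply: cvgD; apply: cvgM; (exact: cvg_fst || exact: cvg_snd).
Qed.

Lemma det_continuous x y : continuous (det x y : plane R -> R).
Proof.
move=> p; rewrite /det; apply: cvgB; apply: cvgM; try exact: cvg_cst.
  by apply: cvgB; [exact: cvg_snd|exact: cvg_cst].
by apply: cvgB; [exact: cvg_fst|exact: cvg_cst].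
Qed.

Lemma kap_continuous : continuous kap.
Proof.
move=> p; rewrite /kap; apply: (@cvgZ _ _ _ _ _ (fun p => 2 / (1 + Num.min 1 (sqnorm p))) id); last exact: cvg_id.
apply: cvgM; first exact: cvg_cst.
apply: cvgV.
  by rewrite gt_eqF // ltr_wpDr // le_min ler01 sqnorm_ge0.
apply: cvgD; first exact: cvg_cst.
apply: (@continuous_min _ _ (fun=> 1) sqnorm); first exact: cvg_cst.
exact: sqnorm_continuous.
Qed.

Lemma kinv_continuous : continuous kinv.
Proof.
move=> p; rewrite /kinv; apply: (@cvgZ _ _ _ _ _ (fun p => (1 + Num.sqrt (1 - sqnorm p))^-1) id); last exact: cvg_id.
apply: cvgV.
  by rewrite gt_eqF // ltr_wpDr // sqrtr_ge0.
apply: cvgD; first exact: cvg_cst.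
apply: (@continuous_comp _ _ _ (fun p => 1 - sqnorm p) Num.sqrt); last exact: sqrt_continuous.
apply: cvgB; first exact: cvg_cst.
exact: sqnorm_continuous.
Qed.

(** The equations [|p - c|^2 = r^2] and [|c|^2 = 1 + r^2] combine to [2 p.c = 1 + |p|^2], which is
    the linear equation [c.(kap p) = 1]: the orthogonal circle centred at [c] becomes the polar line
    of [c]. Diameters are the chords without a pole. *)
Lemma geodesicP x y p : S1 x -> S1 y -> x <> y ->
  geodesic x y p <-> D2 p /\ det x y (kap p) = 0.
Proof.
move=> hx hy nxy; have d1 := dot_lt1 hx hy nxy.
have hx1 : x.1 ^+ 2 + x.2 ^+ 2 = 1 by [].
have hy1 : y.1 ^+ 2 + y.2 ^+ 2 = 1 by [].
split=> -[dp h]; split=> //; have n0 := sqnorm_ge0 p; rewrite kap_in // in h *.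
all: have n1 : 1 + sqnorm p != 0 by rewrite gt_eqF // ltr_wpDr.
- case: h => [[xy0 [t ->]]|[c [r [r0 cE xE yE pE]]]].
    have e1 : y.1 = - x.1 by move/(congr1 fst): xy0 => /=; lra.
    have e2 : y.2 = - x.2 by move/(congr1 snd): xy0 => /=; lra.
    by rewrite /det /= /GRing.scale /= e1 e2; ring.
  have xc : x.1 * c.1 + x.2 * c.2 = 1.
    by move: xE cE; rewrite /sqnorm /= => xE cE; lra.
  have yc : y.1 * c.1 + y.2 * c.2 = 1.
    by move: yE cE; rewrite /sqnorm /= => yE cE; lra.
  move kE : (2 / _ *: p) => k.
  have kc : k.1 * c.1 + k.2 * c.2 = 1.
    rewrite -kE /= /GRing.scale /=.
    have -> : 2 / (1 + sqnorm p) * p.1 * c.1 + 2 / (1 + sqnorm p) * p.2 * c.2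
      = 2 * (p.1 * c.1 + p.2 * c.2) / (1 + sqnorm p) by field.
    have -> : 2 * (p.1 * c.1 + p.2 * c.2) = 1 + sqnorm p.
      by move: pE cE; rewrite /sqnorm /= => pE cE; lra.
    by rewrite divff.
  have e1 : (y.1 - x.1) * c.1 + (y.2 - x.2) * c.2 = 0 by lra.
  have e2 : (k.1 - x.1) * c.1 + (k.2 - x.2) * c.2 = 0 by lra.
  have : det x y k * c.1 = 0.
    transitivity (((y.1 - x.1) * c.1 + (y.2 - x.2) * c.2) * (k.2 - x.2)
      - (y.2 - x.2) * ((k.1 - x.1) * c.1 + (k.2 - x.2) * c.2)).
      by rewrite /det; ring.
    by rewrite e1 e2; ring.
  have : det x y k * c.2 = 0.
    transitivity (- ((y.1 - x.1) * c.1 + (y.2 - x.2) * c.2) * (k.1 - x.1)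
      + (y.1 - x.1) * ((k.1 - x.1) * c.1 + (k.2 - x.2) * c.2)).
      by rewrite /det; ring.
    by rewrite e1 e2; ring.
  move/eqP; rewrite mulf_eq0 => /orP[/eqP //|/eqP c2].
  move/eqP; rewrite mulf_eq0 => /orP[/eqP //|/eqP c1].
  by move: xc; rewrite c1 c2; lra.
- move: h; move kE : (2 / _ *: p) => k h.
  have pk1 : p.1 = (1 + sqnorm p) / 2 * k.1.
    by rewrite -kE /= /GRing.scale /=; field.
  have pk2 : p.2 = (1 + sqnorm p) / 2 * k.2.
    by rewrite -kE /= /GRing.scale /=; field.
  have [xy|xy] := eqVneq (1 + (x.1 * y.1 + x.2 * y.2)) 0.
    left.
    have : (x.1 + y.1) ^+ 2 + (x.2 + y.2) ^+ 2 == 0 by apply/eqP; lra.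
    rewrite paddr_eq0 ?sqr_ge0 // !sqrf_eq0 => /andP[/eqP e1 /eqP e2].
    split; first by apply: plane_eqP => /=.
    exists ((1 + sqnorm p) / 2 * (k.1 * x.1 + k.2 * x.2)).
    have y1 : y.1 = - x.1 by lra.
    have y2 : y.2 = - x.2 by lra.
    have h0 : x.1 * k.2 - x.2 * k.1 = 0 by move: h; rewrite /det y1 y2; lra.
    have k1 : k.1 = (k.1 * x.1 + k.2 * x.2) * x.1.
      transitivity (k.1 * (x.1 ^+ 2 + x.2 ^+ 2) + x.2 * (x.1 * k.2 - x.2 * k.1)).
        by rewrite h0 hx1; ring.
      ring.
    have k2 : k.2 = (k.1 * x.1 + k.2 * x.2) * x.2.
      transitivity (k.2 * (x.1 ^+ 2 + x.2 ^+ 2) - x.1 * (x.1 * k.2 - x.2 * k.1)).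
        by rewrite h0 hx1; ring.
      ring.
    apply: plane_eqP => /=; rewrite /GRing.scale /= -[RHS]mulrA -?k1 -?k2 //.
  right; set D := 1 + _ in xy.
  have D0 : 0 < D.
    rewrite lt_neqAle eq_sym xy /=; rewrite /D.
    have : 0 <= (x.1 + y.1) ^+ 2 + (x.2 + y.2) ^+ 2 by rewrite addr_ge0 ?sqr_ge0.
    by lra.
  (* The pole of the chord, solving [x.c = y.c = 1]. *)
  pose c : plane R := ((x.1 + y.1) / D, (x.2 + y.2) / D).
  have cE : sqnorm c = 2 / D.
    rewrite /sqnorm /c /=.
    transitivity ((x.1 ^+ 2 + x.2 ^+ 2 + (y.1 ^+ 2 + y.2 ^+ 2) + 2 * (D - 1)) / D ^+ 2).
      by rewrite /D; field.
    by rewrite hx1 hy1; field.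
  have c1 : 1 < 2 / D by rewrite ltr_pdivlMr // mul1r /D; lra.
  have kc : k.1 * c.1 + k.2 * c.2 = 1.
    have [l klE] := line_param nxy h.
    rewrite klE mixE /c /=.
    transitivity (((1 - l) * (x.1 ^+ 2 + x.2 ^+ 2) + l * (y.1 ^+ 2 + y.2 ^+ 2) + (D - 1)) / D).
      by rewrite /D; field.
    by rewrite hx1 hy1; field.
  exists c, (Num.sqrt (2 / D - 1)).
  have r2 : Num.sqrt (2 / D - 1) ^+ 2 = 2 / D - 1 by rewrite sqr_sqrtr //; lra.
  rewrite r2 cE sqrtr_gt0; split => //; try lra.
  + transitivity ((x.1 ^+ 2 + x.2 ^+ 2) + sqnorm c
      - 2 * ((x.1 ^+ 2 + x.2 ^+ 2) + (D - 1)) / D); last by rewrite hx1 cE; field.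
    by rewrite /sqnorm /c /D /=; field.
  + transitivity ((y.1 ^+ 2 + y.2 ^+ 2) + sqnorm c
      - 2 * ((y.1 ^+ 2 + y.2 ^+ 2) + (D - 1)) / D); last by rewrite hy1 cE; field.
    by rewrite /sqnorm /c /D /=; field.
  + transitivity (sqnorm p + sqnorm c - 2 * (p.1 * c.1 + p.2 * c.2)).
      by rewrite /sqnorm /=; ring.
    have -> : p.1 * c.1 + p.2 * c.2 = (1 + sqnorm p) / 2 * (k.1 * c.1 + k.2 * c.2).
      by rewrite {1}pk1 {1}pk2; ring.
    by rewrite kc cE; field; rewrite gt_eqF.
Qed.

Lemma geodesic_kinv x y p : S1 x -> S1 y -> x <> y ->
  geodesic x y (kinv p) <-> D2 p /\ det x y p = 0.
Proof.
move=> hx hy nxy; rewrite geodesicP // kinvK; split=> -[h1 h2]; split=> //.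
  by rewrite -(kinvK p); exact: kap_D2.
exact: kinv_D2.
Qed.

(** At a crossing point the affine function [det x y] vanishes strictly between [u] and [v]. So it
    has opposite signs there, unless it vanishes at both; then the geodesics coincide, which [cross]
    excludes. *)
Lemma crossP x y u v : S1 x -> S1 y -> x <> y -> S1 u -> S1 v -> u <> v ->
  cross (geodesic x y) (geodesic u v) <-> det x y u * det x y v < 0.
Proof.
move=> hx hy nxy hu hv nuv; split.
- move=> [nE [p [xp up p1]]]; move: xp up.
  move=> /(geodesicP _ hx hy nxy)[_ e1] /(geodesicP _ hu hv nuv)[_ e2].
  have [k hk kE] := open_chordP hu hv nuv (kap_lt1 p1) e2.
  move: e1; rewrite kE det_mix => e1.
  have [u0|u0] := eqVneq (det x y u) 0.
    have v0 : det x y v = 0.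
      move: e1; rewrite u0 mulr0 add0r => /eqP; rewrite mulf_eq0 => /orP[/eqP|/eqP //]; lra.
    exfalso; apply: nE; apply/seteqP.
    have h : forall q, det x y q = 0 <-> det u v q = 0.
      move: nuv; have [->|->] := det_eq0_S1 hx hy nxy hu u0;
        have [->|->] := det_eq0_S1 hx hy nxy hv v0 => // _ q.
      by rewrite (det_swap x y); split=> h; lra.
    by split=> q; rewrite !geodesicP // h.
  have : 0 < det x y u ^+ 2 by rewrite exprn_even_gt0.
  have : k * (det x y u * det x y v) = - ((1 - k) * det x y u ^+ 2).
    have -> : k * (det x y u * det x y v) = det x y u * (k * det x y v) by ring.
    have -> : k * det x y v = - ((1 - k) * det x y u) by lra.
    ring.
  move=> e h; have : 0 < (1 - k) * det x y u ^+ 2 by rewrite mulr_gt0 //; lra.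
  move=> h1; have : k * (det x y u * det x y v) < 0 by lra.
  by rewrite pmulr_rlt0 //; lra.
- move=> uv; split.
    move=> e; have : geodesic u v u.
      by rewrite geodesicP // kap_S1 // det_xyx; split => //; exact: D2_S1.
    rewrite -e geodesicP // kap_S1 // => -[_ u0].
    by move: uv; rewrite u0 mul0r ltxx.
  (* The parameter at which the segment from [u] to [v] meets the line of [x] and [y]. *)
  pose k := det x y u / (det x y u - det x y v).
  have hk : 0 < k < 1.
    rewrite /k; have [u0|u0|u0] := ltgtP (det x y u) 0.
    - have v0 : 0 < det x y v by move: uv; rewrite nmulr_rlt0.
      by rewrite -mulrNN -invrN divr_gt0 ?ltr_pdivrMr; lra.
    - have v0 : det x y v < 0 by move: uv; rewrite pmulr_rlt0.
      by rewrite divr_gt0 ?ltr_pdivrMr; lra.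
    - by move: uv; rewrite u0 mul0r ltxx.
  exists (kinv (mix k u v)); have h1 := open_chord_lt1 hu hv nuv hk.
  have d0 : det x y u - det x y v != 0.
    by apply/eqP => e; move: hk; rewrite /k e invr0 mulr0 ltxx.
  split; last exact: kinv_lt1.
    by apply/geodesic_kinv => //; split; [exact: ltW|rewrite det_mix /k; field].
  by apply/geodesic_kinv => //; split; [exact: ltW|rewrite det_mix det_xyx det_xyy; ring].
Qed.

(** The arc misses a point of [S1] exactly when that point comes strictly after [y] on the way back
    to [x], that is when [x], [y], [p] are in counterclockwise order. *)
Lemma circle_arcP x y p : S1 x -> S1 y -> x <> y -> Defs.arc x y p <-> S1 p /\ det x y p <= 0.
Proof.
move=> hx hy nxy; split.
- move=> [a [b [t [-> -> hab ht ->]]]]; split; first exact: circ_S1.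
  rewrite leNgt (@det_circ_gt0 _ a); [|lra..].
  by apply/negP; have := pi_gt0 R; lra.
- move=> [hp d]; have [a _ xE] := circ_ex 0 hx.
  have [b hb yE] := circ_ex a hy; have [t ht pE] := circ_ex a hp.
  have pi0 := pi_gt0 R.
  exists a, b, t; split => //; move: d.
  have ab : a != b by apply/eqP => e; apply: nxy; rewrite xE yE e.
  rewrite xE yE pE leNgt (@det_circ_gt0 _ a); [|rewrite ?mulr2n; lra..].
  by rewrite mulr2n in hb ht; move: ab; rewrite neq_lt; lra.
Qed.

(* The angle of [p] in [o, o + 2 pi[. *)
Definition ang (o : R) p : R := xget 0 [set t | o <= t < o + pi *+ 2 /\ p = circ t].

Lemma angP o p : S1 p -> o <= ang o p < o + pi *+ 2 /\ p = circ (ang o p).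
Proof.
by move=> hp; rewrite /ang; case: xgetP => [t -> //|h]; have [t ht pE] := circ_ex o hp; case: (h t).
Qed.

Lemma ang_inj o x y : S1 x -> S1 y -> ang o x = ang o y -> x = y.
Proof. by move=> /(angP o)[_ xE] /(angP o)[_ yE] e; rewrite xE yE e. Qed.

Lemma det_gt0_ang o x y z : S1 x -> S1 y -> S1 z ->
  (0 < det x y z) = [|| ang o x < ang o y < ang o z, ang o y < ang o z < ang o x |
                        ang o z < ang o x < ang o y].
Proof.
move=> /(angP o)[hx xE] /(angP o)[hy yE] /(angP o)[hz zE].
by rewrite {1}xE {1}yE {1}zE (@det_circ_gt0 _ o).
Qed.

Lemma ang_base o : ang o (circ o : plane R) = o.
Proof.
have [h e] := angP o (circ_S1 o); have pi0 := pi_gt0 R.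
by apply/esym/(circ_inj _ h e); rewrite mulr2n; lra.
Qed.

Lemma ang_gt c x : S1 x -> x <> circ c -> c < ang c x.
Proof.
move=> hx nx; rewrite lt_neqAle; have [/andP[-> _] xE] := angP c hx; rewrite andbT.
by apply/eqP => e; apply: nx; rewrite xE -e.
Qed.

(** Cutting the circle at the first vertex turns cyclic order into linear order. *)
Lemma det_gt0_base c y z : S1 y -> S1 z ->
  (0 < det (circ c) y z) = (c < ang c y < ang c z).
Proof.
move=> hy hz; rewrite (det_gt0_ang c) //; last exact: circ_S1.
rewrite ang_base; have [hy1 _] := angP c hy; have [hz1 _] := angP c hz.
by apply/idP/idP; lra.
Qed.

End Klein.

(** * Noncrossing edges *)

Section Combinatorics.
Context {R : realType} (Z : set (plane R)) (S : set {fset plane R}).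
Context (Zadm : admissible Z) (Scl : is_cluster Z S).
Implicit Types (p q r x y z u v w a b : plane R).

Lemma Z_S1 : Z `<=` S1. Proof. by case: Zadm. Qed.

(** The open arc from [x] to [y] is the part of [S1] strictly to the right of the chord, so its
    emptiness is a sign condition on [det x y]. *)
Lemma succE x y : Defs.succ Z x y <->
  [/\ Z x, Z y, x <> y & forall z, Z z -> 0 <= det x y z].
Proof.
split.
- move=> [Zx Zy nxy h]; split=> // z Zz; rewrite leNgt; apply/negP => d.
  have : (Defs.arc x y `&` Z) z.
    by split=> //; apply/circle_arcP; [exact: Z_S1..|exact: nxy|split; [exact: Z_S1|exact: ltW]].
  by rewrite h => -[] zE; move: d; rewrite zE ?det_xyx ?det_xyy ltxx.
- move=> [Zx Zy nxy h]; split=> //; apply/seteqP; split=> z.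
  + move=> [/(circle_arcP _ (Z_S1 Zx) (Z_S1 Zy) nxy)[zS d] Zz].
    apply: det_eq0_S1 => //; [exact: Z_S1..|].
    by apply/eqP; rewrite eq_le d h.
  + move=> zE; have Zz : Z z by case: zE => ->.
    split=> //; apply/circle_arcP => //; [exact: Z_S1..|].
    by split; [exact: Z_S1|case: zE => ->; rewrite ?det_xyx ?det_xyy].
Qed.

Lemma E_inj x y u v : E x y = E u v -> (x = u /\ y = v) \/ (x = v /\ y = u).
Proof.
move=> /fsetP e.
have := e x; have := e y; have := e u; have := e v; rewrite !inE !eqxx ?orbT /=.
move=> /orP h1 /orP h2 /esym/orP h3 /esym/orP h4.
by case: h1 => /eqP h1; case: h2 => /eqP h2; case: h3 => /eqP h3; case: h4 => /eqP h4;
  subst; auto.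
Qed.

Lemma E_sym x y : E x y = E y x. Proof. exact: fsetUC. Qed.

Lemma S_edge x y : S (E x y) ->
  [/\ Z x, Z y, x <> y, ~ Defs.succ Z x y & ~ Defs.succ Z y x].
Proof.
move=> Sxy; have [[/(_ _ Sxy)[u [v [[Zu Zv uv n1 n2]]]] + _] _] := Scl.
by move=> /E_inj[] [-> ->]; split=> //; apply: nesym.
Qed.

Lemma edge_sym x y : is_edge Z S x y -> is_edge Z S y x.
Proof.
by case=> h; [apply: Or31; rewrite E_sym|apply: Or33|apply: Or32].
Qed.

Lemma edge_Z x y : is_edge Z S x y -> [/\ Z x, Z y & x <> y].
Proof.
case=> [/S_edge[]//| [? ? ? _] | [? ? ? _]]; split => //.
exact: nesym.
Qed.

(** For two edges in [S] this is compatibility; an edge between neighbours cannot be crossed because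
    [Z] lies on one side of it. *)
Lemma noncross x y u v : is_edge Z S x y -> is_edge Z S u v ->
  0 < det x y u -> 0 < det y x v -> False.
Proof.
move=> exy euv; have [Zx Zy nxy] := edge_Z exy; have [Zu Zv nuv] := edge_Z euv.
have [[[hx hy] hu] hv] := (Z_S1 Zx, Z_S1 Zy, Z_S1 Zu, Z_S1 Zv).
move=> d1 d2; have c1 : det x y u * det x y v < 0.
  by rewrite pmulr_rlt0 //; move: d2; rewrite det_swap oppr_gt0.
have c2 : det u v x * det u v y < 0.
  apply/crossP => //; have /(crossP hx hy nxy hu hv nuv)[ne [p [? ? ?]]] := c1.
  by split; [exact: nesym|exists p].
have nsucc a b p q : Defs.succ Z a b -> Z p -> Z q -> det a b p * det a b q < 0 -> False.
  by move=> /succE[_ _ _ h] Zp Zq; rewrite ltNge mulr_ge0 ?h.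
have swap2 a b p q : det a b p * det a b q = det b a p * det b a q.
  by rewrite !(det_swap a b) mulrNN.
case: exy => [Sxy|sxy|syx]; first last.
- by apply: (nsucc y x u v) => //; rewrite -swap2.
- by apply: (nsucc x y u v).
case: euv => [Suv|suv|svu]; first last.
- by apply: (nsucc v u x y) => //; rewrite -swap2.
- by apply: (nsucc u v x y).
have [[_ comp] _] := Scl.
by apply: (comp _ _ Sxy Suv x y u v) => //; apply/crossP.
Qed.

(** If no edge of [S] crosses [E x y], adjoining it preserves pairwise compatibility. This is where
    maximality of the cluster enters. *)
Lemma cluster_maximal x y : Z x -> Z y -> x <> y ->
  (forall u v, S (E u v) -> 0 < det x y u -> 0 < det y x v -> False) ->
  is_edge Z S x y.
Proof.
move=> Zx Zy nxy h.
have [?|ns1] := pselect (Defs.succ Z x y); first by apply: Or32.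
have [?|ns2] := pselect (Defs.succ Z y x); first by apply: Or33.
apply: Or31; have [[Sind Scomp] /(_ (S `|` [set E x y])) <-] := Scl; first by right.
  split.
    by move=> e [/Sind //|->]; exists x, y.
  have h1 u v : S (E u v) -> ~ det x y u * det x y v < 0.
    move=> Suv; have [u0|u0|->] := ltgtP (det x y u) 0; last by rewrite mul0r ltxx.
    - rewrite nmulr_rlt0 // => v0; apply: (h v u) => //; first by rewrite E_sym.
      by rewrite det_swap oppr_gt0.
    - rewrite pmulr_rlt0 // => v0; apply: (h u v) => //.
      by rewrite det_swap oppr_gt0.
  have h2 u v a b : S (E u v) -> E x y = E a b -> ~ cross (geodesic a b) (geodesic u v).
    move=> Suv abE; have [Zu Zv nuv _ _] := S_edge Suv.
    have [[[hx hy] hu] hv] := (Z_S1 Zx, Z_S1 Zy, Z_S1 Zu, Z_S1 Zv).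
    have [[<- <-]|[<- <-]] := E_inj abE.
      by move=> /(crossP hx hy nxy hu hv nuv); exact: h1.
    move=> /(crossP hy hx (nesym nxy) hu hv nuv).
    by rewrite !(det_swap x y) mulrNN; exact: h1.
  move=> e f [Se|->] [Sf|->] a b u v eE fE.
  - exact: (Scomp e f).
  - move=> [ne [p [? ? ?]]]; apply: (h2 a b u v) => //; first by rewrite -eE.
    by split; [exact: nesym|exists p].
  - by apply: h2 => //; rewrite -fE.
  - move=> [ne _]; apply: ne.
    have [Ea|Ea] := E_inj eE; have [Eu|Eu] := E_inj fE; move: Ea Eu => [<- <-] [<- <-] //.
    + apply/seteqP; split=> p; rewrite !geodesicP //; try exact: Z_S1; try exact: nesym;
      by rewrite (det_swap x y) => -[? ?]; split=> //; lra.
    + apply/seteqP; split=> p; rewrite !geodesicP //; try exact: Z_S1; try exact: nesym;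
      by rewrite (det_swap x y) => -[? ?]; split=> //; lra.
by move=> e Se; left.
Qed.

Lemma Z_fourth x y z : exists w, [/\ Z w, w <> x, w <> y & w <> z].
Proof.
have [_ _ _ /pcard_leP[f]] := Zadm.
apply: contrapT => h.
have hi (i : nat) : (i < 4)%N -> f i = x \/ f i = y \/ f i = z.
  move=> hi; have Zf : Z (f i) by apply: funS.
  apply: contrapT => /not_orP[n1 /not_orP[n2 n3]]; apply: h.
  by exists (f i).
have fi (i j : nat) : (i < 4)%N -> (j < 4)%N -> f i = f j -> i = j.
  by move=> hi1 hj; apply: (@inj _ _ _ f); rewrite inE.
have n01 := fi 0%N 1%N isT isT; have n02 := fi 0%N 2%N isT isT.
have n03 := fi 0%N 3%N isT isT; have n12 := fi 1%N 2%N isT isT.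
have n13 := fi 1%N 3%N isT isT; have n23 := fi 2%N 3%N isT isT.
by case: (hi 0%N isT) => [|[]] e0; case: (hi 1%N isT) => [|[]] e1;
  case: (hi 2%N isT) => [|[]] e2; case: (hi 3%N isT) => [|[]] e3;
  rewrite e0 e1 e2 e3 in n01 n02 n03 n12 n13 n23;
  first [have := n01 erefl|have := n02 erefl|have := n03 erefl
        |have := n12 erefl|have := n13 erefl|have := n23 erefl].
Qed.

Lemma det_neq0 x y z : Z x -> Z y -> Z z -> x <> y -> z <> x -> z <> y -> det x y z != 0.
Proof.
move=> Zx Zy Zz nxy nzx nzy; apply/eqP => /(det_eq0_S1 (Z_S1 Zx) (Z_S1 Zy) nxy (Z_S1 Zz)).
by case.
Qed.

Lemma succ_side x y : Defs.succ Z x y -> exists2 w, Z w & 0 < det x y w.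
Proof.
move=> /succE[Zx Zy nxy h]; have [w [Zw wx wy _]] := Z_fourth x y x.
by exists w => //; rewrite lt_neqAle h // eq_sym det_neq0.
Qed.

Lemma S_side x y : S (E x y) -> exists2 w, Z w & 0 < det x y w.
Proof.
move=> /S_edge[Zx Zy nxy _ n2]; apply: contrapT => h; apply: n2.
apply/succE; split=> //; first exact: nesym.
move=> z Zz; rewrite det_swap oppr_ge0 leNgt; apply/negP => d; apply: h.
by exists z.
Qed.

(** Consider the angles of [Z] in the turn that ends at [x]. Their supremum is below the angle of
    [x] because [x] is isolated. It is attained: otherwise it would give a limit point of [Z],
    approached from above as well, by angles exceeding the supremum. *)
Lemma pred_ex x : Z x -> exists y, Defs.succ Z y x.
Proof.
move=> Zx; have pi0 := pi_gt0 R; have xS := Z_S1 Zx.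
have [a _ xE] := circ_ex 0 xS.
have aux t : a - pi *+ 2 < t < a -> circ t <> x.
  move=> ht tx; have ta : t + pi *+ 2 = a.
    by apply: (@circ_inj _ a); rewrite ?circD2pi -?xE //; lra.
  lra.
pose T := [set t | a - pi *+ 2 < t < a /\ Z (circ t)].
have T0 : T !=set0.
  have [w [Zw wx _ _]] := Z_fourth x x x.
  have [t ht wE] := circ_ex (a - pi *+ 2) (Z_S1 Zw).
  exists t; split; last by rewrite -wE.
  have : t != a - pi *+ 2.
    by apply/eqP => e; apply: wx; rewrite wE xE -[in RHS](subrK (pi *+ 2) a) circD2pi e.
  by rewrite neq_lt => h; lra.
have Tub : ubound T a by move=> t [/andP[_ /ltW]].
have Ts : has_sup T by split=> //; exists a.
set s := sup T.
have sT t : T t -> t <= s by move=> h; apply: ub_le_sup => //; exists a.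
have s_gt : a - pi *+ 2 < s.
  by have [t Tt] := T0; have := sT t Tt; case: Tt => h _; lra.
have s_lt : s < a.
  have [_ /(_ _ Zx)[U [oU Ux UE]] _ _] := Zadm.
  have /circ_continuous : nbhs (circ a) U by rewrite -xE; exact: open_nbhs_nbhs.
  move=> /nbhs_ballP[e /= e0 he].
  suff : s <= a - e by lra.
  apply: ge_sup => // t [ht Zt]; rewrite leNgt; apply/negP => h.
  have : (U `&` Z) (circ t).
    split=> //; apply: he; rewrite /ball /= ltr_norml; lra.
  by rewrite UE; exact: aux.
have Zs : Z (circ s).
  apply: contrapT => nZ.
  have : limit_set Z (circ s).
    split; first exact: circ_S1.
    move=> U /circ_continuous/nbhs_ballP[e /= e0 he].
    have [t Tt ht] := sup_adherent e0 Ts.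
    exists (circ t); case: (Tt) => _ Zt; split=> //.
      by apply/eqP => e1; apply: nZ; rewrite -e1.
    apply: he; rewrite /ball /= ltr_norml; have := sT t Tt; rewrite -/s in ht; lra.
  move=> hl; have [_ _ /(_ _ hl (a - s)) h _] := Zadm.
  have [|[t [ht Zt]] _] := h; first by lra.
  have := sT t; rewrite leNgt => /(_ _)/negP; apply; last lra.
  by split=> //; lra.
exists (circ s); apply/succE; split=> //.
  by apply: aux; lra.
move=> z Zz; rewrite leNgt -oppr_gt0 -det_swap; apply/negP.
have [t ht zE] := circ_ex s (Z_S1 Zz).
rewrite xE zE (@det_circ_gt0 _ s); [|rewrite ?mulr2n in s_gt s_lt ht *; lra..].
move=> h; have : T t by split; [lra|rewrite -zE].
by move/sT; lra.
Qed.

Definition tri x y z :=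
  [/\ is_edge Z S x y, is_edge Z S y z, is_edge Z S z x & 0 < det x y z].

Lemma tri_rot x y z : tri x y z -> tri y z x.
Proof. by move=> [? ? ? ?]; split=> //; rewrite -det_cyc. Qed.

Lemma tri_Z x y z : tri x y z -> [/\ Z x, Z y & Z z].
Proof. by move=> [/edge_Z[? ? _] /edge_Z[_ ? _] _ _]. Qed.

(* The third vertex is the neighbour of x that comes first after y. *)
Lemma triangle_left x y w : finite_set [set z | is_edge Z S x z] ->
  is_edge Z S x y -> Z w -> 0 < det x y w -> exists z, tri x y z.
Proof.
move=> fin exy Zw dw; have [Zx Zy nxy] := edge_Z exy.
have [[hx hy] hw] := (Z_S1 Zx, Z_S1 Zy, Z_S1 Zw).
have [c _ yE] := circ_ex 0 hy.
have base u v : S1 u -> S1 v -> (0 < det y u v) = (c < ang c u < ang c v).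
  by rewrite yE; exact: det_gt0_base.
have pos u : S1 u -> u <> y -> c < ang c u by rewrite yE; exact: ang_gt.
pose N := [set z | is_edge Z S x z /\ 0 < det x y z].
have [||z [exz dz] zmin] := @finite_min R _ N (ang c).
- by apply: sub_finite_set fin => u [].
(* As [w] lies between [y] and [x], so does the predecessor of [x]; hence [N] is nonempty. *)
- have [p sp] := pred_ex Zx; exists p; split; first exact: Or33.
  have [Zp _ npx h] := (succE p x).1 sp; have hp := Z_S1 Zp.
  have := h _ Zw; rewrite leNgt -oppr_gt0 -det_swap.
  have [->|/eqP py] := eqVneq p y; first by rewrite dw.
  have pc := pos _ hp py.
  have : ang c p != ang c x by apply/eqP => e; apply: npx; apply: ang_inj e.
  move: dw; rewrite det_cyc base // => dw; rewrite (det_cyc x y p) base // neq_lt.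
  move=> /orP[px _|px]; first by rewrite pc.
  by rewrite (det_gt0_ang c) //; lra.
have [_ Zz nxz] := edge_Z exz; have hz := Z_S1 Zz.
exists z; split=> //; last exact: edge_sym.
have dz' := dz; rewrite det_cyc base // in dz'.
apply: cluster_maximal => // [e|u v Suv].
  by move: dz; rewrite -e det_xyy ltxx.
have [Zu Zv nuv _ _] := S_edge Suv; have [hu hv] := (Z_S1 Zu, Z_S1 Zv).
have euv : is_edge Z S u v by apply: Or31.
rewrite (det_cyc z y v) !base // => /andP[_ zu] /andP[cv vz].
(* Here [v] lies strictly between [y] and [z], and [u] beyond [z]. According to the position of [u]
   relative to [x], the edge crosses [x z], crosses [x y], or makes [v] a neighbour of [x] earlier
   than [z]. *)
have [ux|ux|/(ang_inj hu hx) ux] := ltgtP (ang c u) (ang c x).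
- by apply: (noncross exz euv); rewrite (det_gt0_ang c) //; lra.
- apply: (noncross exy (edge_sym euv)); first by rewrite det_cyc base //; lra.
  by rewrite base //; lra.
- have : N v by split; [rewrite -ux|rewrite det_cyc base //; lra].
  by move=> /zmin; lra.
Qed.

Lemma three_arcs x y z p : S1 x -> S1 y -> S1 z -> S1 p -> 0 < det x y z ->
  p <> x -> p <> y -> p <> z -> [|| 0 < det y x p, 0 < det z y p | 0 < det x z p].
Proof.
move=> hx hy hz hp d px py pz.
have : ang 0 p != ang 0 x by apply/eqP => e; apply: px; apply: ang_inj e.
have : ang 0 p != ang 0 y by apply/eqP => e; apply: py; apply: ang_inj e.
have : ang 0 p != ang 0 z by apply/eqP => e; apply: pz; apply: ang_inj e.
move: d; rewrite !(det_gt0_ang 0) // !neq_lt; lra.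
Qed.

(** Points of [Z] strictly on both sides show that the edge does not join neighbours. *)
Lemma edge_beyond x y z v : is_edge Z S x y -> Z z -> Z v ->
  0 < det x y z -> 0 < det y x v ->
  S (E x y) /\ forall v', is_edge Z S v v' -> det x y v' <= 0.
Proof.
move=> exy Zz Zv dz dv; split.
  case: exy => [//|/succE[_ _ _ h]|/succE[_ _ _ h]].
    by have := h _ Zv; rewrite det_swap; lra.
  by have := h _ Zz; rewrite (det_swap x y); lra.
move=> v' e; rewrite leNgt; apply/negP => d.
by apply: (noncross exy (edge_sym e)).
Qed.

(** With both ends in the cap cut off by [a b], the arc could leave the cap only by running round
    its complement. It would then contain [w], which is impossible between neighbours. *)
Lemma succ_arc_side u v a b r w : Defs.succ Z u v -> Z a -> Z b -> a <> b -> Z w ->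
  0 < det a b w -> det a b u <= 0 -> det a b v <= 0 -> S1 r -> det u v r <= 0 ->
  det a b r <= 0.
Proof.
move=> /succE[Zu Zv nuv h] Za Zb nab Zw dw du dv rS dr.
have [[[[ha hb] hu] hv] hw] := (Z_S1 Za, Z_S1 Zb, Z_S1 Zu, Z_S1 Zv, Z_S1 Zw).
have [c _ aE] := circ_ex 0 ha.
have base p q : S1 p -> S1 q -> (0 < det a p q) = (c < ang c p < ang c q).
  by rewrite aE; exact: det_gt0_base.
have pos p : S1 p -> p <> a -> c < ang c p by rewrite aE; exact: ang_gt.
have bc := pos _ hb (nesym nab).
move: dw du dv; rewrite !leNgt !base // bc /= -!leNgt => bw ub vb.
rewrite leNgt; apply/negP => br.
have [uv|vu|/(ang_inj hu hv)//] := ltgtP (ang c u) (ang c v).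
  by move: dr; rewrite leNgt => /negP; apply; rewrite (det_gt0_ang c) //; lra.
have := h _ Zw; rewrite leNgt -oppr_gt0 -det_swap => /negP; apply.
by rewrite (det_gt0_ang c) //; lra.
Qed.

End Combinatorics.

(** * Local finiteness *)

Section Topology.
Context {R : realType}.
Implicit Types (p q w : plane R).

Lemma closed_S1 : closed (S1 : set (plane R)).
Proof.
rewrite (_ : S1 = sqnorm @^-1` [set 1 : R]) //.
apply: preimage_closed; last exact: closed_eq.
by move=> p _; exact: sqnorm_continuous.
Qed.

Lemma closed_D2 : closed (D2 : set (plane R)).
Proof.
rewrite (_ : D2 = sqnorm @^-1` [set x : R | x <= 1]) //.
apply: preimage_closed; last exact: closed_le.
by move=> p _; exact: sqnorm_continuous.
Qed.

Lemma compact_D2 : compact (D2 : set (plane R)).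
Proof.
apply: (subclosed_compact closed_D2 (compact_setX (@segment_compact R (-1) 1) (@segment_compact R (-1) 1))).
move=> p; rewrite /D2 /sqnorm /= => h; split; rewrite /= in_itv /=; nra.
Qed.

Lemma compact_S1 : compact (S1 : set (plane R)).
Proof. exact: (subclosed_compact closed_S1 compact_D2 (@D2_S1 R)). Qed.

Lemma closed_limit_set (Z : set (plane R)) : closed (limit_set Z).
Proof.
by apply: closedI; [exact: closed_S1|apply: limit_point_closed; exact: hausdorff_accessible].
Qed.

Lemma closed_nbhs_off (K : set (plane R)) p : closed K -> ~ K p ->
  exists N, [/\ nbhs p N, closed N & N `&` K = set0].
Proof.
move=> cK nKp; have /nbhs_ballP[e /= e0 he] : nbhs p (~` K).
  by apply: open_nbhs_nbhs; split=> //; exact: closed_openC.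
exists (closed_ball p (e / 2)); split.
- apply/nbhs_ballP; exists (e / 2) => /=; first by rewrite divr_gt0.
  exact: subset_closed_ball.
- exact: closed_ball_closed.
- apply/seteqP; split=> // q [hq Kq]; apply: (he q) => //.
  apply: (closed_ball_subset _ _ hq); rewrite ?divr_gt0 // ltr_pdivrMr //; lra.
Qed.

End Topology.

Definition edges_converge (R : realType) (Z : set (plane R)) (S : set {fset plane R}) :=
  forall (x y : nat -> plane R) (w : plane R),
    (forall i, S (E (x i) (y i))) -> limit_set Z w -> (x @ \oo --> w <-> y @ \oo --> w).

(** * Caps at limit points and local finiteness of the edges *)

Section LocalFiniteness.
Context {R : realType} (Z : set (plane R)) (S : set {fset plane R}).
Context (Zadm : admissible Z) (Scl : is_cluster Z S).
Implicit Types (p q r x y z u v w a b : plane R).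

(** For [0 < h < pi], the chord has unit normal [circ m], signed distance [cos h] from the centre
    and length [2 * sin h]. *)
Lemma det_cap (m h : R) p : det (circ (m - h)) (circ (m + h)) p =
  2 * sin h * (cos h - (p.1 * cos m + p.2 * sin m)).
Proof.
transitivity (2 * sin h * (cos h * (cos m ^+ 2 + sin m ^+ 2) - (p.1 * cos m + p.2 * sin m))).
  by rewrite /det /= !(cosD, sinD) cosN sinN; ring.
by rewrite cos2Dsin2 mulr1.
Qed.

(** Limit points being two-sided, [Z] has points just before and just after [w], and the chord
    joining them cuts off a small cap. The point [w'] outside the cap is what [succ_arc_side]
    needs. *)
Lemma cap_small w (U : set (plane R)) : limit_set Z w -> nbhs w U ->
  exists l r, [/\ Z l, Z r, l <> r, exists2 w', Z w' & 0 < det l r w' &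
    det l r w < 0 /\ forall p, D2 p -> det l r p <= 0 -> U p].
Proof.
move=> lw /nbhs_ballP[e /= e0 he].
have [a _ wE] := circ_ex 0 lw.1; have pi0 := pi_gt0 R.
(* [2 - 2 * cos t] is the squared length of a chord subtending the angle [t]. Half of [e] is spent
   from [w] to the middle of the arc, half from there to the points of the cap. *)
have [d /= d0 hd] : exists2 d, 0 < d & forall t : R, `|t| < d -> 2 - 2 * cos t < (e / 2) ^+ 2.
  have : nbhs (cos (0 : R)) [set x | 2 - 2 * x < (e / 2) ^+ 2].
    apply: open_nbhs_nbhs; split; last first.
      by rewrite /= cos0; have : 0 < (e / 2) ^+ 2 by [apply: exprn_gt0; lra]; lra.
    rewrite (_ : mkset _ = [set x | 1 - (e / 2) ^+ 2 / 2 < x]); first exact: open_gt.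
    by apply/seteqP; split=> x /=; lra.
  move=> /(@continuous_cos R 0)/nbhs_ballP[d /= d0 hd]; exists d => // t ht.
  by apply: hd; rewrite /ball /= sub0r normrN.
have [_ _ h _] := Zadm; rewrite wE in lw.
(* The bound [pi / 4] keeps all angles in one period and the cap smaller than a half disk. *)
pose d' := Num.min d (pi / 4).
have d'0 : 0 < d' by rewrite lt_min d0; lra.
have d'd : d' <= d by rewrite ge_min lexx.
have d'pi : d' <= pi / 4 by rewrite ge_min lexx orbT.
have [[t3 [ht3 Zt3]] [t1 [ht1 Zt1]]] := h a lw d' d'0.
(* Chosen between [w] and [t3], which thereby stays outside the cap. *)
have [|[t2 [ht2 Zt2]] _] := h a lw (t3 - a); first by lra.
exists (circ t1), (circ t2).
have D13 : 0 < det (circ t1) (circ t2) (circ t3).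
  by rewrite (@det_circ_gt0 _ t1); rewrite ?mulr2n; lra.
split=> //; first by move=> e1; move: D13; rewrite e1 det_xx ltxx.
  by exists (circ t3).
split.
  rewrite -oppr_gt0 -det_swap wE det_cyc (@det_circ_gt0 _ t1); rewrite ?mulr2n; lra.
pose m := (t1 + t2) / 2; pose k := (t2 - t1) / 2.
move=> p Dp; have -> : t1 = m - k by rewrite /m /k; field.
have -> : t2 = m + k by rewrite /m /k; field.
have k0 : 0 < sin k by apply: sin_gt0_pi; rewrite /k; lra.
rewrite det_cap pmulr_rle0 ?mulr_gt0 // => hp.
have hk : 2 - 2 * cos k < (e / 2) ^+ 2.
  by apply: hd; rewrite ltr_norml /k; lra.
have hm : 2 - 2 * cos (m - a) < (e / 2) ^+ 2.
  by apply: hd; rewrite ltr_norml /m; lra.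
have pm : (p.1 - cos m) ^+ 2 + (p.2 - sin m) ^+ 2 < (e / 2) ^+ 2.
  by move: Dp; rewrite /D2 /sqnorm /=; have := cos2Dsin2 m; lra.
have ma : (cos m - cos a) ^+ 2 + (sin m - sin a) ^+ 2 < (e / 2) ^+ 2.
  by move: hm; rewrite cosB; have := cos2Dsin2 m; have := cos2Dsin2 a; lra.
have sq (s t : R) : s ^+ 2 + t ^+ 2 < (e / 2) ^+ 2 -> `|s| < e / 2 /\ `|t| < e / 2.
  move=> st; have := sqr_ge0 s; have := sqr_ge0 t => t2' s2'.
  have e2 : 0 <= e / 2 by lra.
  by split; rewrite -(@ltr_pXn2r _ 2) ?nnegrE ?normr_ge0 // real_normK ?num_real //; lra.
have [p1 p2] := sq _ _ pm; have [m1 m2] := sq _ _ ma.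
apply: he; rewrite wE; split; rewrite /ball /= distrC.
  by have := ler_normD (p.1 - cos m) (cos m - cos a); rewrite addrA subrK; lra.
by have := ler_normD (p.2 - sin m) (sin m - sin a); rewrite addrA subrK; lra.
Qed.

Context (conv : edges_converge Z S).

(** Otherwise the balls of radius [1/(n+1)] at [w] provide edges with one end tending to [w] and the
    other outside [U]. *)
Lemma S_nbhs w (U : set (plane R)) : limit_set Z w -> nbhs w U ->
  exists2 V, nbhs w V & forall x y, S (E x y) -> V x -> U y.
Proof.
move=> lw Uw; apply: contrapT => h.
have /choice[f hf] : forall n : nat, exists xy : plane R * plane R,
    [/\ S (E xy.1 xy.2), ball w n.+1%:R^-1 xy.1 & ~ U xy.2].
  move=> n; apply: contrapT => hn; apply: h.
  exists (ball w n.+1%:R^-1); first by apply: nbhsx_ballx; rewrite invr_gt0.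
  move=> x y Sxy xw; apply: contrapT => nU; apply: hn.
  by exists (x, y).
have xw : (fun n => (f n).1) @ \oo --> w.
  apply/cvg_ballP => e e0; near=> n.
  have [_ h1 _] := hf n; apply: le_ball h1; apply: ltW; near: n.
  by apply: near_infty_natSinv_lt (PosNum e0).
have Sf i : S (E (f i).1 (f i).2) by case: (hf i).
have [n _ hn] := (conv Sf lw).1 xw U Uw.
by have [_ _] := hf n; apply; apply: (hn n) => /=.
Unshelve. all: by end_near. Qed.

(** Extends [S_nbhs] to edges between neighbours: an edge from inside a small cap to its outside
    crosses the chord [l r], whereas [Z] lies on one side of an edge between neighbours. *)
Lemma edge_nbhs w (U : set (plane R)) : limit_set Z w -> nbhs w U ->
  exists2 V, nbhs w V & forall x y, is_edge Z S x y -> V x -> U y.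
Proof.
move=> lw Uw; have [V Vw hV] := S_nbhs lw Uw.
have [l [r [Zl Zr nlr _ [lrw hU]]]] := cap_small lw Uw.
have Z1 := Z_S1 Zadm.
exists (V `&` [set x | det l r x < 0]).
  apply: filterI => //; apply: open_nbhs_nbhs; split=> //.
  by apply: (@open_comp _ _ (det l r) [set t | t < 0]); [move=> ? _; exact: det_continuous|exact: open_lt].
have side x y : Z x -> Z y -> x <> y -> (forall z, Z z -> 0 <= det x y z \/ False) ->
    det l r x < 0 -> det l r y <= 0.
  move=> Zx Zy nxy h dx; rewrite leNgt; apply/negP => dy.
  have : det l r x * det l r y < 0 by rewrite nmulr_rlt0.
  move/(crossP (Z1 _ Zl) (Z1 _ Zr) nlr (Z1 _ Zx) (Z1 _ Zy) nxy) => [ne [p [? ? ?]]].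
  have : cross (geodesic x y) (geodesic l r) by split; [exact: nesym|exists p].
  move/(crossP (Z1 _ Zx) (Z1 _ Zy) nxy (Z1 _ Zl) (Z1 _ Zr) nlr).
  by have [h1|//] := h _ Zl; have [h2|//] := h _ Zr; rewrite ltNge mulr_ge0.
move=> x y exy [Vx /= dx]; case: exy => [/hV|/(succE Zadm)|/(succE Zadm)].
- exact.
- move=> [Zx Zy nxy h]; apply: hU; first exact/D2_S1/Z1.
  by apply: (side x y) => // z Zz; left; exact: h.
- move=> [Zy Zx nyx h]; apply: hU; first exact/D2_S1/Z1.
  have [dy|] := leP (det l r y) 0 => // dy.
  have : det l r y * det l r x < 0 by rewrite pmulr_rlt0.
  move/(crossP (Z1 _ Zl) (Z1 _ Zr) nlr (Z1 _ Zy) (Z1 _ Zx) nyx) => [ne [p [? ? ?]]].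
  have : cross (geodesic y x) (geodesic l r) by split; [exact: nesym|exists p].
  move/(crossP (Z1 _ Zy) (Z1 _ Zx) nyx (Z1 _ Zl) (Z1 _ Zr) nlr).
  by rewrite ltNge mulr_ge0 ?h.
Qed.

(* Stated with caps so that it covers both chords (y = z) and triangles with curved sides. *)
Definition hull x y z p := forall a b, Z a -> Z b -> a <> b ->
  (exists2 w, Z w & 0 < det a b w) ->
  det a b x <= 0 -> det a b y <= 0 -> det a b z <= 0 -> det a b p <= 0.

(** Infinitely many such vertices would accumulate at a point [w] of [limit_set Z]. For [x] close to
    [w] the neighbours [y] and [z] also lie in a cap at [w] that misses [K], and the hull condition
    forces [p] into that cap. *)
Lemma locally_finite (K : set (plane R)) : closed K -> K `&` limit_set Z = set0 ->
  finite_set [set x | exists y z p, [/\ is_edge Z S x y, is_edge Z S x z, D2 p, K p &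
                                      hull x y z p]].
Proof.
move=> cK KL; apply: contrapT => inf.
have [|w wS lw] := infinite_limit_point compact_S1 _ inf.
  by move=> x [y [z [p [/(edge_Z Scl)[Zx _ _] _ _ _ _]]]]; exact: (Z_S1 Zadm).
have lwZ : limit_set Z w.
  split=> // U Uw; have [x [xw [y [z [p [/(edge_Z Scl)[Zx _ _] _ _ _ _]]]]] Ux] := lw U Uw.
  by exists x.
have nKw : ~ K w by move=> Kw; suff : (K `&` limit_set Z) w by [rewrite KL]; split.
have [l [r [Zl Zr nlr hw' [lrw hU]]]] : exists l r, [/\ Z l, Z r, l <> r,
    exists2 w', Z w' & 0 < det l r w' &
    det l r w < 0 /\ forall p, D2 p -> det l r p <= 0 -> (~` K) p].
  apply: cap_small => //; apply: open_nbhs_nbhs; split=> //; exact: closed_openC.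
have Vw : nbhs w [set x | det l r x < 0].
  apply: open_nbhs_nbhs; split=> //.
  by apply: (@open_comp _ _ (det l r) [set t | t < 0]); [move=> ? _; exact: det_continuous|exact: open_lt].
have [V' V'w hV'] := edge_nbhs lwZ Vw.
have [x [_ [y [z [p [exy exz Dp Kp hp]]]] [/= Vx V'x]]] := lw _ (filterI Vw V'w).
apply: (hU p) => //; apply: hp => //; apply: ltW => //.
  exact: hV' exy V'x.
exact: hV' exz V'x.
Qed.

(** Local finiteness at [[set x]], which avoids the limit set since [x] is isolated in [Z]. A
    neighbour [y] is counted through the degenerate hull of [y], [x], [x], which contains [x]. *)
Lemma edges_finite x : Z x -> finite_set [set y | is_edge Z S x y].
Proof.
move=> Zx; apply: sub_finite_set (@locally_finite [set x] _ _).
- move=> y exy; exists x, x, x; split=> //; try exact: edge_sym.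
  exact/D2_S1/(Z_S1 Zadm).
- by apply: accessible_closed_set1; exact: hausdorff_accessible.
- apply/seteqP; split=> // _ [/= -> [_]].
  have [_ /(_ _ Zx)[U [oU Ux UE]] _ _] := Zadm.
  move=> /(_ U)[|y [/eqP yx Zy Uy]]; first exact: open_nbhs_nbhs.
  by have : (U `&` Z) y by []; rewrite UE.
Qed.

Lemma limit_set_notin x : Z x -> ~ limit_set Z x.
Proof.
move=> Zx [_].
have [_ /(_ _ Zx)[U [oU Ux UE]] _ _] := Zadm.
move=> /(_ U)[|y [/eqP yx Zy Uy]]; first exact: open_nbhs_nbhs.
by have : (U `&` Z) y by []; rewrite UE.
Qed.

End LocalFiniteness.

(** * Maps of single triangles *)

Section Regions.
Context {R : realType} (Z : set (plane R)) (S : set {fset plane R}).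
Context (Zadm : admissible Z) (Scl : is_cluster Z S).
Implicit Types (p q r g x y z u v w : plane R).

(* Maps the segment from x to y onto the counterclockwise arc, extended
   homogeneously; it is 0 at s + t = 0, where the quotient is junk. *)
Definition arcmap x y (s t : R) : plane R :=
  (s + t) *: circ ((s * ang 0 x + t * ang (ang 0 x) y) / (s + t)).

(** Homogeneous of degree one, so that it applies to the coordinates left after the minimum is
    subtracted in [Phi]. An arc is always run from a point to its successor, so the value does not
    depend on the order in which the ends are given. *)
Definition emap x y (s t : R) : plane R :=
  if `[< Defs.succ Z x y >] then arcmap x y s t
  else if `[< Defs.succ Z y x >] then arcmap y x t s
  else s *: x + t *: y.

Lemma succ_asym x y : Defs.succ Z x y -> ~ Defs.succ Z y x.
Proof.
move=> sxy syx; have [w Zw] := succ_side Zadm sxy.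
by have [_ _ _ /(_ _ Zw)] := (succE Zadm y x).1 syx; rewrite det_swap; lra.
Qed.

Lemma emapC x y s t : emap x y s t = emap y x t s.
Proof.
rewrite /emap; have [sxy|_] := asboolP (Defs.succ Z x y).
  by rewrite asboolF //; exact: succ_asym.
by case: asboolP => // _; rewrite addrC.
Qed.

Lemma arcmap_s0 x y s : S1 x -> arcmap x y s 0 = s *: x.
Proof.
move=> hx; rewrite /arcmap addr0 mul0r addr0.
have [->|s0] := eqVneq s 0; first by rewrite !scale0r.
by rewrite mulrAC divff // mul1r -(angP 0 hx).2.
Qed.

Lemma arcmap_0t x y t : S1 y -> arcmap x y 0 t = t *: y.
Proof.
move=> hy; rewrite /arcmap add0r mul0r add0r.
have [->|t0] := eqVneq t 0; first by rewrite !scale0r.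
by rewrite mulrAC divff // mul1r -(angP _ hy).2.
Qed.

Lemma emap_s0 x y s : S1 x -> S1 y -> emap x y s 0 = s *: x.
Proof.
move=> hx hy; rewrite /emap; case: ifP => _; [|case: ifP => _].
- exact: arcmap_s0.
- exact: arcmap_0t.
- by rewrite scale0r addr0.
Qed.

Lemma emap_0t x y t : S1 x -> S1 y -> emap x y 0 t = t *: y.
Proof. by move=> hx hy; rewrite emapC emap_s0. Qed.

Lemma emapZ x y k s t : k != 0 -> emap x y (k * s) (k * t) = k *: emap x y s t.
Proof.
move=> k0.
have arcZ u v a b : arcmap u v (k * a) (k * b) = k *: arcmap u v a b.
  by rewrite /arcmap -mulrDr -!mulrA -mulrDr -mulf_div divff // mul1r scalerA.
by rewrite /emap; do 2 (case: ifP => _; first by rewrite arcZ); rewrite scalerDr !scalerA.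
Qed.

(** Where [s + t = 0] the angle is junk, but the norm of the value is at most [|s + t|]. *)
Lemma arcmap_continuous x y : continuous (fun st : R * R => arcmap x y st.1 st.2).
Proof.
move=> st.
have sD : (fun t : R * R => t.1 + t.2) @ st --> st.1 + st.2.
  by apply: cvgD; [exact: cvg_fst|exact: cvg_snd].
have [s0|s0] := eqVneq (st.1 + st.2) 0; last first.
  rewrite /arcmap; move: (ang 0 x) (ang _ y) => al be; apply: cvgZ => //.
  apply: (@continuous_comp _ _ _ (fun t : R * R => (t.1 * al + t.2 * be) / (t.1 + t.2)) circ); last exact: circ_continuous.
  apply: cvgM; last exact: cvgV.
  by apply: cvgD; apply: cvgM; (exact: cvg_fst || exact: cvg_snd || exact: cvg_cst).
have e0 : arcmap x y st.1 st.2 = 0 by rewrite /arcmap s0 scale0r.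
suff : (fun t : R * R => arcmap x y t.1 t.2) @ st --> (0 : plane R) by rewrite -e0.
apply/cvgr0Pnorm_lt => e e_gt0.
move: sD; rewrite s0 => /cvgr0Pnorm_lt/(_ e e_gt0); apply: filterS => t.
apply: le_lt_trans; rewrite normrZ ler_piMr //.
by rewrite prod_normE ge_max cos_max sin_max.
Qed.

Lemma emap_continuous x y : continuous (fun st : R * R => emap x y st.1 st.2).
Proof.
rewrite /emap; case: (`[< Defs.succ Z x y >]); first exact: arcmap_continuous.
case: (`[< Defs.succ Z y x >]).
  move=> st; apply: (@continuous2_cvg _ _ _ _ (nbhs st) _ snd fst (arcmap y x)).
  - exact: (@arcmap_continuous y x (st.2, st.1)).
  - exact: cvg_snd.
  - exact: cvg_fst.
by move=> st; apply: cvgD; apply: cvgZ; (exact: cvg_fst || exact: cvg_snd || exact: cvg_cst).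
Qed.

Definition ept x y t := emap x y (1 - t) t.

Lemma ept0 x y : S1 x -> S1 y -> ept x y 0 = x.
Proof. by move=> hx hy; rewrite /ept subr0 emap_s0 // scale1r. Qed.

Lemma ept1 x y : S1 x -> S1 y -> ept x y 1 = y.
Proof. by move=> hx hy; rewrite /ept subrr emap_0t // scale1r. Qed.

Lemma ept_S x y t : S (E x y) -> ept x y t = mix t x y.
Proof.
by move=> /(S_edge Scl)[_ _ _ n1 n2]; rewrite /ept /emap !asboolF.
Qed.

Lemma ept_succ x y t : Defs.succ Z x y ->
  ept x y t = circ (ang 0 x + t * (ang (ang 0 x) y - ang 0 x)).
Proof.
move=> sxy; rewrite /ept /emap asboolT // /arcmap subrK scale1r divr1.
by congr circ; ring.
Qed.

Lemma ang_succ x y : Defs.succ Z x y ->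
  [/\ x = circ (ang 0 x), y = circ (ang (ang 0 x) y) &
      ang 0 x < ang (ang 0 x) y < ang 0 x + pi *+ 2].
Proof.
move=> [Zx Zy nxy _]; have [_ xE] := angP 0 (Z_S1 Zadm Zx).
have [/andP[h1 h2] yE] := angP (ang 0 x) (Z_S1 Zadm Zy); split=> //.
by rewrite h2 andbT ang_gt -?xE //; [exact: Z_S1 Zy|exact: nesym].
Qed.

Lemma ept_succP x y p : Defs.succ Z x y ->
  (exists2 t, 0 <= t <= 1 & p = ept x y t) <-> S1 p /\ det x y p <= 0.
Proof.
move=> sxy; have [xE yE hxy] := ang_succ sxy.
have [Zx Zy nxy _] := sxy; have [hx hy] := (Z_S1 Zadm Zx, Z_S1 Zadm Zy).
split=> [[t ht ->]|[hp]].
  rewrite ept_succ //; split; first exact: circ_S1.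
  rewrite leNgt; apply/negP; rewrite [in det x y]xE [X in det _ X]yE.
  by rewrite (@det_circ_gt0 _ (ang 0 x)); nra.
have [hp1 pE] := angP (ang 0 x) hp.
rewrite leNgt [in det x y]xE [X in det _ X]yE {1}pE (@det_circ_gt0 _ (ang 0 x)); [|lra..].
move=> h; exists ((ang (ang 0 x) p - ang 0 x) / (ang (ang 0 x) y - ang 0 x)).
  by rewrite divr_ge0 ?ler_pdivrMr; lra.
have n0 : ang (ang 0 x) y - ang 0 x != 0.
  by rewrite subr_eq0 gt_eqF //; case/andP: hxy.
by rewrite ept_succ // divfK // subrKC.
Qed.

Lemma ept_SP x y p : S (E x y) ->
  (exists2 t, 0 <= t <= 1 & p = ept x y t) <-> D2 p /\ det x y p = 0.
Proof.
move=> Sxy; have [Zx Zy nxy _ _] := S_edge Scl Sxy.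
have [hx hy] := (Z_S1 Zadm Zx, Z_S1 Zadm Zy); split=> [[t ht ->]|[hp d0]].
  rewrite ept_S // det_mix det_xyx det_xyy; split; last by ring.
  by apply: D2_mix => //; exact: D2_S1.
by have [k hk ->] := chordP hx hy nxy hp d0; exists k => //; rewrite ept_S.
Qed.

Lemma eptC x y t : ept x y t = ept y x (1 - t).
Proof. by rewrite /ept emapC; congr emap; ring. Qed.

Lemma ept_inj x y s t : is_edge Z S x y -> 0 <= s <= 1 -> 0 <= t <= 1 ->
  ept x y s = ept x y t -> s = t.
Proof.
have succ_inj u v a b : Defs.succ Z u v -> 0 <= a <= 1 -> 0 <= b <= 1 ->
    ept u v a = ept u v b -> a = b.
  move=> suv ha hb; rewrite !ept_succ //; have [_ _ hxy] := ang_succ suv.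
  move=> /(@circ_inj _ (ang 0 u)) h.
  have : ang 0 u + a * (ang (ang 0 u) v - ang 0 u) = ang 0 u + b * (ang (ang 0 u) v - ang 0 u).
    by apply: h; nra.
  by move/addrI/mulIf; apply; lra.
case=> [Sxy|sxy|syx] hs ht.
- have [Zx Zy nxy _ _] := S_edge Scl Sxy; rewrite !ept_S // !mixE => -[e1 e2].
  have h1 : (s - t) * (y.1 - x.1) == 0 by apply/eqP; lra.
  have h2 : (s - t) * (y.2 - x.2) == 0 by apply/eqP; lra.
  move: h1 h2; rewrite !mulf_eq0 !subr_eq0 => /orP[/eqP//|/eqP h1] /orP[/eqP//|/eqP h2].
  by case: nxy; apply: plane_eqP.
- exact: succ_inj.
- rewrite eptC [RHS]eptC => /(succ_inj _ _ _ _ syx) h.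
  have : 1 - s = 1 - t by apply: h; lra.
  lra.
Qed.

(* An edge {u, u^+} bounds the region by its arc of S1, hence imposes no half-plane. *)
Definition region x y z : set (plane R) := [set p |
  [/\ D2 p, S (E x y) -> 0 <= det x y p, S (E y z) -> 0 <= det y z p &
      S (E z x) -> 0 <= det z x p]].

Definition region0 x y z : set (plane R) := [set p |
  [/\ sqnorm p < 1, S (E x y) -> 0 < det x y p, S (E y z) -> 0 < det y z p &
      S (E z x) -> 0 < det z x p]].

Definition centroid x y z : plane R := 3^-1 *: (x + y + z).

(* In barycentric coordinates, the cone from the centroid over the maps [emap] of
   the three sides: if the minimum is c, only the side from x to y contributes. *)
Definition Phi x y z (a b c : R) : plane R :=
  let m := Num.min a (Num.min b c) in
  m *: (x + y + z) + (emap x y (a - m) (b - m) - (a - m) *: x)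
  + (emap y z (b - m) (c - m) - (b - m) *: y)
  + (emap z x (c - m) (a - m) - (c - m) *: z).

Lemma Phi_rot x y z a b c : Phi x y z a b c = Phi y z x b c a.
Proof.
have e : Num.min a (Num.min b c) = Num.min b (Num.min c a) by rewrite minC -minA.
rewrite /Phi -e (_ : y + z + x = x + y + z); last by rewrite addrC addrA.
move: (_ *: _) (emap x y _ _ - _) (emap y z _ _ - _) (emap z x _ _ - _) => X A B C.
by rewrite -!addrA; congr (_ + _); rewrite addrC -addrA.
Qed.

Lemma Phi_continuous x y z :
  continuous (fun q : R * R * R => Phi x y z q.1.1 q.1.2 q.2).
Proof.
move=> q.
have c1 : (fun q : R * R * R => q.1.1) @ q --> q.1.1.
  by apply: (@continuous_comp _ _ _ fst fst); exact: cvg_fst.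
have c2 : (fun q : R * R * R => q.1.2) @ q --> q.1.2.
  by apply: (@continuous_comp _ _ _ fst snd); [exact: cvg_fst|exact: cvg_snd].
have c3 : (fun q : R * R * R => q.2) @ q --> q.2 by exact: cvg_snd.
have cm : (fun q : R * R * R => Num.min q.1.1 (Num.min q.1.2 q.2)) @ q
    --> Num.min q.1.1 (Num.min q.1.2 q.2).
  exact: (cvg_min_fun c1 (cvg_min_fun c2 c3)).
have ce u v (f h : R * R * R -> R) : f @ q --> f q -> h @ q --> h q ->
    (fun t => emap u v (f t) (h t)) @ q --> emap u v (f q) (h q).
  by move=> cf ch; apply: continuous2_cvg cf ch; exact: (@emap_continuous u v (f q, h q)).
have cs (f : R * R * R -> R) u : f @ q --> f q -> (fun t => f t *: u) @ q --> f q *: u.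
  by move=> cf; apply: cvgZ => //; exact: cvg_cst.
pose mf (t : R * R * R) := Num.min t.1.1 (Num.min t.1.2 t.2).
have A := ce x y (fun t => t.1.1 - mf t) (fun t => t.1.2 - mf t) (cvgB c1 cm) (cvgB c2 cm).
have B := ce y z (fun t => t.1.2 - mf t) (fun t => t.2 - mf t) (cvgB c2 cm) (cvgB c3 cm).
have C := ce z x (fun t => t.2 - mf t) (fun t => t.1.1 - mf t) (cvgB c3 cm) (cvgB c1 cm).
have A' := cs (fun t => t.1.1 - mf t) x (cvgB c1 cm).
have B' := cs (fun t => t.1.2 - mf t) y (cvgB c2 cm).
have C' := cs (fun t => t.2 - mf t) z (cvgB c3 cm).
have D := cs mf (x + y + z) cm.
exact: (cvgD (cvgD (cvgD D (cvgB (A _ _) (A' _))) (cvgB (B _ _) (B' _))) (cvgB (C _ _) (C' _))).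
Qed.

Lemma Phi_min x y z a b c : S1 x -> S1 y -> S1 z -> c <= a -> c <= b ->
  Phi x y z a b c = c *: (x + y + z) + emap x y (a - c) (b - c).
Proof.
move=> hx hy hz ca cb.
rewrite /Phi (min_r cb) (min_r ca) subrr emap_s0 // emap_0t //.
by rewrite scale0r subr0 subrr addr0 -addrA subrK.
Qed.

End Regions.

(** * Bijectivity of the cone map of one triangle *)

Section Triangles.
Context {R : realType} (Z : set (plane R)) (S : set {fset plane R}).
Context (Zadm : admissible Z) (Scl : is_cluster Z S).
Implicit Types (p q r g x y z u v w : plane R).

Local Notation ept := (ept Z).
Local Notation Phi := (Phi Z).
Local Notation region := (region S).
Local Notation region0 := (region0 S).

Let edge_S1 x y : is_edge Z S x y -> S1 x /\ S1 y.
Proof. by move=> /(edge_Z Scl)[/(Z_S1 Zadm) ? /(Z_S1 Zadm)]. Qed.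

Let itvC (t : R) : 0 <= t <= 1 -> 0 <= 1 - t <= 1.
Proof. lra. Qed.

Lemma ept_D2 x y t : is_edge Z S x y -> 0 <= t <= 1 -> D2 (ept x y t).
Proof.
case=> [Sxy|sxy|syx] ht.
- by have [|] := (ept_SP Zadm Scl (ept x y t) Sxy).1; first by exists t.
- have [|/D2_S1//] := (ept_succP Zadm (ept x y t) sxy).1; by exists t.
- rewrite eptC //; have [|/D2_S1//] := (ept_succP Zadm (ept y x (1 - t)) syx).1.
  by exists (1 - t) => //; exact: itvC.
Qed.

Lemma ept_side x y t a b : is_edge Z S x y -> 0 <= t <= 1 -> Z a -> Z b -> a <> b ->
  (exists2 w, Z w & 0 < det a b w) -> det a b x <= 0 -> det a b y <= 0 ->
  det a b (ept x y t) <= 0.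
Proof.
case=> [Sxy|sxy|syx] ht Za Zb nab [w Zw dw] dx dy.
- by rewrite (ept_S Scl) // det_mix; nra.
- have [|rS dr] := (ept_succP Zadm (ept x y t) sxy).1; first by exists t.
  exact: (succ_arc_side Zadm sxy _ _ nab _ dw).
- rewrite eptC //; have [|rS dr] := (ept_succP Zadm (ept y x (1 - t)) syx).1.
    by exists (1 - t) => //; exact: itvC.
  exact: (succ_arc_side Zadm syx _ _ nab _ dw).
Qed.

(** The equality case of [ept_side]. A chord on one side of a line meets it at an end or lies in it;
    an arc between neighbours can meet the line only in [a] or [b], which are points of [Z], hence
    only at its own ends. *)
Lemma ept_side_eq x y t a b : is_edge Z S x y -> 0 <= t <= 1 -> Z a -> Z b -> a <> b ->
  (exists2 w, Z w & 0 < det a b w) -> det a b x <= 0 -> det a b y <= 0 ->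
  det a b (ept x y t) = 0 -> (t != 1 -> x = a \/ x = b) /\ (t != 0 -> y = a \/ y = b).
Proof.
move=> exy ht Za Zb nab hw dx dy.
have [ha hb] := (Z_S1 Zadm Za, Z_S1 Zadm Zb).
have onsucc u v s : Defs.succ Z u v -> 0 <= s <= 1 -> det a b (ept u v s) = 0 ->
    (s != 1 -> u = a \/ u = b) /\ (s != 0 -> v = a \/ v = b).
  move=> suv hs d0; have [Zu Zv nuv h] := (succE Zadm u v).1 suv.
  have [hu hv] := (Z_S1 Zadm Zu, Z_S1 Zadm Zv).
  have euv : is_edge Z S u v by apply: Or32.
  have [|rS dr] := (ept_succP Zadm (ept u v s) suv).1; first by exists s.
  have rab := det_eq0_S1 ha hb nab rS d0.
  have Zr : Z (ept u v s) by case: rab => ->.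
  have /(det_eq0_S1 hu hv nuv rS) : det u v (ept u v s) = 0.
    by apply/eqP; rewrite eq_le dr h.
  case=> e.
    have s0 : s = 0 by apply: (ept_inj Zadm Scl euv) => //; rewrite ?lexx ?ler01 // ept0.
    by split=> [_|]; [rewrite -e|rewrite s0 eqxx].
  have s1 : s = 1 by apply: (ept_inj Zadm Scl euv) => //; rewrite ?lexx ?ler01 // ept1.
  by split=> [|_]; [rewrite s1 eqxx|rewrite -e].
case: exy => [Sxy|sxy|syx].
- rewrite (ept_S Scl) // det_mix => d0; have [hx hy] := edge_S1 (Or31 _ _ Sxy).
  split=> nt; apply: det_eq0_S1 => //; [have : t < 1|have : 0 < t]; first lra.
  + by move=> t1; nra.
  + lra.
  + by move=> t1; nra.
- exact: onsucc.
- rewrite eptC // => /(onsucc _ _ _ syx (itvC ht))[h1 h2]; split=> nt.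
    by apply: h2; lra.
  by apply: h1; lra.
Qed.

Lemma region_rot x y z p : region x y z p -> region y z x p.
Proof. by case. Qed.

Lemma region0_rot x y z p : region0 x y z p -> region0 y z x p.
Proof. by case. Qed.

Lemma region0_sub x y z : region0 x y z `<=` region x y z.
Proof. by move=> p [h0 h1 h2 h3]; split=> [|/h1/ltW|/h2/ltW|/h3/ltW] //; exact: ltW. Qed.

Lemma region_mix x y z k p q : 0 <= k <= 1 -> region x y z p -> region x y z q ->
  region x y z (mix k p q).
Proof.
move=> hk [p0 p1 p2 p3] [q0 q1 q2 q3]; split; first exact: D2_mix.
- by move=> h; rewrite det_mix; have := p1 h; have := q1 h; nra.
- by move=> h; rewrite det_mix; have := p2 h; have := q2 h; nra.
- by move=> h; rewrite det_mix; have := p3 h; have := q3 h; nra.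
Qed.

Lemma region0_mix x y z k p q : 0 <= k < 1 -> region0 x y z p -> region x y z q ->
  region0 x y z (mix k p q).
Proof.
move=> hk [p0 p1 p2 p3] [q0 q1 q2 q3]; split; first exact: sqnorm_mix_lt1.
- by move=> h; rewrite det_mix; have := p1 h; have := q1 h; nra.
- by move=> h; rewrite det_mix; have := p2 h; have := q2 h; nra.
- by move=> h; rewrite det_mix; have := p3 h; have := q3 h; nra.
Qed.

Lemma closed_region x y z : closed (region x y z).
Proof.
have cl (P : Prop) u v : closed [set p | P -> 0 <= det u v p].
  have [h|h] := pselect P; last first.
    have -> : [set p | P -> 0 <= det u v p] = setT.
      by apply/seteqP; split=> p //= _ /h.
    exact: closedT.
  rewrite (_ : mkset _ = det u v @^-1` [set t | 0 <= t]).
    by apply: preimage_closed => [p _|]; [exact: det_continuous|exact: closed_ge].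
  by apply/seteqP; split=> p //= h'; exact: h'.
rewrite (_ : region x y z = D2 `&` [set p | S (E x y) -> 0 <= det x y p] `&`
  [set p | S (E y z) -> 0 <= det y z p] `&` [set p | S (E z x) -> 0 <= det z x p]).
  by do 3 (apply: closedI => //); exact: closed_D2.
by apply/seteqP; split=> p; [case|case=> -[[]]].
Qed.

Lemma open_region0 x y z : open (region0 x y z).
Proof.
have op (P : Prop) u v : open [set p | P -> 0 < det u v p].
  have [h|h] := pselect P; last first.
    have -> : [set p | P -> 0 < det u v p] = setT.
      by apply/seteqP; split=> p //= _ /h.
    exact: openT.
  rewrite (_ : mkset _ = det u v @^-1` [set t | 0 < t]).
    by apply: open_comp => [p _|]; [exact: det_continuous|exact: open_gt].
  by apply/seteqP; split=> p //= h'; exact: h'.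
rewrite (_ : region0 x y z = sqnorm @^-1` [set t | t < 1] `&` [set p | S (E x y) -> 0 < det x y p] `&`
  [set p | S (E y z) -> 0 < det y z p] `&` [set p | S (E z x) -> 0 < det z x p]).
  do 3 (apply: openI => //).
  by apply: open_comp => [p _|]; [exact: sqnorm_continuous|exact: open_lt].
by apply/seteqP; split=> p; [case|case=> -[[]]].
Qed.

Section Triangle.
Context (x y z : plane R) (t3 : tri Z S x y z).

Let exy : is_edge Z S x y. Proof. by case: t3. Qed.
Let eyz : is_edge Z S y z. Proof. by case: t3. Qed.
Let ezx : is_edge Z S z x. Proof. by case: t3. Qed.
Let Zx : Z x. Proof. by have [] := edge_Z Scl exy. Qed.
Let Zy : Z y. Proof. by have [] := edge_Z Scl exy. Qed.
Let Zz : Z z. Proof. by have [] := edge_Z Scl eyz. Qed.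
Let hx : S1 x. Proof. exact: Z_S1 Zx. Qed.
Let hy : S1 y. Proof. exact: Z_S1 Zy. Qed.
Let hz : S1 z. Proof. exact: Z_S1 Zz. Qed.
Let d3 : 0 < det x y z. Proof. by case: t3. Qed.

(** The third vertex lies to the left of [x y], so [x] cannot be the successor of [y]. *)
Lemma tri_side : S (E x y) \/ Defs.succ Z x y.
Proof.
case: exy => [|sxy|/(succE Zadm)[_ _ _ /(_ _ Zz)]]; [by left|by right|].
by rewrite det_swap oppr_ge0 leNgt d3.
Qed.

Lemma ept_le0 t : 0 <= t <= 1 -> det x y (ept x y t) <= 0.
Proof.
move=> ht; have [Sxy|sxy] := tri_side.
  by have [|_ ->] := (ept_SP Zadm Scl (ept x y t) Sxy).1; first by exists t.
by have [|_] := (ept_succP Zadm (ept x y t) sxy).1; first by exists t.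
Qed.

Lemma region_side t : 0 <= t <= 1 -> region x y z (ept x y t).
Proof.
move=> ht; split; first exact: ept_D2.
- by move=> Sxy; have [|_ ->] := (ept_SP Zadm Scl (ept x y t) Sxy).1; first by exists t.
- move=> Syz; rewrite det_swap oppr_ge0; apply: ept_side => //.
  + by have [_ _ /nesym] := edge_Z Scl eyz.
  + by apply: (S_side Zadm Scl); rewrite E_sym.
  + by rewrite det_swap oppr_le0 -det_cyc ltW.
  + by rewrite det_xyy.
- move=> Szx; rewrite det_swap oppr_ge0; apply: ept_side => //.
  + by have [_ _ /nesym] := edge_Z Scl ezx.
  + by apply: (S_side Zadm Scl); rewrite E_sym.
  + by rewrite det_xyx.
  + by rewrite det_swap oppr_le0 det_cyc ltW.
Qed.

Lemma region0_side t : 0 <= t <= 1 -> ~ region0 x y z (ept x y t).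
Proof.
move=> ht [h0 h1 _ _]; have [Sxy|sxy] := tri_side.
  have [|_ e] := (ept_SP Zadm Scl (ept x y t) Sxy).1; first by exists t.
  by move: (h1 Sxy); rewrite e ltxx.
have [|h _] := (ept_succP Zadm (ept x y t) sxy).1; first by exists t.
by move: h0; rewrite (h : sqnorm _ = 1) ltxx.
Qed.

Lemma det_centroid a b : det a b (centroid x y z) = (det a b x + det a b y + det a b z) / 3.
Proof. by rewrite /centroid /det /= /GRing.scale /=; field. Qed.

Lemma region0_centroid : region0 x y z (centroid x y z).
Proof.
split; rewrite ?det_centroid.
- rewrite (_ : centroid x y z = mix 3^-1 (mix 2^-1 x y) z).
    apply: sqnorm_mix_lt1; [lra| |exact: D2_S1].
    by apply: open_chord_lt1 => //; [by have [] := edge_Z Scl exy|lra].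
  by rewrite /centroid !mixE; apply: plane_eqP; rewrite /= /GRing.scale /=; field.
- by move=> _; rewrite det_xyx det_xyy; move: d3; lra.
- by move=> _; rewrite det_xyx det_xyy -(det_cyc x y z); move: d3; lra.
- by move=> _; rewrite det_xyx det_xyy (det_cyc z x y); move: d3; lra.
Qed.

(* y is an extreme point of the disk, and the only one beyond both sides at y. *)
Lemma ept_common s t : 0 <= s <= 1 -> 0 <= t <= 1 -> det y z (ept y z t) <= 0 ->
  ept x y s = ept y z t -> s = 1 /\ t = 0.
Proof.
move=> hs ht; have := ept_le0 hs; have := ept_D2 exy hs.
move=> + + + e; rewrite -e; move pE : (ept x y s) => p Dp d1 d2.
have [_ _ nxy] := edge_Z Scl exy; have [_ _ nyz] := edge_Z Scl eyz.
have xy1 := dot_lt1 hx hy nxy; have yz1 := dot_lt1 hy hz nyz.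
have hy1 : y.1 ^+ 2 + y.2 ^+ 2 = 1 by [].
have py : p.1 * y.1 + p.2 * y.2 <= 1.
  have : 0 <= (p.1 - y.1) ^+ 2 + (p.2 - y.2) ^+ 2 by rewrite addr_ge0 ?sqr_ge0.
  by move: Dp; rewrite /D2 /sqnorm /=; lra.
(* Cramer's rule for [y - p] in terms of [y - x] and [y - z], paired with [y]. The left side is
   nonnegative and both terms on the right are nonpositive, so everything vanishes. *)
have key : det x y z * ((y.1 ^+ 2 + y.2 ^+ 2) - (p.1 * y.1 + p.2 * y.2)) =
    det y z p * ((y.1 ^+ 2 + y.2 ^+ 2) - (x.1 * y.1 + x.2 * y.2)) +
    det x y p * ((y.1 ^+ 2 + y.2 ^+ 2) - (y.1 * z.1 + y.2 * z.2)).
  by rewrite /det; ring.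
rewrite hy1 in key.
have A : 0 <= det x y z * (1 - (p.1 * y.1 + p.2 * y.2)).
  by apply: mulr_ge0; [exact: ltW d3|lra].
have B1 : det y z p * (1 - (x.1 * y.1 + x.2 * y.2)) <= 0 by apply: mulr_le0_ge0 => //; lra.
have B2 : det x y p * (1 - (y.1 * z.1 + y.2 * z.2)) <= 0 by apply: mulr_le0_ge0 => //; lra.
have dxy : det x y p = 0.
  apply/eqP; rewrite eq_le d1 /= -(@pmulr_lge0 _ (1 - (y.1 * z.1 + y.2 * z.2))); lra.
have dyz : det y z p = 0.
  apply/eqP; rewrite eq_le d2 /= -(@pmulr_lge0 _ (1 - (x.1 * y.1 + x.2 * y.2))); lra.
have [k pk] := line_param nxy dxy.
have py' : p = y.
  move: dyz; rewrite pk det_mix det_xyx mulr0 addr0 => /eqP.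
  rewrite mulf_eq0 => /orP[/eqP k1|/eqP e0].
    by rewrite (_ : k = 1) ?mix1 //; lra.
  by move: d3; rewrite det_cyc e0 ltxx.
split.
  by apply: (ept_inj Zadm Scl exy) => //; rewrite ?lexx ?ler01 // ept1 // pE.
by apply: (ept_inj Zadm Scl eyz) => //; rewrite ?lexx ?ler01 // ept0 // -e pE.
Qed.

Lemma boundary_side p : region x y z p -> S (E x y) -> det x y p = 0 ->
  exists2 t, 0 <= t <= 1 & p = ept x y t.
Proof. by move=> [Dp _ _ _] Sxy d0; apply/(ept_SP Zadm Scl). Qed.

Lemma boundary_arc p : region x y z p -> S1 p -> 0 < det y x p ->
  exists2 t, 0 <= t <= 1 & p = ept x y t.
Proof.
move=> [_ h _ _] pS d; have [/h|sxy] := tri_side; first by move: d; rewrite det_swap; lra.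
by apply/(ept_succP Zadm) => //; split=> //; move: d; rewrite det_swap; lra.
Qed.

(** The coordinates are those of the point at ratio [k] from the barycentre [(1/3, 1/3, 1/3)] to the
    point [(1 - t, t, 0)] of the side. *)
Lemma Phi_of_polar (k t : R) : 0 <= k <= 1 -> 0 <= t <= 1 ->
  Phi x y z ((1 - k) / 3 + k * (1 - t)) ((1 - k) / 3 + k * t) ((1 - k) / 3) =
  mix k (centroid x y z) (ept x y t).
Proof.
move=> hk ht.
have k1 : (1 - k) / 3 <= (1 - k) / 3 + k * (1 - t) by rewrite lerDl mulr_ge0; lra.
have k2 : (1 - k) / 3 <= (1 - k) / 3 + k * t by rewrite lerDl mulr_ge0; lra.
rewrite Phi_min //.
have -> : (1 - k) / 3 + k * (1 - t) - (1 - k) / 3 = k * (1 - t) by ring.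
have -> : (1 - k) / 3 + k * t - (1 - k) / 3 = k * t by ring.
rewrite /mix /centroid scalerA; congr (_ + _).
have [->|k0] := eqVneq k 0; last exact: emapZ.
by rewrite !mul0r scale0r emap_s0 // scale0r.
Qed.

(** A ray from an interior point leaves a convex region only once: with [k <> k'], one of [r], [r']
    would lie strictly nearer to [g] than the other on a common ray, hence in [region0]. *)
Lemma mix_boundary_inj g k k' r r' : region0 x y z g -> 0 <= k <= 1 -> 0 <= k' <= 1 ->
  region x y z r -> ~ region0 x y z r -> region x y z r' -> ~ region0 x y z r' ->
  mix k g r = mix k' g r' -> k = k' /\ (k != 0 -> r = r').
Proof.
move=> g0.
have lt (a b : R) u v : 0 <= a <= 1 -> 0 <= b <= 1 -> region x y z u -> ~ region0 x y z v ->
    mix a g u = mix b g v -> ~ a < b.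
  move=> ha hb ru nv; rewrite !mixE => -[e1 e2] ab; apply: nv.
  rewrite (_ : v = mix (a / b) g u).
    by apply: region0_mix => //; rewrite divr_ge0 ?ltr_pdivrMr; lra.
  have b0 : b != 0 by lra.
  have bE (s t : R) : b * ((1 - a / b) * s + a / b * t) = (b - a) * s + a * t by field.
  by rewrite mixE; apply: plane_eqP => /=; apply: (mulfI b0); rewrite bE; lra.
move=> hk hk' rr nr rr' nr' e.
have kk : k = k'.
  apply/eqP; rewrite eq_le !leNgt; apply/andP; split; apply/negP.
    exact: lt (esym e).
  exact: lt e.
split=> // k0; move: e; rewrite -kk !mixE => -[e1 e2].
by apply: plane_eqP; apply: (mulfI k0); lra.
Qed.

(** Follow the ray from the centroid through [p] to the last parameter in the region. Closedness of
    [region] puts the end in it; openness of [region0] keeps the end out of [region0]. *)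
Lemma polar_ex p : region x y z p -> exists k r,
  [/\ 0 <= k <= 1, region x y z r, ~ region0 x y z r & p = mix k (centroid x y z) r].
Proof.
have g0 := region0_centroid; move: (centroid x y z) g0 => g g0 rp.
have [->|/eqP pg] := eqVneq p g.
  exists 0, (ept x y 0); split; rewrite ?mix0 //; first by rewrite lexx ler01.
    by apply: region_side; rewrite lexx ler01.
  by apply: region0_side; rewrite lexx ler01.
pose T := [set s : R | 0 <= s /\ region x y z (mix s g p)].
have T1 : T 1 by split; rewrite ?mix1.
have cm : continuous (fun s : R => mix s g p).
  move=> s; rewrite /mix; apply: cvgD; apply: cvgZ; try exact: cvg_cst; last exact: cvg_id.
  by apply: cvgB; [exact: cvg_cst|exact: cvg_id].
pose d := (p.1 - g.1) ^+ 2 + (p.2 - g.2) ^+ 2.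
have d0 : 0 < d.
  rewrite lt_neqAle addr_ge0 ?sqr_ge0 // andbT eq_sym paddr_eq0 ?sqr_ge0 //.
  rewrite !sqrf_eq0 !subr_eq0; apply/negP => /andP[/eqP h1 /eqP h2].
  by apply: pg; apply: plane_eqP.
(* Two points of the disk are at distance at most 2, so [s^2 d <= 4], and [s <= s^2] when [s > 1];
   the summand 1 covers [s <= 1]. *)
have Tub : ubound T (1 + 4 / d).
  move=> s [s0 [Ds _ _ _]]; have [Dg _ _ _] := g0; have q0 : 0 < 4 / d by apply: divr_gt0.
  have [s1|s1] := leP s 1; first lra.
  suff : s * s * d <= 4.
    by rewrite -ler_pdivlMr // => h; have : s * 1 <= s * s by [rewrite ler_pM2l; lra]; lra.
  move: Ds Dg; rewrite mixE /D2 /sqnorm /d /=.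
  set u1 := _ + s * p.1; set u2 := _ + s * p.2 => Ds Dg.
  have -> : s * s * ((p.1 - g.1) ^+ 2 + (p.2 - g.2) ^+ 2) = (u1 - g.1) ^+ 2 + (u2 - g.2) ^+ 2.
    by rewrite /u1 /u2; ring.
  have := sqr_ge0 (u1 + g.1); have := sqr_ge0 (u2 + g.2); lra.
have Tne : T !=set0 by exists 1.
set s0 := sup T; have Ts s : T s -> s <= s0 by move=> h; apply: ub_le_sup h; exists (1 + 4 / d).
have s01 : 1 <= s0 by exact: Ts.
have rs : region x y z (mix s0 g p).
  apply: contrapT => nr; have : nbhs s0 ((fun s => mix s g p) @^-1` (~` region x y z)).
    by apply: cm; apply: open_nbhs_nbhs; split=> //; exact/closed_openC/closed_region.
  move=> /nbhs_ballP[e /= e0 he].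
  have [|s [s_ge0 rs] hs] := @sup_adherent _ T e e0; first by split=> //; exists (1 + 4 / d).
  apply: (he s) => //; have := Ts s; rewrite /ball /= ltr_norml -/s0 in hs * => h.
  have : T s by split=> //; lra.
  by move/h; lra.
exists s0^-1, (mix s0 g p); split=> //.
- by rewrite invr_ge0 invf_le1; lra.
- move=> r0; have : nbhs s0 ((fun s => mix s g p) @^-1` (region0 x y z)).
    by apply: cm; apply: open_nbhs_nbhs; split=> //; exact: open_region0.
  move=> /nbhs_ballP[e /= e0 he].
  have : T (s0 + e / 2).
    split; first lra.
    by apply: region0_sub; apply: he; rewrite /ball /= ltr_norml; lra.
  by move/Ts; lra.
- have n0 : s0 != 0 by rewrite gt_eqF // (lt_le_trans ltr01).
  by rewrite !mixE; apply: plane_eqP => /=; field.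
Qed.

Lemma polarP (a b c : R) : 0 <= c -> a + b + c = 1 -> c <= a -> c <= b ->
  exists k t, [/\ 0 <= k <= 1, 0 <= t <= 1,
    [/\ a = (1 - k) / 3 + k * (1 - t), b = (1 - k) / 3 + k * t & c = (1 - k) / 3] &
    Phi x y z a b c = mix k (centroid x y z) (ept x y t)].
Proof.
move=> c0 e ca cb; have [k0|k0] := eqVneq (1 - 3 * c) 0.
  (* The barycentre is the apex of the cone, where [t] is arbitrary. *)
  exists 0, 0; have [-> [-> ->]] : a = 1 / 3 /\ b = 1 / 3 /\ c = 1 / 3 by lra.
  have h : 0 <= (0 : R) <= 1 by rewrite lexx ler01.
  split=> //; first by split; field.
  by rewrite -Phi_of_polar // !mul0r !addr0 subr0.
have kgt : 0 < 1 - 3 * c by lra.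
exists (1 - 3 * c), ((b - c) / (1 - 3 * c)).
have h : 0 <= (b - c) / (1 - 3 * c) <= 1 by rewrite divr_ge0 ?ler_pdivrMr //; lra.
have hk : 0 <= 1 - 3 * c <= 1 by lra.
have aE : a = (1 - (1 - 3 * c)) / 3 + (1 - 3 * c) * (1 - (b - c) / (1 - 3 * c)).
  by rewrite (_ : a = 1 - b - c); [field|lra].
have bE : b = (1 - (1 - 3 * c)) / 3 + (1 - 3 * c) * ((b - c) / (1 - 3 * c)) by field.
have cE : c = (1 - (1 - 3 * c)) / 3 by field.
by split=> //; rewrite -Phi_of_polar // -aE -bE -cE.
Qed.

Lemma region_ept_polar (k t : R) : 0 <= k <= 1 -> 0 <= t <= 1 ->
  region x y z (mix k (centroid x y z) (ept x y t)).
Proof.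
by move=> hk ht; apply: region_mix => //; [exact/region0_sub/region0_centroid|exact: region_side].
Qed.

End Triangle.

Definition bary (a b c : R) := [/\ 0 <= a, 0 <= b, 0 <= c & a + b + c = 1].

Lemma bary_rot a b c : bary a b c -> bary b c a.
Proof. by case=> ? ? ? ?; split=> //; lra. Qed.

(** A rotation makes the third coordinate the smallest, so that [Phi] is the cone over the side
    [x y]. *)
Lemma bary_wlog (P : plane R -> plane R -> plane R -> R -> R -> R -> Prop) :
  (forall x y z a b c, P x y z a b c -> P y z x b c a) ->
  (forall x y z a b c, tri Z S x y z -> bary a b c -> c <= a -> c <= b -> P x y z a b c) ->
  forall x y z a b c, tri Z S x y z -> bary a b c -> P x y z a b c.
Proof.
move=> rot h x y z a b c t b3.
have [ab|/ltW ba] := leP a b; have [bc|/ltW cb] := leP b c; have [ac|/ltW ca] := leP a c.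
all: try (by apply: h => //; lra).
all: try (by apply: rot; apply: h; [exact/tri_rot/tri_rot|exact/bary_rot/bary_rot|lra|lra]).
all: by apply: (rot z x y c a b); apply: (rot y z x b c a); apply: h; [exact/tri_rot|exact/bary_rot|lra|lra].
Qed.

Lemma Phi_region x y z a b c : tri Z S x y z -> bary a b c -> region x y z (Phi x y z a b c).
Proof.
apply: (@bary_wlog (fun x y z a b c => region x y z (Phi x y z a b c))) => {x y z a b c}.
  by move=> x y z a b c; rewrite Phi_rot => /region_rot.
move=> x y z a b c t [_ _ c0 e] ca cb.
by have [k [s [hk hs _ ->]]] := polarP t c0 e ca cb; exact: region_ept_polar.
Qed.

Lemma Phi_region0 x y z a b c : tri Z S x y z -> bary a b c ->
  region0 x y z (Phi x y z a b c) <-> [/\ 0 < a, 0 < b & 0 < c].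
Proof.
apply: (@bary_wlog (fun x y z a b c => region0 x y z (Phi x y z a b c) <-> [/\ 0 < a, 0 < b & 0 < c])) => {x y z a b c}.
  move=> x y z a b c; rewrite Phi_rot => h; split=> [/region0_rot/region0_rot/h[? ? ?]//|[? ? ?]].
  by apply: region0_rot; apply/h.
move=> x y z a b c t [_ _ c0 e] ca cb.
have [k [s [hk hs [_ _ cE] ->]]] := polarP t c0 e ca cb; split.
  have [->|k1] := eqVneq k 1; first by rewrite mix1 => /(region0_side t hs).
  by move=> _; split; lra.
move=> [_ _ c_gt0]; apply: region0_mix; [lra|exact: region0_centroid|exact: region_side].
Qed.

(** By [polar_ex] it suffices that a point outside [region0] lies on a side. On [S1] it is a vertex
    or belongs to one of the three arcs; inside the disk one of the half-plane inequalities must be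
    an equality. *)
Lemma Phi_surj x y z p : tri Z S x y z -> region x y z p ->
  exists a b c, bary a b c /\ p = Phi x y z a b c.
Proof.
move=> t rp; have [k [r [hk rr nr ->]]] := polar_ex t rp.
have side u v w s : tri Z S u v w -> 0 <= s <= 1 -> exists a b c, bary a b c /\
    mix k (centroid u v w) (ept u v s) = Phi u v w a b c.
  move=> t' hs; exists ((1 - k) / 3 + k * (1 - s)), ((1 - k) / 3 + k * s), ((1 - k) / 3).
  rewrite Phi_of_polar //; split=> //; split; last field; nra.
have cE : centroid y z x = centroid x y z by rewrite /centroid (addrC (y + z)) addrA.
have cE' : centroid z x y = centroid x y z by rewrite -cE /centroid (addrC (z + x)) addrA.
have t1 := tri_rot t; have t2 := tri_rot t1.
suff [s hs [->|[->|->]]] : exists2 s, 0 <= s <= 1 & r = ept x y s \/ r = ept y z s \/ r = ept z x s.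
- exact: side.
- have [a [b [c [b3 e]]]] := side _ _ _ s t1 hs; exists c, a, b.
  by split; [exact/bary_rot/bary_rot|rewrite Phi_rot -e cE].
- have [a [b [c [b3 e]]]] := side _ _ _ s t2 hs; exists b, c, a.
  by split; [exact/bary_rot|rewrite -Phi_rot -e cE'].
have [hx [hy hz]] : S1 x /\ S1 y /\ S1 z.
  by have [/(Z_S1 Zadm) ? /(Z_S1 Zadm) ? /(Z_S1 Zadm) ?] := tri_Z Scl t.
have i0 : 0 <= (0 : R) <= 1 by rewrite lexx ler01.
have rr1 := region_rot rr; have rr2 := region_rot rr1.
have [r1|r1] := ltP (sqnorm r) 1; last first.
  have rS : S1 r by apply/eqP; rewrite eq_le r1 andbT; case: rr.
  have [->|/eqP rx] := eqVneq r x; first by exists 0 => //; left; rewrite ept0.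
  have [->|/eqP ry] := eqVneq r y; first by exists 0 => //; right; left; rewrite ept0.
  have [->|/eqP rz] := eqVneq r z; first by exists 0 => //; right; right; rewrite ept0.
  have [_ _ _ d3] := t.
  have /or3P[d|d|d] := three_arcs hx hy hz rS d3 rx ry rz.
  - by have [s hs ->] := boundary_arc t rr rS d; exists s => //; left.
  - by have [s hs ->] := boundary_arc t1 rr1 rS d; exists s => //; right; left.
  - by have [s hs ->] := boundary_arc t2 rr2 rS d; exists s => //; right; right.
have [[Sxy d]|n1] := pselect (S (E x y) /\ det x y r = 0).
  by have [s hs ->] := boundary_side rr Sxy d; exists s => //; left.
have [[Syz d]|n2] := pselect (S (E y z) /\ det y z r = 0).
  by have [s hs ->] := boundary_side rr1 Syz d; exists s => //; right; left.
have [[Szx d]|n3] := pselect (S (E z x) /\ det z x r = 0).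
  by have [s hs ->] := boundary_side rr2 Szx d; exists s => //; right; right.
case: nr; case: rr => _ h1 h2 h3; split=> // h; rewrite lt_neqAle eq_sym ?h1 ?h2 ?h3 // andbT.
- by apply/eqP => d; apply: n1.
- by apply/eqP => d; apply: n2.
- by apply/eqP => d; apply: n3.
Qed.

(** Equal values have equal [k] and, unless [k = 0], equal boundary points. If these come from
    different sides, [ept_common] identifies them with the shared vertex. *)
Lemma Phi_inj x y z a b c a' b' c' : tri Z S x y z -> bary a b c -> bary a' b' c' ->
  Phi x y z a b c = Phi x y z a' b' c' -> [/\ a = a', b = b' & c = c'].
Proof.
move=> t b3; move: a' b' c'.
apply: (@bary_wlog (fun x y z a b c => forall a' b' c', bary a' b' c' ->
  Phi x y z a b c = Phi x y z a' b' c' -> [/\ a = a', b = b' & c = c'])) t b3 => {x y z a b c}.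
  move=> x y z a b c h a' b' c' b3; rewrite -Phi_rot (Phi_rot _ y z x).
  rewrite (Phi_rot _ z x y) => /h[]; first exact/bary_rot/bary_rot.
  by move=> -> -> ->.
move=> x y z a b c t [_ _ c0 e] ca cb.
have [k [s [hk hs [aE bE cE] ->]]] := polarP t c0 e ca cb.
move=> a' b' c' b3'; have [a0' b0' c0' e'] := b3'.
have t1 := tri_rot t; have t2 := tri_rot t1.
have g0 := region0_centroid t.
have cyz : centroid y z x = centroid x y z by rewrite /centroid (addrC (y + z)) addrA.
have czx : centroid z x y = centroid x y z by rewrite -cyz /centroid (addrC (z + x)) addrA.
have rs := region_side t hs; have ns := region0_side t hs.
have [[c1 c2]|[[c1 c2]|[c1 c2]]] : (c' <= a' /\ c' <= b') \/ (a' <= b' /\ a' <= c') \/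
    (b' <= c' /\ b' <= a').
  have [ab|/ltW ba] := leP a' b'; have [bc|/ltW cb'] := leP b' c'; have [ac|/ltW ca'] := leP a' c';
  by [left; split; lra|right; left; split; lra|right; right; split; lra].
- have [k' [s' [hk' hs' [-> -> ->] ->]]] := polarP t c0' e' c1 c2.
  move/(mix_boundary_inj g0 hk hk' rs ns (region_side t hs') (region0_side t hs')) => [kk].
  rewrite aE bE cE -kk; have [->|k0] := eqVneq k 0; first by rewrite !mul0r.
  by move/(_ isT)/(ept_inj Zadm Scl) => -> //; case: t.
- have e1' : b' + c' + a' = 1 by lra.
  have [k' [s' [hk' hs' [bE' cE' aE']]]] := polarP t1 a0' e1' c1 c2.
  rewrite -Phi_rot => -> ; rewrite cyz.
  have rs' : region x y z (ept y z s') by apply/region_rot/region_rot/(region_side t1 hs').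
  have ns' : ~ region0 x y z (ept y z s') by move/region0_rot; exact: (region0_side t1 hs').
  move/(mix_boundary_inj g0 hk hk' rs ns rs' ns') => [kk].
  rewrite aE bE cE aE' bE' cE' -kk; have [->|k0] := eqVneq k 0.
    by rewrite !mul0r !addr0.
  move/(_ isT)/(ept_common t hs hs' (ept_le0 t1 hs')) => [-> ->].
  by split; ring.
- have e1' : c' + a' + b' = 1 by lra.
  have [k' [s' [hk' hs' [cE' aE' bE']]]] := polarP t2 b0' e1' c1 c2.
  rewrite -(Phi_rot _ z x y) => ->; rewrite czx.
  have rs' : region x y z (ept z x s') by apply/region_rot/(region_side t2 hs').
  have ns' : ~ region0 x y z (ept z x s').
    by move/region0_rot/region0_rot; exact: (region0_side t2 hs').
  move/(mix_boundary_inj g0 hk hk' rs ns rs' ns') => [kk].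
  rewrite aE bE cE aE' bE' cE' -kk; have [->|k0] := eqVneq k 0.
    by rewrite !mul0r !addr0.
  move/(_ isT)/esym/(ept_common t2 hs' hs (ept_le0 t hs)) => [-> ->].
  by split; ring.
Qed.

(** Three distinct points of [S1] are not all on one line, so the centroid is strictly off [A B]. A
    point on the line therefore has [k = 1], lies on a side, and [ept_side_eq] applies. *)
Lemma Phi_line x y z a b c A B : tri Z S x y z -> bary a b c -> Z A -> Z B -> A <> B ->
  (exists2 w, Z w & 0 < det A B w) -> det A B x <= 0 -> det A B y <= 0 -> det A B z <= 0 ->
  det A B (Phi x y z a b c) <= 0 /\ (det A B (Phi x y z a b c) = 0 ->
    [/\ a != 0 -> x = A \/ x = B, b != 0 -> y = A \/ y = B & c != 0 -> z = A \/ z = B]).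
Proof.
move=> t b3 ZA ZB nAB hw.
apply: (@bary_wlog (fun x y z a b c => det A B x <= 0 -> det A B y <= 0 -> det A B z <= 0 ->
  det A B (Phi x y z a b c) <= 0 /\ (det A B (Phi x y z a b c) = 0 ->
    [/\ a != 0 -> x = A \/ x = B, b != 0 -> y = A \/ y = B & c != 0 -> z = A \/ z = B]))) t b3 => {x y z a b c}.
  move=> x y z a b c h dy dz dx; rewrite -Phi_rot; have [h1 h2] := h dx dy dz.
  by split=> // /h2[].
move=> x y z a b c t [_ _ c0 e] ca cb dx dy dz.
have [k [s [hk hs [aE bE cE] ->]]] := polarP t c0 e ca cb.
have [exy eyz ezx d3] := t.
have ds := ept_side exy hs ZA ZB nAB hw dx dy.
have dg : det A B (centroid x y z) < 0.
  rewrite det_centroid // ltNge; apply/negP => h.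
  have [ZX ZY nxy] := edge_Z Scl exy; have [_ ZZ nyz] := edge_Z Scl eyz.
  have [_ _ nzx] := edge_Z Scl ezx.
  have hA := Z_S1 Zadm ZA; have hB := Z_S1 Zadm ZB.
  have zX := det_eq0_S1 hA hB nAB (Z_S1 Zadm ZX).
  have zY := det_eq0_S1 hA hB nAB (Z_S1 Zadm ZY).
  have zZ := det_eq0_S1 hA hB nAB (Z_S1 Zadm ZZ).
  have [|x1|x1] := zX; first lra.
    have [|y1|y1] := zY; [lra|by case: nxy; rewrite x1 y1|].
    have [|z1|z1] := zZ; [lra|by case: nzx; rewrite x1 z1|by case: nyz; rewrite y1 z1].
  have [|y1|y1] := zY; [lra| |by case: nxy; rewrite x1 y1].
  have [|z1|z1] := zZ; [lra|by case: nyz; rewrite y1 z1|by case: nzx; rewrite x1 z1].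
rewrite det_mix; split; first nra.
move=> d0; have k1 : k = 1 by nra.
have d1 : det A B (ept x y s) = 0 by move: d0; rewrite k1; lra.
have [h1 h2] := ept_side_eq exy hs ZA ZB nAB hw dx dy d1.
rewrite aE bE cE k1; split=> h.
- by apply: h1; apply: contra_neq h => ->; ring.
- by apply: h2; apply: contra_neq h => ->; ring.
- by move: h; rewrite subrr mul0r eqxx.
Qed.

End Triangles.

(** * Gluing the triangles *)

Section Triangulation.
Context {R : realType} (Z : set (plane R)) (S : set {fset plane R}).
Context (Zadm : admissible Z) (Scl : is_cluster Z S).
Implicit Types (p q r g x y z u v w : plane R) (f : plane R -> R).

Local Notation tri := (tri Z S).
Local Notation region := (region S).

Definition PhiF x y z f := Phi Z x y z (f x) (f y) (f z).

Lemma simplex3P x y z f : x <> y -> y <> z -> z <> x ->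
  Defs.simplex [fset x; y; z]%fset f <->
  bary (f x) (f y) (f z) /\ forall v, v <> x -> v <> y -> v <> z -> f v = 0.
Proof.
move=> nxy nyz nzx.
have sumE : \sum_(v <- [fset x; y; z]%fset) f v = f x + f y + f z.
  rewrite fsetUC big_fsetU1 /= ?big_fsetU1 /= ?big_seq_fset1.
  - by rewrite addrC.
  - by rewrite inE; apply/eqP.
  - by rewrite !inE; apply/norP; split; apply/eqP => //; exact: nesym.
split=> [[h1 h2 h3]|[[h1 h2 h3 e] h]]; split.
- by split=> //; rewrite -sumE.
- move=> v vx vy vz; apply: h2; rewrite !inE.
  by apply/norP; split; [apply/norP; split|]; apply/eqP.
- move=> v; have [->//|/eqP vx] := eqVneq v x; have [->//|/eqP vy] := eqVneq v y.
  by have [->//|/eqP vz] := eqVneq v z; rewrite h.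
- move=> v; rewrite !inE => /norP[/norP[/eqP vx /eqP vy] /eqP vz]; exact: h.
- by rewrite sumE.
Qed.

Lemma tri_neq x y z : tri x y z -> [/\ x <> y, y <> z & z <> x].
Proof. by move=> [/(edge_Z Scl)[_ _ ?] /(edge_Z Scl)[_ _ ?] /(edge_Z Scl)[_ _ ?] _]. Qed.

Lemma tri_simplexP x y z f : tri x y z ->
  Defs.simplex [fset x; y; z]%fset f <->
  bary (f x) (f y) (f z) /\ forall v, v <> x -> v <> y -> v <> z -> f v = 0.
Proof. by move=> /tri_neq[? ? ?]; exact: simplex3P. Qed.

Lemma PhiF_rot x y z f : PhiF y z x f = PhiF x y z f.
Proof. by rewrite /PhiF -Phi_rot. Qed.

(** Both triangles are counterclockwise, which leaves only the rotations. *)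
Lemma tri_perm x y z x' y' z' : tri x y z -> tri x' y' z' ->
  x' = x \/ x' = y \/ x' = z -> y' = x \/ y' = y \/ y' = z -> z' = x \/ z' = y \/ z' = z ->
  [\/ [/\ x' = x, y' = y & z' = z], [/\ x' = y, y' = z & z' = x] |
      [/\ x' = z, y' = x & z' = y]].
Proof.
move=> t t'; have [n1 n2 n3] := tri_neq t'.
have [_ _ _ d] := t; have [_ _ _ d'] := t'.
have dyxz : det y x z < 0 by rewrite det_swap oppr_lt0.
have dzyx : det z y x < 0 by rewrite det_cyc.
have dxzy : det x z y < 0 by rewrite det_cyc.
case=> [e1|[e1|e1]] [e2|[e2|e2]] [e3|[e3|e3]]; rewrite ?e1 ?e2 ?e3 in n1 n2 n3 d' *;
  try (by []); try (exfalso; lra).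
- by apply: Or31.
- by apply: Or32.
- by apply: Or33.
Qed.

Lemma PhiF_perm x y z x' y' z' f : tri x y z -> tri x' y' z' ->
  x' = x \/ x' = y \/ x' = z -> y' = x \/ y' = y \/ y' = z -> z' = x \/ z' = y \/ z' = z ->
  PhiF x' y' z' f = PhiF x y z f.
Proof.
move=> t t' h1 h2 h3.
case: (tri_perm t t' h1 h2 h3) => -[-> -> ->] //; first exact: PhiF_rot.
by rewrite -[RHS]PhiF_rot -[RHS]PhiF_rot.
Qed.

Lemma PhiF_edge x y z f : tri x y z -> Defs.simplex [fset x; y; z]%fset f -> f z = 0 ->
  PhiF x y z f = emap Z x y (f x) (f y).
Proof.
move=> t /(tri_simplexP _ t)[[h1 h2 h3 e] _] fz; rewrite /PhiF fz.
have [/(Z_S1 Zadm) ? /(Z_S1 Zadm) ? /(Z_S1 Zadm) ?] := tri_Z Scl t.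
by rewrite Phi_min // scale0r add0r !subr0.
Qed.

Lemma PhiF_degenerate x y z f : tri x y z -> Defs.simplex [fset x; y; z]%fset f ->
  f x = 0 \/ f y = 0 \/ f z = 0 -> exists u v, [/\ is_edge Z S u v,
    PhiF x y z f = emap Z u v (f u) (f v) & forall w, w <> u -> w <> v -> f w = 0].
Proof.
move=> t fs.
have base u v w : tri u v w -> Defs.simplex [fset u; v; w]%fset f -> f w = 0 ->
   exists a b, [/\ is_edge Z S a b, PhiF u v w f = emap Z a b (f a) (f b) &
    forall c, c <> a -> c <> b -> f c = 0].
  move=> t' fs' fw; exists u, v; split; [by case: t'|exact: PhiF_edge|].
  move=> c cu cv; have [->//|/eqP cw] := eqVneq c w.
  by have [_ ->] := (tri_simplexP f t').1 fs'.
case=> [fx|[fy|fz]].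
- by rewrite -PhiF_rot; apply: base => //; [exact: tri_rot|rewrite fset3_rot].
- rewrite -PhiF_rot -PhiF_rot; apply: base => //; [exact/tri_rot/tri_rot|].
  by rewrite fset3_rot fset3_rot.
- exact: base.
Qed.

(** [f] is supported on the common vertices of both edges: if there are two, the edges agree up to
    order; if one, both sides are its multiple by the value of [f]; if none, both vanish. *)
Lemma emap_consistent x y x' y' f : S1 x -> S1 y -> S1 x' -> S1 y' -> x <> y -> x' <> y' ->
  (forall w, w <> x -> w <> y -> f w = 0) -> (forall w, w <> x' -> w <> y' -> f w = 0) ->
  emap Z x y (f x) (f y) = emap Z x' y' (f x') (f y').
Proof.
move=> hx hy hx' hy' nxy nxy' f1 f2.
have [xx'|/eqP xx'] := eqVneq x x'.
  have [->|/eqP yy'] := eqVneq y y'; first by rewrite xx'.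
  rewrite (f2 y) ?emap_s0 //; last by rewrite -xx'; exact: nesym.
  by rewrite (f1 y') ?emap_s0 ?xx' // => e; [apply: nxy'|apply: yy'].
have [xy'|/eqP xy'] := eqVneq x y'.
  have [->|/eqP yx'] := eqVneq y x'; first by rewrite xy' emapC.
  have fy : f y = 0 by apply: f2 => //; rewrite -xy'; exact: nesym.
  have fx' : f x' = 0 by apply: f1; [exact: nesym|exact: nesym].
  by rewrite fy fx' emap_s0 // emap_0t // xy'.
rewrite (f2 x) // emap_0t //.
have [yx'|/eqP yx'] := eqVneq y x'.
  have fy' : f y' = 0 by apply: f1; [exact: nesym|rewrite yx'; exact: nesym].
  by rewrite fy' emap_s0 // yx'.
have [yy'|/eqP yy'] := eqVneq y y'.
  have fx' : f x' = 0 by apply: f1; [exact: nesym|rewrite yy'].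
  by rewrite fx' emap_0t // yy'.
have fy : f y = 0 by exact: f2.
have fx' : f x' = 0 by apply: f1; exact: nesym.
have fy' : f y' = 0 by apply: f1; exact: nesym.
by rewrite fy fx' fy' emap_s0 // !scale0r.
Qed.

Lemma simplex_vertex x y z f v : tri x y z -> Defs.simplex [fset x; y; z]%fset f ->
  f v <> 0 -> v = x \/ v = y \/ v = z.
Proof.
move=> t /(tri_simplexP f t)[_ h] fv.
have [->|/eqP v1] := eqVneq v x; first by left.
have [->|/eqP v2] := eqVneq v y; first by right; left.
by have [->|/eqP v3] := eqVneq v z; [right; right|case: fv; exact: h].
Qed.

(** If no coordinate vanishes at the vertices of one triangle, these are all vertices of the other.
    Otherwise each value is computed on an edge. *)
Lemma PhiF_consistent x y z x' y' z' f : tri x y z -> tri x' y' z' ->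
  Defs.simplex [fset x; y; z]%fset f -> Defs.simplex [fset x'; y'; z']%fset f ->
  PhiF x y z f = PhiF x' y' z' f.
Proof.
move=> t t' fs fs'.
have all_vertices u v w u' v' w' : tri u v w -> tri u' v' w' ->
    Defs.simplex [fset u'; v'; w']%fset f -> ~ (f u = 0 \/ f v = 0 \/ f w = 0) ->
    PhiF u v w f = PhiF u' v' w' f.
  move=> s s' fs1 /not_orP[n1 /not_orP[n2 n3]].
  by apply: PhiF_perm => //; exact: (simplex_vertex s' fs1).
have [D|nD] := pselect (f x = 0 \/ f y = 0 \/ f z = 0); last exact: all_vertices.
have [D'|nD'] := pselect (f x' = 0 \/ f y' = 0 \/ f z' = 0); last first.
  by apply/esym; exact: all_vertices.
have [u [v [euv -> fuv]]] := PhiF_degenerate t fs D.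
have [u' [v' [euv' -> fuv']]] := PhiF_degenerate t' fs' D'.
have [/(Z_S1 Zadm) ? /(Z_S1 Zadm) ? ?] := edge_Z Scl euv.
have [/(Z_S1 Zadm) ? /(Z_S1 Zadm) ? ?] := edge_Z Scl euv'.
exact: emap_consistent.
Qed.

(** A vertex [v] of the second triangle outside the first lies beyond one of its sides. The other
    two vertices of the second triangle are joined to [v] by edges, which cannot cross that side. *)
Lemma separation x y z x' y' z' v : tri x y z -> tri x' y' z' ->
  v = x' \/ v = y' \/ v = z' -> v <> x -> v <> y -> v <> z ->
  exists A B, [/\ S (E A B), A = x \/ A = y \/ A = z, B = x \/ B = y \/ B = z,
    [/\ 0 <= det A B x, 0 <= det A B y & 0 <= det A B z] &
    [/\ det A B x' <= 0, det A B y' <= 0 & det A B z' <= 0]].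
Proof.
move=> t t' hv vx vy vz.
have [Zx Zy Zz] := tri_Z Scl t; have [Zx' Zy' Zz'] := tri_Z Scl t'.
have Zv : Z v by case: hv => [->|[->|->]].
have far a b : det a b v < 0 -> (forall v', is_edge Z S v v' -> det a b v' <= 0) ->
    [/\ det a b x' <= 0, det a b y' <= 0 & det a b z' <= 0].
  move=> /ltW dv h; have [e1 e2 e3 _] := t'.
  case: hv h dv => [->|[->|->]] h dv; split=> //; apply: h => //; exact: edge_sym.
have base a b c : tri a b c -> 0 < det b a v -> S (E a b) /\
    [/\ det a b x' <= 0, det a b y' <= 0 & det a b z' <= 0].
  move=> tabc dv; have [_ _ Zc] := tri_Z Scl tabc; have [eab _ _ d] := tabc.
  have [Sab h] := edge_beyond Zadm Scl eab Zc Zv d dv; split=> //.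
  by apply: far => //; rewrite det_swap oppr_lt0.
have [_ _ _ d3] := t.
have t1 := tri_rot t; have t2 := tri_rot t1.
have [_ _ _ d1] := t1; have [_ _ _ d2] := t2.
have /or3P[d|d|d] := three_arcs (Z_S1 Zadm Zx) (Z_S1 Zadm Zy) (Z_S1 Zadm Zz)
  (Z_S1 Zadm Zv) d3 vx vy vz.
- have [Sab h] := base _ _ _ t d; exists x, y; split; auto.
  by split; rewrite ?det_xyx ?det_xyy //; exact: ltW.
- have [Sab h] := base _ _ _ t1 d; exists y, z; split; auto.
  by split; rewrite ?det_xyx ?det_xyy //; exact: ltW.
- have [Sab h] := base _ _ _ t2 d; exists z, x; split; auto.
  by split; rewrite ?det_xyx ?det_xyy //; exact: ltW.
Qed.

(** For different triangles, a common value lies on a separating chord [A B]. By the equality case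
    of [Phi_line], [f'] is then supported on [A] and [B]. These are vertices of the first triangle,
    so injectivity there applies. *)
Lemma PhiF_inj x y z x' y' z' f f' : tri x y z -> tri x' y' z' ->
  Defs.simplex [fset x; y; z]%fset f -> Defs.simplex [fset x'; y'; z']%fset f' ->
  PhiF x y z f = PhiF x' y' z' f' -> f = f'.
Proof.
move=> t t' fs fs'.
have same f2 : Defs.simplex [fset x; y; z]%fset f2 -> PhiF x y z f = PhiF x y z f2 -> f = f2.
  move=> fs2; have [b1 h1] := (tri_simplexP f t).1 fs; have [b2 h2] := (tri_simplexP f2 t).1 fs2.
  move=> /(Phi_inj Zadm Scl t b1 b2)[e1 e2 e3]; apply/funext => v.
  have [->//|/eqP v1] := eqVneq v x; have [->//|/eqP v2] := eqVneq v y.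
  by have [->//|/eqP v3] := eqVneq v z; rewrite h1 // h2.
have [fs2|nfs2] := pselect (Defs.simplex [fset x; y; z]%fset f').
  by rewrite (PhiF_consistent t' t fs' fs2); exact: same.
have [v [hv vx vy vz]] : exists v, [/\ v = x' \/ v = y' \/ v = z', v <> x, v <> y & v <> z].
  apply: contrapT => h; apply: nfs2.
  suff -> : [fset x; y; z]%fset = [fset x'; y'; z']%fset by [].
  have vert v : v = x' \/ v = y' \/ v = z' -> v = x \/ v = y \/ v = z.
    move=> hv; have [->|/eqP v1] := eqVneq v x; first by left.
    have [->|/eqP v2] := eqVneq v y; first by right; left.
    have [->|/eqP v3] := eqVneq v z; first by right; right.
    by case: h; exists v.
  have v1 : x' = x \/ x' = y \/ x' = z by apply: vert; auto.
  have v2 : y' = x \/ y' = y \/ y' = z by apply: vert; auto.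
  have v3 : z' = x \/ z' = y \/ z' = z by apply: vert; auto.
  case: (tri_perm t t' v1 v2 v3).
  - by move=> [-> -> ->].
  - by move=> [-> -> ->]; exact/esym/fset3_rot.
  - by move=> [-> -> ->]; exact: fset3_rot.
have [A [B [SAB hA hB [p1 p2 p3] [n1 n2 n3]]]] := separation t t' hv vx vy vz.
have [ZA ZB nAB _ _] := S_edge Scl SAB.
have sAB := S_side Zadm Scl SAB.
have sBA : exists2 w, Z w & 0 < det B A w by apply: (S_side Zadm Scl); rewrite E_sym.
have [b1 h1] := (tri_simplexP f t).1 fs; have [b2 h2] := (tri_simplexP f' t').1 fs'.
have [l1 _] := Phi_line Zadm Scl t b1 ZB ZA (nesym nAB) sBA
  (ltac:(by rewrite det_swap oppr_le0)) (ltac:(by rewrite det_swap oppr_le0))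
  (ltac:(by rewrite det_swap oppr_le0)).
have [l2 e2] := Phi_line Zadm Scl t' b2 ZA ZB nAB sAB n1 n2 n3.
move=> e; have d0 : det A B (PhiF x' y' z' f') = 0.
  by apply/eqP; rewrite eq_le l2 /= -e -oppr_le0 -det_swap.
have [c1 c2 c3] := e2 d0.
have supp v0 : v0 <> A -> v0 <> B -> f' v0 = 0.
  move=> vA vB; apply: contrapT => /eqP f0.
  have [ve|/eqP v1] := eqVneq v0 x'; first by rewrite ve in f0 vA vB; case: (c1 f0).
  have [ve|/eqP v2] := eqVneq v0 y'; first by rewrite ve in f0 vA vB; case: (c2 f0).
  have [ve|/eqP v3] := eqVneq v0 z'; first by rewrite ve in f0 vA vB; case: (c3 f0).
  by move: f0; rewrite h2 // eqxx.
case: nfs2; case: fs' => g1 g2 g3; split=> //.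
  move=> u; rewrite !inE => /norP[/norP[/eqP u1 /eqP u2] /eqP u3]; apply: supp.
    by move=> ue; move: hA; rewrite -ue => -[|[]].
  by move=> ue; move: hB; rewrite -ue => -[|[]].
rewrite -g3; apply: sum_support_eq g2 => u; rewrite !inE => /norP[/norP[/eqP u1 /eqP u2] /eqP u3].
apply: supp.
  by move=> ue; move: hA; rewrite -ue => -[|[]].
by move=> ue; move: hB; rewrite -ue => -[|[]].
Qed.

Lemma tri_hull x y z p : tri x y z -> region x y z p -> hull Z x y z p.
Proof.
move=> t rp; have [a [b [c [b3 ->]]]] := Phi_surj Zadm Scl t rp.
by move=> A B ZA ZB nAB hw d1 d2 d3; have [] := Phi_line Zadm Scl t b3 ZA ZB nAB hw d1 d2 d3.
Qed.

(** Beyond a side in [S] there is no point of the region; beyond a side between neighbours there is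
    an open half-plane free of [Z]. *)
Lemma arc_limit x y z p : tri x y z -> region x y z p -> 0 < det y x p -> limit_set Z p -> False.
Proof.
move=> t [_ h _ _] d [_ lp]; have [/h|/(succE Zadm)[_ _ _ sxy]] := tri_side Zadm Scl t.
  by move: d; rewrite det_swap; lra.
have [|q [_ Zq /=]] := lp [set q | 0 < det y x q].
  apply: open_nbhs_nbhs; split=> //.
  by apply: (@open_comp _ _ (det y x) [set t | 0 < t]); [move=> ? _; exact: det_continuous|exact: open_gt].
by have := sxy _ Zq; rewrite (det_swap y x); lra.
Qed.

Lemma region_limit x y z p : tri x y z -> region x y z p -> ~ limit_set Z p.
Proof.
move=> t rp lp; have [Zx Zy Zz] := tri_Z Scl t.
have nZ v : Z v -> p <> v by move=> Zv e; move: lp; rewrite e; exact: limit_set_notin.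
have [_ _ _ d3] := t; have t1 := tri_rot t; have t2 := tri_rot t1.
have /or3P[d|d|d] := three_arcs (Z_S1 Zadm Zx) (Z_S1 Zadm Zy) (Z_S1 Zadm Zz)
  lp.1 d3 (nZ _ Zx) (nZ _ Zy) (nZ _ Zz).
- exact: arc_limit t rp d lp.
- exact: (arc_limit t1 (region_rot rp) d lp).
- exact: (arc_limit t2 (region_rot (region_rot rp)) d lp).
Qed.

Context (conv : edges_converge Z S).

Lemma triangle_left_of x y w : is_edge Z S x y -> Z w -> 0 < det x y w -> exists z, tri x y z.
Proof.
move=> exy; have [Zx _ _] := edge_Z Scl exy.
by apply: triangle_left => //; exact: edges_finite.
Qed.

Lemma edge_triangle x y : is_edge Z S x y -> exists z, tri x y z \/ tri y x z.
Proof.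
move=> exy; case: (exy) => [Sxy|sxy|syx].
- by have [w Zw d] := S_side Zadm Scl Sxy; have [z t] := triangle_left_of exy Zw d; exists z; left.
- by have [w Zw d] := succ_side Zadm sxy; have [z t] := triangle_left_of exy Zw d; exists z; left.
- have [w Zw d] := succ_side Zadm syx.
  by have [z t] := triangle_left_of (edge_sym exy) Zw d; exists z; right.
Qed.

Lemma vertex_triangle x : Z x -> exists y z, tri x y z.
Proof.
move=> Zx; have [y sy] := pred_ex Zadm Zx.
have eyx : is_edge Z S y x by apply: Or32.
by have [z [t|t]] := edge_triangle eyx; [exists z, y; exact: tri_rot|exists y, z].
Qed.

Lemma triangles_finite (K : set (plane R)) : closed K -> K `&` limit_set Z = set0 ->
  finite_set [set t : plane R * plane R * plane R | tri t.1.1 t.1.2 t.2 /\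
    exists2 p, K p & region t.1.1 t.1.2 t.2 p].
Proof.
move=> cK KL; have fA := locally_finite Zadm Scl conv cK KL.
apply: sub_finite_set (finite_setX (finite_setX fA fA) fA).
move=> [[x y] z] /= [t [p Kp rp]]; have [e1 e2 e3 _] := t.
have Dp : D2 p by case: rp.
have h1 := tri_hull t rp; have h2 := tri_hull (tri_rot t) (region_rot rp).
have h3 := tri_hull (tri_rot (tri_rot t)) (region_rot (region_rot rp)).
split; [split|].
- by exists y, z, p; split=> //; exact: edge_sym.
- by exists z, x, p; split=> //; exact: edge_sym.
- by exists x, y, p; split=> //; exact: edge_sym.
Qed.

(** If all sides of a triangle joined neighbours, its vertices would exhaust [Z], which has at least
    four elements. *)
Lemma S_nonempty : exists u v, S (E u v).
Proof.
have [x [Zx _ _ _]] := Z_fourth Zadm 0 0 0; have [y [z t]] := vertex_triangle Zx.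
have t1 := tri_rot t; have t2 := tri_rot t1; have [_ _ _ d3] := t.
have [Sxy|/(succE Zadm)[_ Zy _ sxy]] := tri_side Zadm Scl t; first by exists x, y.
have [Syz|/(succE Zadm)[_ Zz _ syz]] := tri_side Zadm Scl t1; first by exists y, z.
have [Szx|/(succE Zadm)[_ _ _ szx]] := tri_side Zadm Scl t2; first by exists z, x.
have [w [Zw wx wy wz]] := Z_fourth Zadm x y z.
have Z1 := Z_S1 Zadm.
have := three_arcs (Z1 _ Zx) (Z1 _ Zy) (Z1 _ Zz) (Z1 _ Zw) d3 wx wy wz.
rewrite (det_swap x y) (det_swap y z) (det_swap z x).
by have := sxy _ Zw; have := syz _ Zw; have := szx _ Zw; lra.
Qed.

(** The path to [p] is a segment starting at the midpoint of an edge of [S], so that some chord is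
    met. Before [p] it stays in the open disk; hence it avoids the limit set and meets only finitely
    many chords. *)
Lemma covering p : D2 p -> ~ limit_set Z p -> exists x y z, tri x y z /\ region x y z p.
Proof.
move=> Dp nLp; have [u0 [v0 S0]] := S_nonempty.
have onchord u v : S (E u v) -> det u v p = 0 -> exists x y z, tri x y z /\ region x y z p.
  move=> Suv d0; have [w Zw dw] := S_side Zadm Scl Suv.
  have euv : is_edge Z S u v by apply: Or31.
  have [z t] := triangle_left_of euv Zw dw; exists u, v, z; split=> //.
  have [|k hk ->] := (ept_SP Zadm Scl p Suv).2; first by [].
  exact: region_side.
have [[u [v [Suv d0]]]|noch] := pselect (exists u v, S (E u v) /\ det u v p = 0).
  exact: onchord Suv d0.
have [Zu0 Zv0 nuv0 _ _] := S_edge Scl S0.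
pose q0 := mix 2^-1 u0 v0.
have q0lt : sqnorm q0 < 1.
  by apply: open_chord_lt1; [exact: Z_S1 Zu0|exact: Z_S1 Zv0|by []|lra].
pose K := (fun t => mix t q0 p) @` `[0, 1].
have cK : closed K.
  apply: compact_closed; first exact: norm_hausdorff.
  apply: continuous_compact; last exact: segment_compact.
  apply: continuous_subspaceT => s; rewrite /mix; apply: cvgD; apply: cvgZ; try exact: cvg_cst; last exact: cvg_id.
  by apply: cvgB; [exact: cvg_cst|exact: cvg_id].
have KL : K `&` limit_set Z = set0.
  apply/seteqP; split=> // r [[t /=]]; rewrite in_itv /= => /andP[t0 t1] <- lr.
  move: t1; rewrite le_eqVlt => /orP[/eqP t1|t1]; first by apply: nLp; rewrite t1 mix1 in lr.
  have : sqnorm (mix t q0 p) < 1 by apply: sqnorm_mix_lt1 => //; rewrite t0.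
  by rewrite (lr.1 : sqnorm _ = 1) ltxx.
pose F := [set e : plane R * plane R | S (E e.1 e.2) /\
   exists2 t, 0 <= t <= 1 & det e.1 e.2 (mix t q0 p) = 0].
have finF : finite_set F.
  have fA := locally_finite Zadm Scl conv cK KL.
  apply: sub_finite_set (finite_setX fA fA) => -[u v] /= [Suv [t ht d0]].
  have euv : is_edge Z S u v by apply: Or31.
  have [Zu Zv nuv] := edge_Z Scl euv.
  have Dt : D2 (mix t q0 p) by apply: D2_mix => //; exact: ltW.
  have Kt : K (mix t q0 p) by exists t; rewrite //= in_itv.
  have [k hk e] := chordP (Z_S1 Zadm Zu) (Z_S1 Zadm Zv) nuv Dt d0.
  have hl a b : det a b u <= 0 -> det a b v <= 0 -> det a b (mix t q0 p) <= 0.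
    by rewrite e det_mix; nra.
  split.
    by exists v, v, (mix t q0 p); split=> // a b _ _ _ _ d1 d2 _; exact: hl.
  exists u, u, (mix t q0 p); split=> //; try exact: edge_sym.
  by move=> a b _ _ _ _ d1 d2 _; exact: hl.
(* The parameter at which the segment from q0 to p meets the line of e. *)
pose tau (e : plane R * plane R) := det e.1 e.2 q0 / (det e.1 e.2 q0 - det e.1 e.2 p).
have F0 : F (u0, v0).
  split=> //; exists 0; rewrite ?lexx ?ler01 // mix0 det_mix det_xyx det_xyy; ring.
have [|[u v] Fuv umax] := finite_min (fun e => - tau e) finF; first by exists (u0, v0).
(* Reversing the edge changes both determinants in [tau] by a sign and leaves [tau] unchanged. *)
wlog dp : u v Fuv umax / 0 < det u v p.
  move=> h; have [Suv [t ht d0]] := Fuv; rewrite /= in Suv d0.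
  have [dp|dp|dp] := ltgtP (det u v p) 0; last by apply: (onchord u v).
    apply: (h v u); last by rewrite det_swap oppr_gt0.
      by split; [rewrite /= E_sym|exists t => //=; rewrite det_swap d0 oppr0].
    move=> e /umax; rewrite (_ : tau (v, u) = tau (u, v)) //.
    by rewrite /tau /= !(det_swap u v) -opprD invrN mulrNN.
  exact: (h u v).
have [Suv [t ht d0]] := Fuv; rewrite /= in Suv d0.
have [Zu Zv nuv _ _] := S_edge Scl Suv.
move: (d0); rewrite det_mix => d0'.
have tE : tau (u, v) = t.
  rewrite /tau /=; have n0 : det u v q0 - det u v p != 0.
    by apply/eqP => e; move: d0' dp; rewrite (_ : det u v q0 = det u v p); lra.
  by apply: (mulIf n0); rewrite divfK //; lra.
have t1 : t < 1.
  by rewrite lt_neqAle; case/andP: ht => _ ->; rewrite andbT; apply/eqP => e; move: d0' dp; rewrite e; lra.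
have qt1 : sqnorm (mix t q0 p) < 1.
  by apply: sqnorm_mix_lt1 => //; case/andP: ht => -> _.
(* A chord separating the last meeting point from [p] would be met later still. *)
have beyond a b : S (E a b) -> det a b p < 0 -> 0 < det a b (mix t q0 p) -> False.
  move=> Sab dab; rewrite det_mix => h.
  set h0 := det a b q0 in h; set h1 := det a b p in dab h.
  have h00 : 0 < h0 - h1 by nra.
  have ts : t < tau (a, b) by rewrite /tau /= -/h0 -/h1 ltr_pdivlMr //; lra.
  have s1 : tau (a, b) <= 1 by rewrite /tau /= -/h0 -/h1 ler_pdivrMr //; lra.
  have : F (a, b).
    split=> //; exists (tau (a, b)); first lra.
    by rewrite /= det_mix /tau /= -/h0 -/h1; field; rewrite gt_eqF.
  by move/umax; lra.
(* The meeting point is interior to the chord [u v], hence strictly on the inner side of the other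
   two sides. *)
have [k hk kE] := open_chordP (Z_S1 Zadm Zu) (Z_S1 Zadm Zv) nuv qt1 d0.
have [w Zw dw] := S_side Zadm Scl Suv.
have euv : is_edge Z S u v by apply: Or31.
have [z tt] := triangle_left_of euv Zw dw; exists u, v, z; split=> //.
have [_ _ _ d3] := tt.
split=> // [_|Svz|Szu]; first exact: ltW.
  rewrite leNgt; apply/negP => /(beyond _ _ Svz); apply.
  by rewrite kE det_mix det_xyx mulr0 addr0 -(det_cyc u v z) mulr_gt0 //; lra.
rewrite leNgt; apply/negP => /(beyond _ _ Szu); apply.
by rewrite kE det_mix det_xyy mulr0 add0r (det_cyc z u v) mulr_gt0 //; lra.
Qed.

End Triangulation.

(** * The glued map on the geometric realization *)

Section Realize.
Context {R : realType} (Z : set (plane R)) (S : set {fset plane R}).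
Context (Zadm : admissible Z) (Scl : is_cluster Z S).
Implicit Types (p x y z u v w : plane R) (f : plane R -> R) (s : {fset plane R}).

Local Notation tri := (tri Z S).
Local Notation region := (region S).
Local Notation K := (cluster_complex Z S).
Local Notation RK := (realization R (cluster_complex Z S)).
Local Notation simplex := Defs.simplex.
Local Notation face := Defs.face.

Lemma simplex_sub s s' f : (s `<=` s')%fset -> simplex s f -> simplex s' f.
Proof.
move=> /fsubsetP ss [h1 h2 h3].
have h2' v : v \notin s' -> f v = 0 by move=> vs; apply: h2; apply: contra vs; exact: ss.
by split=> //; rewrite -h3; exact: sum_support_eq.
Qed.

Lemma simplex_shrink s s' f : simplex s' f -> (forall v, v \notin s -> f v = 0) -> simplex s f.
Proof. by move=> [h1 h2 h3] h; split=> //; rewrite -h3; exact: sum_support_eq. Qed.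

Lemma tri_K x y z : tri x y z -> K [fset x; y; z]%fset.
Proof.
by move=> [? ? ? _]; apply: Or33; exists x, y, z; split=> //; split=> //; exact: edge_sym.
Qed.

Lemma edges_tri x y z : is_edge Z S x y -> is_edge Z S y z -> is_edge Z S x z ->
  tri x y z \/ tri y x z.
Proof.
move=> exy eyz exz; have [Zx Zy nxy] := edge_Z Scl exy.
have [_ Zz nyz] := edge_Z Scl eyz; have [_ _ nxz] := edge_Z Scl exz.
have : det x y z != 0 by apply: (det_neq0 Zadm) => //; exact: nesym.
rewrite neq_lt => /orP[d|d]; [right|left]; split=> //; try exact: edge_sym.
by rewrite det_swap oppr_gt0.
Qed.

(** The chart of a closed triangle of the realization by barycentric triples, giving access to
    compactness of [bary]. *)
Definition spike x y z (t : R * R * R) : plane R -> R := fun v =>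
  if v == x then t.1.1 else if v == y then t.1.2 else if v == z then t.2 else 0.

Lemma spike_continuous x y z : continuous (spike x y z : R * R * R -> {ptws plane R -> R}).
Proof.
move=> t; apply/pointwise_cvgP => v.
change ((fun u : R * R * R => spike x y z u v) @ t --> spike x y z t v); rewrite /spike.
case: (v == x); first by apply: (@continuous_comp _ _ _ fst fst); exact: cvg_fst.
case: (v == y); first by apply: (@continuous_comp _ _ _ fst snd); [exact: cvg_fst|exact: cvg_snd].
by case: (v == z); [exact: cvg_snd|exact: cvg_cst].
Qed.

Lemma spike_simplex x y z t : tri x y z -> bary t.1.1 t.1.2 t.2 ->
  [/\ simplex [fset x; y; z]%fset (spike x y z t), spike x y z t x = t.1.1,
      spike x y z t y = t.1.2 & spike x y z t z = t.2].
Proof.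
move=> tt b; have [nxy nyz nzx] := tri_neq Scl tt.
have ex : spike x y z t x = t.1.1 by rewrite /spike eqxx.
have ey : spike x y z t y = t.1.2 by rewrite /spike (_ : y == x = false) ?eqxx //; apply/eqP/nesym.
have ez : spike x y z t z = t.2.
  have zx : (z == x) = false by apply/eqP.
  have zy : (z == y) = false by apply/eqP/nesym.
  by rewrite /spike zx zy eqxx.
split=> //; apply/(tri_simplexP Scl) => //; rewrite ex ey ez; split=> // v /eqP vx /eqP vy /eqP vz.
by rewrite /spike (negbTE vx) (negbTE vy) (negbTE vz).
Qed.

Lemma spikeK x y z f : tri x y z -> simplex [fset x; y; z]%fset f ->
  spike x y z (f x, f y, f z) = f.
Proof.
move=> tt /(tri_simplexP Scl f tt)[_ h]; apply/funext => v; rewrite /spike /=.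
have [->//|/eqP v1] := eqVneq v x; have [->//|/eqP v2] := eqVneq v y.
by have [->//|/eqP v3] := eqVneq v z; rewrite h.
Qed.

Lemma PhiF_spike x y z t : tri x y z -> bary t.1.1 t.1.2 t.2 ->
  PhiF Z x y z (spike x y z t) = Phi Z x y z t.1.1 t.1.2 t.2.
Proof. by move=> tt b; have [_ e1 e2 e3] := spike_simplex tt b; rewrite /PhiF e1 e2 e3. Qed.

Lemma PhiF_continuous x y z : continuous (PhiF Z x y z : {ptws plane R -> R} -> plane R).
Proof.
move=> f; rewrite /PhiF.
have ev v : (fun h : {ptws plane R -> R} => h v) @ f --> f v.
  by have /pointwise_cvgP := @cvg_id _ (nbhs (f : {ptws plane R -> R})); apply.
have H : (fun h : {ptws plane R -> R} => (h x, h y, h z)) @ f --> (f x, f y, f z).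
  exact: (cvg_triple _ (ev x) (ev y) (ev z)).
exact: (cvg_comp _ _ H (@Phi_continuous R Z x y z (f x, f y, f z))).
Qed.

Lemma compact_bary : compact [set t : R * R * R | bary t.1.1 t.1.2 t.2].
Proof.
have c01 := @segment_compact R 0 1.
apply: (subclosed_compact _ (compact_setX (compact_setX c01 c01) c01)); last first.
  by move=> t [? ? ? ?]; split; [split|]; rewrite /= in_itv /=; lra.
have p1 : continuous (fun t : R * R * R => t.1.1).
  by move=> t; apply: (@continuous_comp _ _ _ fst fst); exact: cvg_fst.
have p2 : continuous (fun t : R * R * R => t.1.2).
  by move=> t; apply: (@continuous_comp _ _ _ fst snd); [exact: cvg_fst|exact: cvg_snd].
have p3 : continuous (fun t : R * R * R => t.2) by move=> t; exact: cvg_snd.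
rewrite (_ : mkset _ = ((fun t : R * R * R => t.1.1) @^-1` [set a | 0 <= a]) `&`
  ((fun t : R * R * R => t.1.2) @^-1` [set a | 0 <= a]) `&`
  ((fun t : R * R * R => t.2) @^-1` [set a | 0 <= a]) `&`
  ((fun t : R * R * R => t.1.1 + t.1.2 + t.2) @^-1` [set 1])).
  apply: closedI; [apply: closedI; [apply: closedI|]|].
  - by apply: preimage_closed => [t _|]; [exact: p1|exact: closed_ge].
  - by apply: preimage_closed => [t _|]; [exact: p2|exact: closed_ge].
  - by apply: preimage_closed => [t _|]; [exact: p3|exact: closed_ge].
  - apply: preimage_closed => [t _|]; last exact: closed_eq.
    by apply: cvgD; [apply: cvgD; [exact: p1|exact: p2]|exact: p3].
by apply/seteqP; split=> t; [case|case=> -[[]]].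
Qed.

Context (conv : edges_converge Z S).

Lemma K_triangle s : K s -> exists x y z, tri x y z /\ (s `<=` [fset x; y; z])%fset.
Proof.
case=> [[x [Zx ->]]|[x [y [exy ->]]]|[x [y [z [[exy eyz exz] ->]]]]].
- have [y [z t]] := vertex_triangle Zadm Scl conv Zx; exists x, y, z; split=> //.
  by apply/fsubsetP => v; rewrite !inE => ->.
- have [z [t|t]] := edge_triangle Zadm Scl conv exy; [exists x, y, z|exists y, x, z]; split=> //.
    by apply/fsubsetP => v; rewrite !inE => ->.
  by apply/fsubsetP => v; rewrite !inE orbC => ->.
- have [t|t] := edges_tri exy eyz exz; [exists x, y, z|exists y, x, z]; split=> //.
  by apply/fsubsetP => v; rewrite !inE (orbC (v == y)).
Qed.

Lemma point_triangle (q : RK) : exists t : plane R * plane R * plane R,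
  tri t.1.1 t.1.2 t.2 /\ simplex [fset t.1.1; t.1.2; t.2]%fset (sval q).
Proof.
have [s [Ks fs]] := svalP q; have [x [y [z [t ss]]]] := K_triangle Ks.
by exists (x, y, z); split=> //; exact: simplex_sub fs.
Qed.

(** The map in the Klein model; [PhiF_consistent] makes the arbitrary choice of a triangle
    immaterial. *)
Definition psi0 (q : RK) : plane R :=
  let t := projT1 (cid (point_triangle q)) in PhiF Z t.1.1 t.1.2 t.2 (sval q).

Lemma psi0E x y z (q : RK) : tri x y z -> simplex [fset x; y; z]%fset (sval q) ->
  psi0 q = PhiF Z x y z (sval q).
Proof.
move=> t qs; rewrite /psi0; case: cid => -[[x' y'] z'] /= [t' qs'].
exact: (PhiF_consistent Zadm Scl t' t).
Qed.

Lemma K_point x y z f : tri x y z -> simplex [fset x; y; z]%fset f ->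
  exists q : RK, sval q = f.
Proof.
move=> t fs; have h : exists s, K s /\ simplex s f by exists [fset x; y; z]%fset; split=> //; exact: tri_K.
by exists (exist _ f h).
Qed.

Lemma sval_inj (q q' : RK) : sval q = sval q' -> q = q'.
Proof. by case: q q' => [f hf] [f' hf'] /= e; exact: eq_exist. Qed.

Lemma psi0_inj : injective psi0.
Proof.
move=> q q' e; apply: sval_inj.
have [[[x y] z] [t qs]] := point_triangle q; have [[[x' y'] z'] [t' qs']] := point_triangle q'.
move: e; rewrite (psi0E t qs) (psi0E t' qs'); exact: (PhiF_inj Zadm Scl t t').
Qed.

Lemma psi0_region x y z (q : RK) : tri x y z -> simplex [fset x; y; z]%fset (sval q) ->
  region x y z (psi0 q).
Proof.
move=> t qs; rewrite (psi0E t qs); have [b _] := (tri_simplexP Scl _ t).1 qs.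
exact: Phi_region.
Qed.

Lemma psi0_face_tri x y z : tri x y z -> psi0 @` face [fset x; y; z]%fset = region x y z.
Proof.
move=> t; apply/seteqP; split=> [_ [q qs <-]|p rp]; first exact: psi0_region.
have [a [b [c [b3 ->]]]] := Phi_surj Zadm Scl t rp.
have [fs _ _ _] := @spike_simplex x y z (a, b, c) t b3; have [q qE] := K_point t fs.
exists q; first by rewrite /face /= qE.
by rewrite (psi0E t) qE // (@PhiF_spike x y z (a, b, c) t b3).
Qed.

Lemma psi0_range : range psi0 = D2 `\` limit_set Z.
Proof.
apply/seteqP; split=> [_ [q _ <-]|p [Dp nLp]].
  have [[[x y] z] [/= t qs]] := point_triangle q; have rq := psi0_region t qs.
  by split; [case: rq|exact: (region_limit Zadm Scl t rq)].
have [x [y [z [t rp]]]] := covering Zadm Scl conv Dp nLp.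
by move: rp; rewrite -(psi0_face_tri t) => -[q _ <-]; exists q.
Qed.

Lemma psi0_continuous : continuous psi0.
Proof.
apply/continuousP => O oO; suff : weak_open (psi0 @^-1` O) by [].
move=> s Ks; have [x [y [z [t ss]]]] := K_triangle Ks.
exists (PhiF Z x y z @^-1` O); split.
  by apply: open_comp => // f _; exact: PhiF_continuous.
by move=> q qs; rewrite /= (psi0E t) //; exact: simplex_sub qs.
Qed.

(** Through the chart [spike] the set is the continuous image of a compact set of barycentric
    triples. *)
Lemma psi0_closed_face x y z (U : set RK) : tri x y z -> open U ->
  closed (psi0 @` (face [fset x; y; z]%fset `\` U)).
Proof.
move=> t oU; have [W [oW WE]] := oU _ (tri_K t).
apply: compact_closed; first exact: norm_hausdorff.
rewrite (_ : _ @` _ = (fun q : R * R * R => Phi Z x y z q.1.1 q.1.2 q.2) @`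
  ([set t | bary t.1.1 t.1.2 t.2] `&` (spike x y z @^-1` (~` W)))).
  apply: continuous_compact; first by apply: continuous_subspaceT; exact: Phi_continuous.
  apply: compact_closedI; first exact: compact_bary.
  apply: (@open_closedC _ (spike x y z @^-1` W)).
  by apply: (@open_comp _ {ptws plane R -> R} (spike x y z)) => // c _; exact: spike_continuous.
apply/seteqP; split=> [_ [q [qs nU] <-]|_ [c [b nW] <-]].
  have [b _] := (tri_simplexP Scl _ t).1 qs.
  exists (sval q x, sval q y, sval q z); last by rewrite (psi0E t).
  by split=> //; rewrite /= spikeK // => /(WE _ qs).
have [fs _ _ _] := spike_simplex t b; have [q qE] := K_point t fs.
have qs : face [fset x; y; z]%fset q by rewrite /face /= qE.
exists q; last by rewrite (psi0E t qs) qE PhiF_spike.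
by split=> // /(WE _ qs); rewrite qE.
Qed.

(** Continuity of the inverse. A closed neighbourhood of [psi0 q] off the limit set meets finitely
    many triangles. The images of their parts outside [U] form a closed set, which misses [psi0 q]
    by injectivity. *)
Lemma psi0_open_nbhs (q : RK) (U : set RK) : open U -> U q ->
  nbhs (psi0 q) [set p | forall q', psi0 q' = p -> U q'].
Proof.
move=> oU Uq; have [_ nL] : (D2 `\` limit_set Z) (psi0 q) by rewrite -psi0_range; exists q.
have [N [Nq cN NL]] := closed_nbhs_off (@closed_limit_set R Z) nL.
have fin := triangles_finite Zadm Scl conv cN NL; set T := mkset _ in fin.
pose B := \bigcup_(t in T) (psi0 @` (face [fset t.1.1; t.1.2; t.2]%fset `\` U)).
have cB : closed B.
  by apply: closed_bigcup => // t [tt _]; exact: psi0_closed_face.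
have nB : ~ B (psi0 q) by move=> [t _ [q' [_ nU] /psi0_inj e]]; apply: nU; rewrite e.
have : nbhs (psi0 q) (N `&` ~` B).
  by apply: filterI => //; apply: open_nbhs_nbhs; split=> //; exact: closed_openC.
apply: filterS => p [Np nBp] q' e; apply: contrapT => nU; apply: nBp.
have [[[x y] z] [/= t qs]] := point_triangle q'.
exists (x, y, z); last by exists q'.
by split=> //; exists p => //; rewrite -e; exact: psi0_region.
Qed.

Lemma psi0_vertex z (q : RK) : Z z -> face [fset z]%fset q -> psi0 q = z.
Proof.
move=> Zz qs; have [y [x t]] := vertex_triangle Zadm Scl conv Zz.
have [nzy nyx nxz] := tri_neq Scl t.
have [_ h0] := qs; rewrite big_seq_fset1 => q1.
have qs3 : simplex [fset z; y; x]%fset (sval q).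
  by apply: simplex_sub qs; apply/fsubsetP => v; rewrite !inE => ->.
have [/(Z_S1 Zadm) hz /(Z_S1 Zadm) hy /(Z_S1 Zadm) hx] := tri_Z Scl t.
rewrite (psi0E t qs3) (PhiF_edge Zadm Scl t qs3); last by apply: h0; rewrite inE; apply/eqP.
rewrite q1 (h0 y); last by rewrite inE; apply/eqP/nesym.
by rewrite emap_s0 // scale1r.
Qed.

Lemma psi0_face_edge x y : is_edge Z S x y ->
  psi0 @` face [fset x; y]%fset = [set ept Z x y t | t in [set t | 0 <= t <= 1]].
Proof.
have base u v w : tri u v w ->
    psi0 @` face [fset u; v]%fset = [set ept Z u v t | t in [set t | 0 <= t <= 1]].
  move=> t; have [nuv nvw nwu] := tri_neq Scl t.
  apply/seteqP; split=> [_ [q qs <-]|_ [k /= hk <-]].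
    have qs3 : simplex [fset u; v; w]%fset (sval q).
      by apply: simplex_sub qs; apply/fsubsetP => z; rewrite !inE => ->.
    have qw : sval q w = 0.
      by have [_ h _] := qs; apply: h; rewrite !inE; apply/norP; split; apply/eqP => //; exact: nesym.
    have [[q0 q1 _ e] _] := (tri_simplexP Scl _ t).1 qs3.
    exists (sval q v); first by rewrite /=; rewrite qw in e; lra.
    rewrite (psi0E t qs3) (PhiF_edge Zadm Scl t qs3 qw) /ept; congr emap.
    by rewrite -e qw; ring.
  have b : bary (1 - k) k 0 by split; lra.
  have [fs e1 e2 e3] := @spike_simplex u v w (1 - k, k, 0) t b.
  have [q qE] := K_point t fs; have qs3 : simplex [fset u; v; w]%fset (sval q) by rewrite qE.
  exists q.
    apply: simplex_shrink qs3 _ => z; rewrite !inE => /norP[/eqP zu /eqP zv]; rewrite qE.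
    have [->|/eqP zw] := eqVneq z w; first by rewrite e3.
    by have [_ h] := (tri_simplexP Scl _ t).1 fs; exact: h.
  by rewrite (psi0E t qs3) (PhiF_edge Zadm Scl t qs3) qE ?e1 ?e2 ?e3.
move=> exy; have [z [t|t]] := edge_triangle Zadm Scl conv exy; first exact: base t.
rewrite fsetUC (base _ _ _ t); apply/seteqP; split=> _ [k /= hk <-]; (exists (1 - k) => /=; [lra|by rewrite -eptC]).
Qed.

Lemma psi0_face_boundary x y z : tri x y z ->
  psi0 @` face_boundary [fset x; y; z]%fset = region x y z `\` region0 S x y z.
Proof.
move=> t; apply/seteqP; split=> [_ [q [qs [v [vs v0]]] <-]|p [rp nrp]].
  split; first exact: psi0_region.
  have [b _] := (tri_simplexP Scl _ t).1 qs.
  rewrite (psi0E t qs) => /(Phi_region0 Zadm Scl t b)[q1 q2 q3].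
  by move: vs; rewrite !inE => /orP[/orP[]|] /eqP ve; move: q1 q2 q3; rewrite -ve v0 ltxx.
move: rp; rewrite -(psi0_face_tri t) => -[q qs qE]; exists q => //; split=> //.
have [b h] := (tri_simplexP Scl _ t).1 qs; have [b1 b2 b3 _] := b.
apply: contrapT => nv; apply: nrp; rewrite -qE (psi0E t qs); apply/(Phi_region0 Zadm Scl t b).
have pos v : v \in [fset x; y; z]%fset -> 0 <= sval q v -> 0 < sval q v.
  by move=> vs; rewrite le_eqVlt => /orP[/eqP e|//]; case: nv; exists v.
by split; apply: pos => //; rewrite !inE eqxx ?orbT.
Qed.

End Realize.

(** * The equivalence *)

Section Enclosed.
Context {R : realType} (Z : set (plane R)) (S : set {fset plane R}).
Context (Zadm : admissible Z) (Scl : is_cluster Z S).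
Implicit Types (p q x y z : plane R).

Lemma D2_norm p : D2 p -> `|p| <= 1.
Proof.
rewrite /D2 /sqnorm /= => h; rewrite prod_normE ge_max /=.
by rewrite !ler_norml; nra.
Qed.

Lemma ray_unbounded p q (M : R) : p <> q -> exists2 s, 1 <= s & M < `|mix s q p|.
Proof.
move=> pq; have d0 : 0 < `|p - q| by rewrite normr_gt0 subr_eq0; apply/eqP.
have q0 : 0 <= (`|M| + `|q| + 1) / `|p - q| by rewrite divr_ge0 // !addr_ge0.
exists (1 + (`|M| + `|q| + 1) / `|p - q|); first lra.
have -> s : mix s q p = s *: (p - q) + q.
  by rewrite mixE; apply: plane_eqP => /=; rewrite /GRing.scale /=; ring.
apply: lt_le_trans (lerB_normD _ _); rewrite normrZ ger0_norm; last lra.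
rewrite mulrDl mul1r divfK ?gt_eqF //; have := ler_norm M; lra.
Qed.

(** From a point outside the convex region, the ray pointing away from [g] never meets the region
    and is unbounded. The component of an interior point stays within [region0], which is
    bounded. *)
Lemma enclosed_region x y z : tri Z S x y z ->
  enclosed (kinv @` (region S x y z `\` region0 S x y z)) = kinv @` region S x y z.
Proof.
move=> t; have g0 := region0_centroid Zadm Scl t.
move: (centroid x y z) g0 => g g0; have rg := region0_sub g0.
have C0C := @region0_sub R S x y z.
have cC := @closed_region R S x y z; have oC0 := @open_region0 R S x y z.
have Cmix := @region_mix R S x y z.
have CD : region S x y z `<=` D2 by move=> p [].
move: (region S x y z) (region0 S x y z) C0C cC oC0 Cmix CD g0 rg => C C0 C0C cC oC0 Cmix CD g0 rg.
set J := kinv @` _.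
have kinv_inj : injective (kinv : plane R -> plane R) := can_inj (@kinvK R).
have JE p : J (kinv p) <-> C p /\ ~ C0 p.
  by split=> [[q [? ?] /kinv_inj <-]//|[? ?]]; exists p.
apply/seteqP; split=> p.
- rewrite -(kapK p); move: (kap p) => {}p; case=> [/JE[Cp _]|[nJ bd]]; first by exists p.
  exists p => //; apply: contrapT => nC.
  have pg : p <> g by move=> e; apply: nC; rewrite e.
  pose T := (fun s => kinv (mix s g p)) @` [set s : R | 1 <= s].
  have Tp : T (kinv p) by exists 1; rewrite /= ?lexx // mix1.
  have TJ : T `<=` ~` J.
    move=> _ [s /= s1 <-] /JE[Cs _]; apply: nC.
    rewrite (_ : p = mix s^-1 g (mix s g p)).
      apply: Cmix => //; rewrite invr_ge0 invf_le1; lra.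
    have n0 : s != 0 by rewrite gt_eqF // (lt_le_trans ltr01).
    by rewrite !mixE; apply: plane_eqP => /=; field.
  have cT : connected T.
    apply: connected_continuous_connected.
      apply/connected_intervalP => a b /= a1 b1 c /andP[ac _]; exact: le_trans a1 ac.
    apply: continuous_subspaceT => s.
    apply: (@continuous_comp _ _ _ (fun s => mix s g p) kinv); last exact: kinv_continuous.
    rewrite /mix; apply: cvgD; apply: cvgZ; try exact: cvg_cst; last exact: cvg_id.
    by apply: cvgB; [exact: cvg_cst|exact: cvg_id].
  have TC := connected_component_max Tp TJ cT.
  have [M [Mreal bM]] := bd; pose M' := Num.max M 1 + 1.
  have [s s1 Ms] := ray_unbounded M' pg.
  have M1 : 1 < `|mix s g p|.
    by apply: le_lt_trans Ms; rewrite /M' ler_wpDr // le_max lexx orbT.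
  (* Far out the map to the Poincare disk is the identity, so the image of the ray is unbounded as
     well. *)
  have out : kinv (mix s g p) = mix s g p.
    by apply: kinv_out; rewrite leNgt; apply/negP => /ltW/D2_norm; rewrite leNgt M1.
  have : `|kinv (mix s g p)| <= M'.
    apply: bM; first by rewrite /M' ltr_pwDr // le_max lexx.
    by apply: TC; exists s.
  by rewrite out leNgt Ms.
- move=> [q Cq <-]; have [C0q|nC0q] := pselect (C0 q); last by left; exact/JE.
  have nJq : ~ J (kinv q) by move/JE => -[].
  right; split => //.
  pose A := kap @` connected_component (~` J) (kinv q).
  have cA : connected A.
    apply: connected_continuous_connected; first exact: component_connected.
    exact/continuous_subspaceT/kap_continuous.
  have Aq : A q by exists (kinv q); [exact: connected_component_refl|exact: kinvK].
  have AC : A `&` C0 = A `&` C.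
    apply/seteqP; split=> r [Ar Cr]; split=> //; first exact: C0C.
    apply: contrapT => nC0; have [r' cr' rE] := Ar.
    apply: (connected_component_sub cr'); rewrite -(kapK r') rE; exact/JE.
  have AE : A `&` C0 = A by apply: cA; [exists q|exists C0|exists C].
  exists 1; split; first exact: num_real.
  move=> M M1 {}p cp; apply: le_trans (ltW M1); apply: D2_norm.
  rewrite -(kapK p); apply: kinv_D2; apply: CD; apply: C0C.
  suff [] : (A `&` C0) (kap p) by [].
  by rewrite AE; exists p.
Qed.

End Enclosed.

(** * From convergence to a triangulation *)

Section Forward.
Context {R : realType} (Z : set (plane R)) (S : set {fset plane R}).
Context (Zadm : admissible Z) (Scl : is_cluster Z S).
Implicit Types (p x y z u v w : plane R).

Local Notation K := (cluster_complex Z S).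
Local Notation RK := (realization R (cluster_complex Z S)).
Local Notation face := Defs.face.

Context (conv : edges_converge Z S).

Lemma triangulation_of_convergence : triangulation_cluster Z S.
Proof.
have [x0 [y0 [z0 t0]]] : exists x y z, tri Z S x y z.
  have [x [Zx _ _ _]] := Z_fourth Zadm 0 0 0.
  by have [y [z t]] := vertex_triangle Zadm Scl conv Zx; exists x, y, z.
pose P0 := psi0 Zadm Scl conv.
have P0inj : injective P0 := @psi0_inj _ _ _ _ _ _.
have [q0 _] : exists q : RK, True.
  have : region S x0 y0 z0 (centroid x0 y0 z0) by apply: region0_sub; exact: (region0_centroid Zadm Scl t0).
  by rewrite -(psi0_face_tri Zadm Scl conv t0) => -[q _ _]; exists q.
pose psi q := kinv (P0 q).
(* [kinv] preserves the disk and fixes [S1], which contains the limit set. *)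
have D2L p : (D2 `\` limit_set Z) (kinv p) <-> (D2 `\` limit_set Z) p.
  split=> -[Dp nL]; split.
  - by rewrite -(kinvK p); exact: kap_D2.
  - by move=> Lp; apply: nL; rewrite kinv_S1 //; exact: Lp.1.
  - exact: kinv_D2.
  - by move=> Lp; apply: nL; rewrite -(kinvK p) kap_S1 //; exact: Lp.1.
have psi_range : range psi = D2 `\` limit_set Z.
  apply/seteqP; split=> [_ [q _ <-]|p].
    by apply/D2L; rewrite -(psi0_range Zadm Scl conv); exists q.
  rewrite -(kapK p) => /D2L; rewrite -(psi0_range Zadm Scl conv) => -[q _ e].
  by exists q => //; rewrite /psi /P0 e.
have cpsi : continuous psi.
  move=> q; apply: (@continuous_comp _ _ _ P0 kinv); first exact: psi0_continuous.
  exact: kinv_continuous.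
(* The inverse on the range of [psi]; elsewhere it takes the default value [q0]. *)
pose g p := xget q0 [set q | P0 q = kap p].
have gE q p : P0 q = kap p -> g p = q.
  move=> e; rewrite /g; case: xgetP => [q' _ e'|/(_ q)//].
  by apply: P0inj; rewrite e.
have gK : cancel psi g by move=> q; apply: gE; rewrite /psi kinvK.
have cg : {within D2 `\` limit_set Z, continuous g}.
  apply/subspace_continuousP => p; rewrite -psi_range => -[q _ qE] U gU.
  have gp : g p = q by rewrite -qE gK.
  have kp : P0 q = kap p by rewrite -qE /psi kinvK.
  have qU : nbhs q U by rewrite -gp; exact: gU.
  have [U' [oU' U'q] sU] : exists2 B, open_nbhs q B & B `<=` U by move: qU; rewrite nbhsE.
  have := psi0_open_nbhs Zadm Scl conv oU' U'q; rewrite -/P0 kp => nU.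
  suff : nbhs p [set p' | range psi p' -> U (g p')] by [].
  apply: (@filterS _ (nbhs p) _ _ _ _ (kap_continuous nU)) => p' h [q' _ e].
  by apply: sU; rewrite -e gK; apply: h; rewrite -e /psi kinvK.
(* From here on only the images of the simplices remain to be computed. *)
have hom A B : psi @` A = B -> homeo_onto A B psi.
  move=> AB; have BD : B `<=` D2 `\` limit_set Z by rewrite -AB -psi_range; exact: image_subset.
  exact: homeo_onto_image cpsi gK cg BD AB.
exists psi; split; last exact: hom.
have imc A : psi @` A = kinv @` (P0 @` A) by rewrite image_comp.
split.
- move=> z q Zz qz; rewrite /psi /P0 (psi0_vertex Zadm Scl conv Zz qz) kinv_S1 //.
  exact: Z_S1 Zz.
- move=> x y sxy; apply: hom; rewrite imc psi0_face_edge; last exact: Or32.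
  have [Zx Zy nxy _] := sxy.
  apply/seteqP; split=> [_ [_ [t /= ht <-] <-]|p /(circle_arcP _ (Z_S1 Zadm Zx) (Z_S1 Zadm Zy) nxy)].
    have [|pS d] := (ept_succP Zadm (ept Z x y t) sxy).1; first by exists t.
    by rewrite kinv_S1 //; apply/circle_arcP => //; [exact: Z_S1 Zx|exact: Z_S1 Zy].
  move=> h; have [pS _] := h; have [t ht pE] := (ept_succP Zadm p sxy).2 h.
  by exists p; [exists t|exact: kinv_S1].
- move=> x y Sxy; apply: hom; rewrite imc psi0_face_edge; last exact: Or31.
  have [Zx Zy nxy _ _] := S_edge Scl Sxy.
  have [hx hy] := (Z_S1 Zadm Zx, Z_S1 Zadm Zy).
  apply/seteqP; split=> [_ [_ [t /= ht <-] <-]|p].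
    apply/geodesic_kinv => //; apply/(ept_SP Zadm Scl) => //; by exists t.
  rewrite -(kapK p) => /(geodesic_kinv _ hx hy nxy)/(ept_SP Zadm Scl _ Sxy)[t ht pE].
  by exists (kap p) => //; exists t.
- have base x y z : tri Z S x y z -> homeo_onto (face [fset x; y; z]%fset)
    (enclosed (psi @` face_boundary [fset x; y; z]%fset)) psi.
    move=> t; apply: hom; rewrite !imc psi0_face_boundary // psi0_face_tri //.
    by rewrite (enclosed_region Zadm Scl t).
  move=> x y z exy eyz exz; have [t|t] := edges_tri Zadm Scl exy eyz exz; first exact: base.
  by rewrite (fsetUC [fset x]%fset); exact: base.
Qed.

End Forward.

(** * From a triangulation to convergence *)

Section Backward.
Context {R : realType} (Z : set (plane R)) (S : set {fset plane R}).
Context (Zadm : admissible Z) (Scl : is_cluster Z S).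
Implicit Types (p u v w : plane R).

Lemma convergence_of_triangulation (x y : nat -> plane R) w : triangulation_cluster Z S ->
  (forall i, S (E (x i) (y i))) -> limit_set Z w -> x @ \oo --> w -> y @ \oo --> w.
Proof.
move=> [psi [[psiV _ psiE _] [[psi_fun _ _] _ [g [cg gK]]]]] Sxy lw xw.
have Zxy i : [/\ Z (x i), Z (y i) & x i <> y i] by have [] := S_edge Scl (Sxy i).
(* The limit [w] is not in [Z], so a finite set contains [x i] for finitely many [i] only. *)
have fin_ev (s : {fset plane R}) : \forall i \near \oo, x i \notin s.
  have cs : closed ([set` s] `\ w).
    by apply: (accessible_finite_set_closed.1 (hausdorff_accessible (@norm_hausdorff _ _))); exact/finite_setD/finite_fset.
  have nw : nbhs w (~` ([set` s] `\ w)).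
    by apply: open_nbhs_nbhs; split; [exact: closed_openC|move=> -[_ /(_ erefl)]].
  apply: (@filterS _ \oo _ _ _ _ (xw _ nw)) => i h; apply/negP => xs; apply: h; split=> //= e.
  by have [Zx _ _] := Zxy i; apply: (limit_set_notin Zadm Zx); rewrite e.
pose m i := mix 2^-1 (x i) (y i).
pose q i := g (kinv (m i)).
have m1 i : sqnorm (m i) < 1.
  by have [Zx Zy nxy] := Zxy i; apply: open_chord_lt1; [exact: Z_S1 Zx|exact: Z_S1 Zy| |lra].
have open_disk p : sqnorm p < 1 -> (D2 `\` limit_set Z) p.
  move=> p1; split; first exact: ltW.
  by move=> [pS _]; move: p1; rewrite (pS : sqnorm p = 1) ltxx.
have qP i : Defs.face [fset x i; y i]%fset (q i) /\ psi (q i) = kinv (m i).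
  have [Zx Zy nxy] := Zxy i.
  have [[_ _ sur] _ _] := psiE _ _ (Sxy i).
  have [|q' fq' e] := sur (kinv (m i)).
    apply/geodesic_kinv; [exact: Z_S1 Zx|exact: Z_S1 Zy|exact: nxy|].
    by split; [exact: ltW|rewrite det_mix det_xyx det_xyy; ring].
  by rewrite /q -e gK.
(* If the coordinate at [x i] vanished, [q i] would be the vertex [y i], which [psi] sends to [S1],
   not into the open disk. *)
have qx i s : Defs.face s (q i) -> x i \in s.
  move=> [_ h _]; apply: contraT => /h x0; have [[f1 f2 f3] e] := qP i.
  have [Zx Zy nxy] := Zxy i.
  have : Defs.face [fset y i]%fset (q i).
    split=> //.
      move=> v; rewrite inE => vy; have [->//|vx] := eqVneq v (x i).
      by apply: f2; rewrite !inE (negbTE vx).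
    move: f3; rewrite big_fsetU1 /= ?big_seq_fset1 ?x0 ?add0r //.
    by rewrite inE; apply/eqP.
  move/(psiV _ _ Zy); rewrite e => e'.
  by have := kinv_lt1 (m1 i); rewrite e' (Z_S1 Zadm Zy : sqnorm _ = 1) ltxx.
apply: contrapT => nyw.
have [e [e0 he]] : exists e : R, 0 < e /\ ~ \forall i \near \oo, ball w e (y i).
  apply: contrapT => h; apply: nyw; apply/cvg_ballP => e e0.
  by apply: contrapT => h'; apply: h; exists e.
pose A := [set i | ~ ball w e (y i)].
(* Only indices with [y i] away from [w] are kept, so that a cluster point [v] of [y] along [F]
   differs from [w]. *)
pose F := within A \oo.
have FF : ProperFilter F.
  split; last exact: within_filter.
  by move=> F0; apply: he; apply: (@filterS _ \oo _ _ _ _ F0) => i nA; apply: contrapT => Ai; exact: nA.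
have [|v [vS cv]] := @compact_S1 R (y @ F) _.
  by apply: (@filterE _ F) => i; have [_ Zy _] := Zxy i; exact: Z_S1 Zy.
have vw : w <> v.
  move=> wv; have [||_ [[i Ai <-] Bi]] := cv (y @` A) (ball w e).
  - by apply: (@filterE _ \oo) => i Ai; exists i.
  - by rewrite -wv; exact: nbhsx_ballx.
  - exact: Ai Bi.
pose p := kinv (mix 2^-1 w v).
have p1 : sqnorm p < 1 by apply: kinv_lt1; apply: open_chord_lt1 => //; [exact: lw.1|lra].
have [s [_ fs]] := svalP (g p).
have [N _ hN] := fin_ev s.
(* For [i >= N] the point [x i] is not a vertex of the simplex [s] carrying [g p]; hence [g p] is in
   [U]. *)
pose U : set (realization R (cluster_complex Z S)) := ~` (q @` [set i | (N <= i)%N]).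
have oU : weak_open U.
  move=> s' _; have [N' _ hN'] := fin_ev s'.
  (* Within [s'] only the indices below [N'] can occur, so the trace of [U] is the complement of a
     finite, hence closed, set. *)
  exists (~` ((fun i => sval (q i)) @` [set i | (N <= i)%N /\ (i < N')%N])); split.
    apply: closed_openC; apply: (accessible_finite_set_closed.1 (hausdorff_accessible _)).
      by apply: hausdorff_product => _; exact: norm_hausdorff.
    apply: finite_image; apply: sub_finite_set (finite_II N') => i; by case.
  move=> q' fq'; split=> h.
    by move=> [i [Ni _] /sval_inj e1]; apply: h; exists i.
  move=> [i Ni e1]; apply: h; exists i; last by rewrite e1.
  split=> //; rewrite ltnNge; apply/negP => /hN'; rewrite -e1 in fq'.
  by rewrite /= (qx _ _ fq').
have Up : U (g p).
  by move=> [i Ni e1]; have := hN i Ni; rewrite /= qx // e1.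
have Unb : nbhs (g p) U by apply: open_nbhs_nbhs; split.
have nU := (subspace_continuousP _ _).1 cg p (open_disk _ p1) U Unb.
have mc : (fun ab : plane R * plane R => kinv (mix 2^-1 ab.1 ab.2)) @ (w, v) --> p.
  have mm : (fun ab : plane R * plane R => mix 2^-1 ab.1 ab.2) @ (w, v) --> mix 2^-1 w v.
    by rewrite /mix; apply: cvgD; apply: cvgZ; (exact: cvg_cst || exact: cvg_fst || exact: cvg_snd).
  exact: (cvg_comp _ _ mm (@kinv_continuous R (mix 2^-1 w v))).
have [[B1 B2] /= [wB1 vB2] hB] := mc _ nU.
(* Continuity of [g] at [p] sends midpoints of chords with ends near [w] and [v] into [U], although
   [U] omits all late [q i]. *)
have [||_ [[i [[Ni B1i] Ai] <-] B2i]] := cv (y @` ([set i | (N <= i)%N /\ B1 (x i)] `&` A)) B2.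
- have : \forall i \near \oo, (N <= i)%N /\ B1 (x i).
    by apply: filterI; [exact: nbhs_infty_ge|exact: xw wB1].
  by apply: filterS => i ? Ai; exists i.
- exact: vB2.
- have : U (q i) := hB (x i, y i) (conj B1i B2i) (open_disk _ (kinv_lt1 (m1 i))).
  by apply; exists i.
Qed.

End Backward.

Theorem theorem4p19 (R : realType) (Z : set (plane R))
    (S : set {fset plane R}) :
  admissible Z -> is_cluster Z S ->
  (triangulation_cluster Z S <->
  (forall (x y : nat -> plane R) (w : plane R),
     (forall i, S (E (x i) (y i))) -> limit_set Z w ->
     (x @ \oo --> w <-> y @ \oo --> w))).
Proof.
move=> Zadm Scl; split=> [tr x y w Sxy lw|conv].
  split; first exact: (convergence_of_triangulation Zadm Scl tr Sxy lw).
  apply: (convergence_of_triangulation Zadm Scl tr _ lw) => i.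
  by rewrite E_sym.
exact: triangulation_of_convergence.
Qed.
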